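(* Let $F_\hbar[[G]]$ be a QFSHA over the formal Poisson group $G$, with tangent Lie bialgebra $\mathfrak g=(\mathfrak g;[\ ,\ ],\delta)$. Let $\sigma$ be a 2-cocycle for $F_\hbar[[G]]$ such that $\sigma\equiv\epsilon^{\otimes 2}\ \big(\mathrm{mod}\ \hbar\,(F_\hbar[[G]]^{\widetilde\otimes 2})^{*}\big)$; then $\varsigma:=\hbar^{-1}\log_*(\sigma)\in(F_\hbar[[G]]^{\widetilde\otimes 2})^{*}$, where $\log_*$ is the logarithm for the convolution product, and $\sigma=\exp_*(\hbar\,\varsigma)$. Set $\varsigma_a:=\varsigma-\varsigma_{2,1}$. Then: (a) $\varsigma$ is antisymmetric, i.e. $\varsigma_{2,1}=-\varsigma$, if and only if $\sigma$ is orthogonal, i.e. $\sigma_{2,1}=\sigma^{-1}$ (convolution inverse); (b) the form $\overline{\varsigma_a}:=\varsigma_a\ \big(\mathrm{mod}\ \hbar\,(F_\hbar[[G]]^{\widetilde\otimes 2})^{*}\big)$ on $F[[G]]\widetilde\otimes F[[G]]$ induces, by restriction to $\mathfrak m\otimes\mathfrak m$ and passage to the quotient $(\mathfrak m/\mathfrak m^2)\otimes(\mathfrak m/\mathfrak m^2)=\mathfrak g^*\otimes\mathfrak g^*$, a well-defined element $\zeta\in(\mathfrak g^*\otimes\mathfrak g^* )^*=\mathfrak g\otimes\mathfrak g$, which is an antisymmetric 2-cocycle for the Lie bialgebra $\mathfrak g^*$; (c) the deformation $F_\hbar[[G]]_\sigma$ of $F_\hbar[[G]]$ by the 2-cocycle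 $\sigma$ is a QFSHA for the formal Poisson group $G_\zeta$ whose cotangent Lie bialgebra is $\mathrm{Lie}(G_\zeta)^*=(\mathfrak g^* )_\zeta=(\mathfrak g^*;([\ ,\ ]_* )_\zeta,\delta_* )$, the deformation of $\mathfrak g^*=(\mathfrak g^*;[\ ,\ ]_*,\delta_* )$ by the 2-cocycle $\zeta$. In short, $F_\hbar[[G]]_\sigma\cong F_\hbar[[G_\zeta]]$.
   Context: $\Bbbk$ is a field of characteristic $0$. QFSHA: consider topological $\Bbbk[[\hbar]]$-modules isomorphic to $\Bbbk[[\hbar]]^{E}$ ($E$ a set) with the weak (product) topology, and the completed tensor product $\widetilde\otimes$, for which $\Bbbk[[\hbar]]^{E_1}\widetilde\otimes\,\Bbbk[[\hbar]]^{E_2}\cong\Bbbk[[\hbar]]^{E_1\times E_2}$. A QFSHA is a topological Hopf algebra $F_\hbar$ of this type (with respect to $\widetilde\otimes$) such that $F_\hbar/\hbar F_\hbar$ is commutative and complete in the adic topology of its augmentation ideal, i.e. $F_\hbar/\hbar F_\hbar\cong F[[G]]$, the function algebra of a formal group $G$. Then $\{x,y\}:=\hbar^{-1}(x'y'-y'x')\bmod\hbar$ ($x',y'$ lifts of $x,y$) makes $F[[G]]$ a Poisson Hopf algebra, i.e. $G$ a formal Poisson group; one writes $F_\hbar=F_\hbar[[G]]$ and says it is a QFSHA over (for) $G$. With $\mathfrak m:=\mathrm{Ker}(\epsilon_{F[[G]]})$, the space $\mathfrak g^*:=\mathfrak m/\mathfrak m^2$ is the cotangent Lie bialgebra of $G$: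 its bracket $[\ ,\ ]_*$ is induced by the Poisson bracket and its cobracket $\delta_*$ by $\Delta-\Delta^{\mathrm{op}}$. Its (topological) dual is the tangent Lie bialgebra $\mathfrak g=\mathrm{Lie}(G)$. $(F_\hbar[[G]]^{\widetilde\otimes 2})^{*}$ denotes the topological dual (continuous $\Bbbk[[\hbar]]$-linear forms, for the $I$-adic topology with $I=\hbar\,(\cdot)+\mathrm{Ker}\,\epsilon$, and the $\hbar$-adic topology on $\Bbbk[[\hbar]]$), with convolution product $(\alpha*\beta)(a,b)=\alpha(a_{(1)},b_{(1)})\beta(a_{(2)},b_{(2)})$, unit $\epsilon^{\otimes 2}=\epsilon\otimes\epsilon$; $\exp_*,\log_*$ are with respect to it; $\varsigma_{2,1}(a,b)=\varsigma(b,a)$. Hopf 2-cocycle for $H$: a convolution invertible bilinear form $\sigma$ with $\sigma(a,1)=\epsilon(a)=\sigma(1,a)$ and $\sigma(a_{(1)},b_{(1)})\,\sigma(a_{(2)}b_{(2)},c)=\sigma(b_{(1)},c_{(1)})\,\sigma(a,b_{(2)}c_{(2)})$. The deformation $H_\sigma$ has the same coalgebra structure and unit, with product $a\cdot_\sigma b=\sigma(a_{(1)},b_{(1)})\,a_{(2)}b_{(2)}\,\sigma^{-1}(a_{(3)},b_{(3)})$. Lie 2-cocycle: for a Lie bialgebra $(\mathfrak a;[\ ,\ ],\delta)$ with $\delta(x)=x_{[1]}\otimes x_{[2]}$, a 2-cocycle is $\gamma\in(\mathfrak a\otimes\mathfrak a)^*$ such that for all $\psi\in\mathfrak a^*$: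 $\mathrm{ad}_\psi(\partial_*\gamma+[[\gamma,\gamma]]_* )=0$ and $\mathrm{ad}_\psi(\gamma+\gamma_{2,1})=0$. Here $(\partial_*\gamma)(a,b,c)=\gamma([a,b],c)+$ cyclic permutations; $[[\gamma,\gamma]]_*(a,b,c)=\gamma(a_{[1]},b)\gamma(a_{[2]},c)+\gamma(a,b_{[1]})\gamma(b_{[2]},c)+\gamma(a,c_{[1]})\gamma(b,c_{[2]})$; and $\mathrm{ad}_\psi$ is the adjoint action of the dual Lie algebra $\mathfrak a^*$ (bracket $\delta^*$) extended to multilinear forms viewed as tensors over $\mathfrak a^*$. The deformed Lie bialgebra is $\mathfrak a_\gamma=(\mathfrak a;[\ ,\ ]_\gamma,\delta)$ with $[x,y]_\gamma=[x,y]+\gamma(x_{[1]},y)\,x_{[2]}-\gamma(y_{[1]},x)\,y_{[2]}$. *)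

(* Defs.v *)
From HB Require Import structures.
From mathcomp Require Import all_boot all_order all_algebra.
From mathcomp Require Import all_classical topology.

Set Implicit Arguments.
Unset Strict Implicit.
Unset Printing Implicit Defensive.

Import GRing.Theory.
Local Open Scope classical_set_scope.
Local Open Scope ring_scope.

#[short(type="topComNzRingType")]
HB.structure Definition TopComNzRing :=
  {R of GRing.ComNzRing R & Topological R}.

Definition series (k : fieldType) := nat -> k.

Section SeriesRing.
Variable k : fieldType.

Definition series_mul (f g : series k) : series k :=
  fun n => \sum_(i < n.+1) f i * g (n - i)%N.

Definition seriesC (c : k) : series k := fun n => if n is 0 then c else 0.

Definition hbar : series k := fun n => (n == 1)%:R.

HB.instance Definition _ := GRing.Zmodule.copy (series k) (nat -> k).

Let tr n (f : series k) : {poly k} := \poly_(i < n.+1) f i.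

Let trE n f i : (i <= n)%N -> (tr n f)`_i = f i.
Proof. by move=> le_in; rewrite coef_poly ltnS le_in. Qed.

Let mulE n f g i : (i <= n)%N -> series_mul f g i = (tr n f * tr n g)`_i.
Proof.
move=> le_in; rewrite coefM; apply: eq_bigr => j _.
have le_jn : (j <= n)%N by apply: leq_trans le_in; rewrite -ltnS.
by rewrite !trE // (leq_trans (leq_subr _ _)).
Qed.

Let series_mulC : commutative series_mul.
Proof. by move=> f g; apply/funext => n; rewrite !(@mulE n) // mulrC. Qed.

Let series_mulA : associative series_mul.
Proof.
move=> f g h; apply/funext => n; rewrite !(@mulE n) //.
have trM u v i : (i <= n)%N -> (tr n (series_mul u v))`_i = (tr n u * tr n v)`_i.
  by move=> le_in; rewrite trE // (@mulE n).
transitivity ((tr n f * (tr n g * tr n h))`_n).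
  by rewrite 2!coefM; apply: eq_bigr => i _; rewrite trM // leq_subr.
rewrite mulrA 2!coefM; apply: eq_bigr => i _; rewrite trM //.
by rewrite -ltnS.
Qed.

Let series_mul1 : left_id (seriesC 1) series_mul.
Proof.
move=> f; apply/funext => n.
rewrite /series_mul big_ord_recl /= mul1r subn0 big1 ?addr0 // => i _.
by rewrite mul0r.
Qed.

Let series_mulDl : left_distributive series_mul +%R.
Proof.
move=> f g h; apply/funext => n.
transitivity (\sum_(i < n.+1) (f i * h (n - i)%N + g i * h (n - i)%N)).
  by apply: eq_bigr => i _; rewrite -mulrDl.
by rewrite big_split.
Qed.

Let series_1neq0 : seriesC 1 != 0 :> series k.
Proof.
by apply/eqP => /(congr1 (fun f : series k => f 0%N)) /eqP; rewrite oner_eq0.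
Qed.

HB.instance Definition _ := GRing.Zmodule_isComNzRing.Build (series k)
  series_mulA series_mulC series_mul1 series_mulDl series_1neq0.

Definition hdvd (n : nat) (f : series k) : Prop := exists g, f = hbar ^+ n * g.

(* division by [hbar]; only meaningful on multiples of [hbar] *)
Definition hdiv (f : series k) : series k := fun n => f n.+1.

(* the [hbar]-adic topology *)
Definition series_nbhs (f : series k) : set_system (series k) :=
  [set A | exists n, forall g, hdvd n (g - f) -> A g].

HB.instance Definition _ := hasNbhs.Build (series k) series_nbhs.

Let hdvd_le m n f : (m <= n)%N -> hdvd n f -> hdvd m f.
Proof.
move=> le_mn [g ->]; exists (hbar ^+ (n - m) * g).
by rewrite mulrA -exprD subnKC.
Qed.

Let hdvd0 n : hdvd n 0.
Proof. by exists 0; rewrite mulr0. Qed.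

Let hdvdD n f g : hdvd n f -> hdvd n g -> hdvd n (f + g).
Proof. by move=> [u ->] [v ->]; exists (u + v); rewrite mulrDr. Qed.

Let series_nbhs_filter (f : series k) : ProperFilter (nbhs f).
Proof.
split; first by move=> [n /(_ f)]; apply; rewrite subrr; exact: hdvd0.
split.
- by exists 0%N.
- move=> A B [m Am] [n Bn]; exists (maxn m n) => g dg; split.
    by apply: Am; apply: hdvd_le dg; rewrite leq_maxl.
  by apply: Bn; apply: hdvd_le dg; rewrite leq_maxr.
- by move=> A B sAB [n An]; exists n => g /An /sAB.
Qed.

Let series_nbhs_singleton (f : series k) (A : set (series k)) :
  nbhs f A -> A f.
Proof. by move=> [n]; apply; rewrite subrr; exact: hdvd0. Qed.

Let series_nbhs_nbhs (f : series k) (A : set (series k)) :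
  nbhs f A -> nbhs f (nbhs^~ A).
Proof.
move=> [n An]; exists n => g dg; exists n => h dh; apply: An.
by rewrite -(subrK g h) -addrA; exact: hdvdD.
Qed.

HB.instance Definition _ := Nbhs_isNbhsTopological.Build (series k)
  series_nbhs_filter series_nbhs_singleton series_nbhs_nbhs.

End SeriesRing.

Arguments hbar {k}.

(* the field k with its discrete topology *)
Definition discr (k : fieldType) : Type := k.

HB.instance Definition _ (k : fieldType) := GRing.Field.copy (discr k) k.
HB.instance Definition _ (k : fieldType) :=
  Topological.copy (discr k) (discrete_topology k).

(* The module R^X is the function type [X -> R]; its weak (product) topology is
   that of the library type [{ptws X -> R}]. The completed tensor product of
   R^X and R^Y is R^(X * Y). *)

Section Tensor.
Context {R : topComNzRingType}.
Implicit Types X Y Z : Type.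

Definition cont_linear X Y (f : (X -> R) -> (Y -> R)) : Prop :=
  (forall a u v, f (a \*o u + v) = a \*o f u + f v) /\
  continuous (f : {ptws X -> R} -> {ptws Y -> R}).

Definition cont_form X (phi : (X -> R) -> R) : Prop :=
  (forall a u v, phi (a \*o u + v) = a * phi u + phi v) /\
  continuous (phi : {ptws X -> R} -> R).

Definition tens X Y (u : X -> R) (v : Y -> R) : X * Y -> R :=
  fun p => u p.1 * v p.2.

Definition flip X Y (t : X * Y -> R) : Y * X -> R := fun p => t (p.2, p.1).

(* For f continuous and linear, applying f to all slices of t is the unique
   continuous linear map sending u (x) v to f u (x) v; so the next operations
   are the completed tensor products f (x) id, id (x) f, f (x) g, with f and g
   maps or forms. *)
Definition lmap X Y Z (f : (X -> R) -> (Y -> R)) (t : X * Z -> R) : Y * Z -> R :=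
  fun p => f (fun x => t (x, p.2)) p.1.

Definition rmap X Y Z (f : (X -> R) -> (Y -> R)) (t : Z * X -> R) : Z * Y -> R :=
  fun p => f (fun x => t (p.1, x)) p.2.

Definition tmap X X' Y Y' (f : (X -> R) -> (X' -> R)) (g : (Y -> R) -> (Y' -> R))
  (t : X * Y -> R) : X' * Y' -> R := lmap f (rmap g t).

Definition lform X Y (phi : (X -> R) -> R) (t : X * Y -> R) : Y -> R :=
  fun y => phi (fun x => t (x, y)).

Definition rform X Y (phi : (Y -> R) -> R) (t : X * Y -> R) : X -> R :=
  fun x => phi (fun y => t (x, y)).

Definition tform X Y (phi : (X -> R) -> R) (psi : (Y -> R) -> R)
  (t : X * Y -> R) : R := phi (rform psi t).

Definition flip_form X Y (phi : (X * Y -> R) -> R) : (Y * X -> R) -> R :=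
  fun t => phi (flip t).

(* (X1 (x) X2) (x) (Y1 (x) Y2) -> (X1 (x) Y1) (x) (X2 (x) Y2) *)
Definition mid4 (X1 X2 Y1 Y2 : Type) (t : (X1 * X2) * (Y1 * Y2) -> R) :
    (X1 * Y1) * (X2 * Y2) -> R :=
  fun p => t ((p.1.1, p.2.1), (p.1.2, p.2.2)).

(* (X (x) Y) (x) Z -> X (x) (Y (x) Z) *)
Definition tassoc X Y Z (t : (X * Y) * Z -> R) : X * (Y * Z) -> R :=
  fun p => t ((p.1, p.2.1), p.2.2).

End Tensor.

Record bialg (R : topComNzRingType) (E : Type) := Bialg {
  bmul : (E * E -> R) -> (E -> R);
  bone : E -> R;
  bcomul : (E -> R) -> (E * E -> R);
  bcounit : (E -> R) -> R }.

Section HopfProduct.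
Context {R : topComNzRingType} {E : Type}.
Implicit Type H : bialg R E.

Definition mulb H (x y : E -> R) : E -> R := bmul H (tens x y).

Definition bialg2 H : bialg R (E * E) :=
  {| bmul := fun t => tmap (bmul H) (bmul H) (mid4 t);
     bone := tens (bone H) (bone H);
     bcomul := fun t => mid4 (tmap (bcomul H) (bcomul H) t);
     bcounit := tform (bcounit H) (bcounit H) |}.

End HopfProduct.

Section Hopf.
Context {R : topComNzRingType} {E : Type}.
Implicit Type H : bialg R E.

Record topological_hopf H : Prop := TopologicalHopf {
  hopf_mul_cont : cont_linear (bmul H);
  hopf_comul_cont : cont_linear (bcomul H);
  hopf_counit_cont : cont_form (bcounit H);
  hopf_mulA : forall x y z, mulb H (mulb H x y) z = mulb H x (mulb H y z);
  hopf_mul1l : forall x, mulb H (bone H) x = x;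
  hopf_mul1r : forall x, mulb H x (bone H) = x;
  hopf_coassoc : forall x, tassoc (lmap (bcomul H) (bcomul H x)) =
                rmap (bcomul H) (bcomul H x);
  hopf_counitl : forall x, lform (bcounit H) (bcomul H x) = x;
  hopf_counitr : forall x, rform (bcounit H) (bcomul H x) = x;
  hopf_comulM : forall x y,
        bcomul H (mulb H x y) = mulb (bialg2 H) (bcomul H x) (bcomul H y);
  hopf_comul1 : bcomul H (bone H) = tens (bone H) (bone H);
  hopf_counitM : forall x y, bcounit H (mulb H x y) = bcounit H x * bcounit H y;
  hopf_counit1 : bcounit H (bone H) = 1;
  hopf_antipode : exists S : (E -> R) -> (E -> R), cont_linear S /\
        forall x, bmul H (lmap S (bcomul H x)) = bcounit H x \*o bone H /\
                  bmul H (rmap S (bcomul H x)) = bcounit H x \*o bone H }.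

Definition submodule (V : set (E -> R)) : Prop :=
  V 0 /\ forall a u v, V u -> V v -> V (a \*o u + v).

Definition closed_span (S : set (E -> R)) : set (E -> R) :=
  [set u | forall V : set (E -> R), submodule V ->
     closed (V : set {ptws E -> R}) -> S `<=` V -> V u].

(* Powers of an ideal are topological, i.e. closed; when the ideal is that of a
   Noetherian algebra such as k[[x_1, .., x_d]] taking closures is void. *)
Fixpoint ideal_pow H (I : set (E -> R)) (n : nat) : set (E -> R) :=
  if n is n'.+1 then
    closed_span [set z | exists x y, [/\ I x, ideal_pow H I n' y & z = mulb H x y]]
  else setT.

Definition aug_ideal H : set (E -> R) := [set x | bcounit H x = 0].

Definition adic_complete H : Prop :=
  let m := ideal_pow H (aug_ideal H) in
  (forall x, (forall n, m n x) -> x = 0) /\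
  (forall u : nat -> E -> R,
     (forall n, exists N, forall i j, (N <= i)%N -> (N <= j)%N -> m n (u i - u j)) ->
     exists l, forall n, exists N, forall i, (N <= i)%N -> m n (u i - l)).

Definition commutative_bialg H : Prop := forall x y, mulb H x y = mulb H y x.

Definition conv H (alpha beta : (E -> R) -> R) : (E -> R) -> R :=
  fun t => tform alpha beta (bcomul H t).

Definition conv_pow H (alpha : (E -> R) -> R) (n : nat) : (E -> R) -> R :=
  iter n (conv H alpha) (bcounit H).

End Hopf.

(* [pbr] is the Poisson bracket as a linear map on the tensor square *)
Record poisson_bialg (R : topComNzRingType) (E : Type) := PoissonBialg {
  pbialg :> bialg R E;
  pbr : (E * E -> R) -> (E -> R) }.

Section Poisson.
Context {R : topComNzRingType} {E : Type}.
Implicit Type G : poisson_bialg R E.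

Definition poisson G (x y : E -> R) : E -> R := pbr G (tens x y).

(* G stands for its function algebra F[[G]] *)
Record formal_poisson_group G : Prop := FormalPoissonGroup {
  fpg_hopf : topological_hopf G;
  fpg_mulC : commutative_bialg G;
  fpg_complete : adic_complete G;
  fpg_pbr_cont : cont_linear (pbr G);
  fpg_anti : forall x y, poisson G x y = - poisson G y x;
  fpg_jacobi : forall x y z, poisson G (poisson G x y) z + poisson G (poisson G y z) x
                    + poisson G (poisson G z x) y = 0;
  fpg_leibniz : forall x y z, poisson G x (mulb G y z) =
                    mulb G (poisson G x y) z + mulb G y (poisson G x z);
  fpg_comul : forall x y, let t := mid4 (tens (bcomul G x) (bcomul G y)) in
        bcomul G (poisson G x y) =
        tmap (pbr G) (bmul G) t + tmap (bmul G) (pbr G) t }.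

End Poisson.

Record lie_data (R : topComNzRingType) (B : Type) := LieData {
  lbr : (B * B -> R) -> (B -> R);
  lcobr : (B -> R) -> (B * B -> R) }.

Section Lie.
Context {R : topComNzRingType} {B : Type}.
Implicit Types (L : lie_data R B) (gamma : (B * B -> R) -> R) (psi : (B -> R) -> R).

Definition brk L (x y : B -> R) : B -> R := lbr L (tens x y).

Definition ad_tens2 L (x : B -> R) (t : B * B -> R) : B * B -> R :=
  lmap (brk L x) t + rmap (brk L x) t.

Record lie_bialgebra L : Prop := LieBialgebra {
  lb_br_cont : cont_linear (lbr L);
  lb_cobr_cont : cont_linear (lcobr L);
  lb_anti : forall x y, brk L x y = - brk L y x;
  lb_jacobi : forall x y z,
        brk L (brk L x y) z + brk L (brk L y z) x + brk L (brk L z x) y = 0;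
  lb_coanti : forall x, flip (lcobr L x) = - lcobr L x;
  lb_cojacobi : forall x a b c, let t := lmap (lcobr L) (lcobr L x) in
        t ((a, b), c) + t ((b, c), a) + t ((c, a), b) = 0;
  lb_cocycle : forall x y, lcobr L (brk L x y) =
                  ad_tens2 L x (lcobr L y) - ad_tens2 L y (lcobr L x) }.

Definition dual_brk L psi (phi : (B -> R) -> R) : (B -> R) -> R :=
  fun x => tform psi phi (lcobr L x).

Definition ad2 L psi (T : (B -> R) -> (B -> R) -> R) (a b : B -> R) : R :=
  dual_brk L psi (fun x => T x b) a + dual_brk L psi (fun x => T a x) b.

Definition ad3 L psi (T : (B -> R) -> (B -> R) -> (B -> R) -> R)
    (a b c : B -> R) : R :=
  dual_brk L psi (fun x => T x b c) a + dual_brk L psi (fun x => T a x c) b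
  + dual_brk L psi (fun x => T a b x) c.

Definition cobound L gamma (a b c : B -> R) : R :=
  gamma (tens (brk L a b) c) + gamma (tens (brk L b c) a)
  + gamma (tens (brk L c a) b).

Definition dual_cyb L gamma (a b c : B -> R) : R :=
  tform (fun x => gamma (tens x b)) (fun x => gamma (tens x c)) (lcobr L a)
  + tform (fun x => gamma (tens a x)) (fun x => gamma (tens x c)) (lcobr L b)
  + tform (fun x => gamma (tens a x)) (fun x => gamma (tens b x)) (lcobr L c).

Definition lie_2cocycle L gamma : Prop :=
  cont_form gamma /\
  forall psi, cont_form psi ->
    (forall a b c,
       ad3 L psi (fun x y z => cobound L gamma x y z + dual_cyb L gamma x y z)
           a b c = 0) /\
    (forall a b,
       ad2 L psi (fun x y => gamma (tens x y) + gamma (tens y x)) a b = 0).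

(* x (x) y |-> gamma (x_[1], y) x_[2] *)
Definition contract L gamma (t : B * B -> R) : B -> R :=
  fun b => gamma (fun p => lmap (lcobr L) t ((p.1, b), p.2)).

(* [x, y]_gamma = [x, y] + gamma (x_[1], y) x_[2] - gamma (y_[1], x) y_[2] *)
Definition lie_deform L gamma : lie_data R B :=
  {| lbr := fun t => lbr L t + contract L gamma t - contract L gamma (flip t);
     lcobr := lcobr L |}.

End Lie.

(* L is the cotangent Lie bialgebra of G, carried by m / m^2 with m the
   augmentation ideal. The topological quotient m / m^2 is presented by a
   quotient map [pi] onto a space R^B, extended from m to R 1 (+) m by
   [pi 1 = 0]. *)
Record cotangent_lie_bialgebra (R : topComNzRingType) (E B : Type)
    (G : poisson_bialg R E) (pi : (E -> R) -> (B -> R)) (L : lie_data R B) : Prop :=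
  CotangentLieBialgebra {
  cot_cont : cont_linear pi;
  cot_one : pi (bone G) = 0;
  cot_surj : forall v, exists2 x, aug_ideal G x & pi x = v;
  cot_quot : forall V : set (B -> R), open (V : set {ptws B -> R}) <->
        open (pi @^-1` V : set {ptws E -> R});
  cot_ker : forall x, aug_ideal G x -> (pi x = 0 <-> ideal_pow G (aug_ideal G) 2 x);
  cot_lie : lie_bialgebra L;
  cot_br : forall x y, aug_ideal G x -> aug_ideal G y ->
        brk L (pi x) (pi y) = pi (poisson G x y);
  cot_cobr : forall x, aug_ideal G x ->
        lcobr L (pi x) = tmap pi pi (bcomul G x - flip (bcomul G x)) }.

Section Reduction.
Context {k : fieldType}.

(* F / hbar F = k^E for F = k[[hbar]]^E, with the lift by constant series *)
Definition red E (u : E -> series k) : E -> discr k := fun e => u e 0%N.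

Definition lift E (u : E -> discr k) : E -> series k := fun e => seriesC (u e).

Definition red_map X Y (f : (X -> series k) -> (Y -> series k)) :
    (X -> discr k) -> (Y -> discr k) := fun u => red (f (lift u)).

Definition red_form X (phi : (X -> series k) -> series k) :
    (X -> discr k) -> discr k := fun u => phi (lift u) 0%N.

Definition red_bialg E (H : bialg (series k) E) : bialg (discr k) E :=
  {| bmul := red_map (bmul H); bone := red (bone H);
     bcomul := red_map (bcomul H); bcounit := red_form (bcounit H) |}.

Definition semiclassical E (H : bialg (series k) E) : poisson_bialg (discr k) E :=
  {| pbialg := red_bialg H;
     pbr := red_map (fun t e => hdiv (bmul H t e - bmul H (flip t) e)) |}.

Definition QFSHA E (H : bialg (series k) E) : Prop :=
  [/\ topological_hopf H, commutative_bialg (red_bialg H)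
    & adic_complete (red_bialg H)].

Definition QFSHA_over E (H : bialg (series k) E) (G : poisson_bialg (discr k) E) :
    Prop :=
  [/\ QFSHA H, formal_poisson_group G & semiclassical H = G].

Definition quantum_ideal E (H : bialg (series k) E) : set (E -> series k) :=
  [set x | exists y z, bcounit H z = 0 /\ x = hbar \*o y + z].

(* Topological dual: forms that are continuous for the I-adic topology, I being
   [quantum_ideal H]. Weak continuity is what gives a meaning to completed
   tensor products of forms; it follows from I-adic continuity when the formal
   group is finite dimensional. *)
Definition dual E (H : bialg (series k) E) (phi : (E -> series k) -> series k) :
    Prop :=
  cont_form phi /\
  forall n, exists N, forall x, ideal_pow H (quantum_ideal H) N x -> hdvd n (phi x).

Definition hcong E (H : bialg (series k) E)
    (phi psi : (E -> series k) -> series k) : Prop :=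
  exists2 rho, dual H rho & phi = psi + hbar \*o rho.

(* s is the sum of the u i in the hbar-adic topology of the dual *)
Definition hadic_sum E (H : bialg (series k) E)
    (u : nat -> (E -> series k) -> series k) (s : (E -> series k) -> series k) :
    Prop :=
  forall n, exists N, forall M, (N <= M)%N ->
    exists2 rho, dual H rho & s - \sum_(i < M) u i = hbar ^+ n \*o rho.

Definition is_conv_log E (H : bialg (series k) E)
    (sigma lambda : (E -> series k) -> series k) : Prop :=
  hadic_sum H (fun n => seriesC ((-1) ^+ n / n.+1%:R)
                        \*o conv_pow H (sigma - bcounit H) n.+1) lambda.

Definition is_conv_exp E (H : bialg (series k) E)
    (lambda sigma : (E -> series k) -> series k) : Prop :=
  hadic_sum H (fun n => seriesC (n`!%:R^-1) \*o conv_pow H lambda n) sigma.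

(* sigma is a 2-cocycle, with convolution inverse sigma' *)
Record hopf_2cocycle E (H : bialg (series k) E)
    (sigma sigma' : (E * E -> series k) -> series k) : Prop := Hopf2Cocycle {
  coc_dual : dual (bialg2 H) sigma;
  coc_dual_inv : dual (bialg2 H) sigma';
  coc_invr : conv (bialg2 H) sigma sigma' = bcounit (bialg2 H);
  coc_invl : conv (bialg2 H) sigma' sigma = bcounit (bialg2 H);
  coc_normr : forall a, sigma (tens a (bone H)) = bcounit H a;
  coc_norml : forall a, sigma (tens (bone H) a) = bcounit H a;
  coc_eq : forall a b c,
        tform sigma (fun t => sigma (tens (bmul H t) c))
              (bcomul (bialg2 H) (tens a b)) =
        tform sigma (fun t => sigma (tens a (bmul H t)))
              (bcomul (bialg2 H) (tens b c)) }.

(* a ._sigma b = sigma (a_(1), b_(1)) a_(2) b_(2) sigma^-1 (a_(3), b_(3)) *)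
Definition cocycle_deform E (H : bialg (series k) E)
    (sigma sigma' : (E * E -> series k) -> series k) : bialg (series k) E :=
  {| bmul := fun t =>
       let D := bcomul (bialg2 H) in
       bmul H (rform sigma' (lform sigma (rmap D (D t))));
     bone := bone H; bcomul := bcomul H; bcounit := bcounit H |}.

End Reduction.

(* Main.v *)
(** Write sigma = eps + hbar rho. Logarithm and exponential converge in the
    convolution algebra of the dual, so vs exists and vs = rho modulo hbar; the
    exponential is injective on multiples of hbar, whence (a). At first order the
    cocycle identity says that r = rho mod hbar is a Hochschild 2-cocycle on the
    commutative algebra F[[G]], so that z = r - r_{2,1} is a biderivation and factors
    through m/m^2 (x) m/m^2 as zeta. Dividing by hbar^2 the alternating sum of the
    cocycle identity over the permutations of its arguments shows that
    d zeta + [[zeta, zeta]] vanishes, hence is invariant. The deformed product agrees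
    with the original one modulo hbar, so only the Poisson bracket changes, to
      {x, y} + z(x_(1), y_(1)) x_(2) y_(2) - x_(1) y_(1) z(x_(2), y_(2)),
    whose linear part is the zeta-deformed Lie bracket; the Lie bialgebra axioms of the
    deformation are inherited from the Poisson axioms of the deformed formal group. *)

Require Import Defs.
From HB Require Import structures.
From mathcomp Require Import all_boot all_order all_algebra.
From mathcomp Require Import all_classical topology.
From mathcomp Require Import ring zify.
Import GRing.Theory.
Local Open Scope classical_set_scope.
Local Open Scope ring_scope.

Set Implicit Arguments.
Unset Strict Implicit.
Unset Printing Implicit Defensive.

(** The scalars are k[[hbar]] for the quantum objects and discrete k for their limits, and one
    calculus serves both. A continuous form on R^X is determined by its values on basis vectors and
    behaves like an integral over X: operations on different tensor factors commute by Fubini, and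
    identities are checked on pure tensors. Several obstacles shape the rest. Limits and
    convolutions have to stay in the dual, so Delta must respect the filtration by powers of I. The
    antipode of the deformation is not computed: the antipode of F is already an inverse of the
    identity modulo hbar, and is corrected from there. Identities between commutators are proved in
    F, where hbar can be cancelled, and reduced afterwards; the second division of the cocycle
    identity by hbar needs lifts whose counit is exactly 0. Finally zeta must be one continuous form
    on the completed square of m/m^2, whereas factoring through [pi] treats one argument at a time;
    z depends on finitely many coordinates only, and antisymmetry carries what is gained for the
    first argument over to the second. *)

(* The common features of the hbar-adic topology on [series k] and of the discrete
   topology on [discr k], for which all the ideals are zero. *)
Class adic (R : topComNzRingType) := Adic {
  adJ : nat -> set R;
  adJ_nbhs : forall (r : R) (A : set R), nbhs r A <-> exists n, forall g, adJ n (g - r) -> A g;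
  adJ0 : forall n, adJ n 0;
  adJD : forall n a b, adJ n a -> adJ n b -> adJ n (a + b);
  adJM : forall n a b, adJ n b -> adJ n (a * b);
  adJ_sep : forall a, (forall n, adJ n a) -> a = 0;
  adJ_le : forall m n a, (m <= n)%N -> adJ n a -> adJ m a }.

(** * Power series modulo powers of hbar, and the discrete field *)

Section SeriesAdic.
Variable k : fieldType.
Implicit Types f g : series k.

Lemma hbarE f n : (hbar * f) n = if n is m.+1 then f m else 0.
Proof.
rewrite [LHS]/GRing.mul /= /series_mul; case: n => [|n].
  by rewrite big_ord_recl big_ord0 /hbar /= mul0r addr0.
rewrite big_ord_recl /hbar /= mul0r add0r big_ord_recl /= mul1r subSS subn0.
by rewrite big1 ?addr0 // => i _; rewrite mul0r.
Qed.

Lemma hbarXE f m n : (hbar ^+ m * f) n = if (m <= n)%N then f (n - m)%N else 0.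
Proof.
elim: m n => [|m IH] n; first by rewrite mul1r subn0.
by rewrite exprS -mulrA hbarE; case: n => // n; rewrite IH ltnS subSS.
Qed.

Lemma hdvdP n f : hdvd n f <-> forall i, (i < n)%N -> f i = 0.
Proof.
split=> [[g ->] i lt_in|f0]; first by rewrite hbarXE leqNgt lt_in.
exists (fun i => f (n + i)%N); apply/funext => i; rewrite hbarXE.
by case: leqP => [/subnKC->|/f0].
Qed.

Lemma series_addE f g n : (f + g) n = f n + g n. Proof. by []. Qed.
Lemma series_oppE f n : (- f) n = - f n. Proof. by []. Qed.
Lemma series_mul0E f g : (f * g) 0%N = f 0%N * g 0%N.
Proof. by rewrite [LHS]/GRing.mul /= /series_mul big_ord_recl big_ord0 addr0. Qed.

#[export, refine] Instance series_adic : adic (series k) := {| adJ := @hdvd k |}.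
Proof.
- by [].
- by move=> n; apply/hdvdP.
- by move=> n a b /hdvdP a0 /hdvdP b0; apply/hdvdP => i lt;
  rewrite series_addE a0 // b0 // addr0.
- by move=> n a b [g ->]; exists (a * g); rewrite mulrCA.
- by move=> a a0; apply/funext => n; have /hdvdP -> := a0 n.+1.
- by move=> m n a le /hdvdP a0; apply/hdvdP => i lt; apply: a0; apply: leq_trans le.
Defined.

Lemma hdvdD n f g : hdvd n f -> hdvd n g -> hdvd n (f + g).
Proof. exact: (@adJD _ series_adic). Qed.
Lemma hdvdM n f g : hdvd n g -> hdvd n (f * g).
Proof. exact: (@adJM _ series_adic). Qed.
Lemma hdvd0 n : hdvd n (0 : series k).
Proof. exact: (@adJ0 _ series_adic). Qed.

Lemma hbar_inj : injective (GRing.mul (hbar : series k)).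
Proof. by move=> f g fg; apply/funext => n; have := congr1 (fun h => h n.+1) fg;
  rewrite !hbarE. Qed.

#[export, refine] Instance discr_adic : adic (discr k) := {| adJ := fun _ => [set 0] |}.
Proof.
- move=> r A; split.
    move=> rA; exists 0%N => g /eqP; rewrite subr_eq0 => /eqP ->; exact: nbhs_singleton rA.
  move=> [_ /(_ r)]; rewrite subrr => /(_ erefl) Ar.
  have -> : nbhs r A = nbhs (r : discrete_topology k) A by [].
  by rewrite discrete_topology.nbhs_principalE principal_filterP.
- by [].
- by move=> n a b /= -> ->; rewrite addr0.
- by move=> n a b /= ->; rewrite mulr0.
- by move=> a /(_ 0%N).
- by [].
Defined.
End SeriesAdic.

(** * Continuous linear forms and maps in the product topology *)

Section Pointwise.
Context {R : topComNzRingType} {aR : adic R}.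
Implicit Types X Y : Type.

Lemma adJN n (a : R) : adJ n a -> adJ n (- a).
Proof. by rewrite -mulN1r; exact: adJM. Qed.

Lemma adJMr n (a b : R) : adJ n a -> adJ n (a * b).
Proof. by rewrite mulrC; exact: adJM. Qed.

Lemma scE X a (u : X -> R) x : (a \*o u) x = a * u x. Proof. by []. Qed.
Lemma fadE X (u v : X -> R) x : (u + v) x = u x + v x. Proof. by []. Qed.
Lemma fopE X (u : X -> R) x : (- u) x = - u x. Proof. by []. Qed.
Lemma fzE X (x : X) : (0 : X -> R) x = 0. Proof. by []. Qed.
Definition fE := (scE, fadE, fopE, fzE).

(** As s and n vary, a basis of neighbourhoods of 0 in the product topology. [List.In] is used
    because X carries no decidable equality. *)
Definition small X (s : seq X) n : set (X -> R) :=
  [set u | forall x, List.In x s -> adJ n (u x)].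

Lemma ptws_nbhsP X (v : X -> R) (A : set (X -> R)) :
  nbhs (v : {ptws X -> R}) A <-> exists s n, forall u, small s n (u - v) -> A u.
Proof.
split=> [vA|[s [n sA]]].
  (* The sets with the property on the right form a filter. The product topology is the supremum of
     the topologies pulled back along the coordinates, so it is enough that this filter converges to
     v for each of them. *)
  pose FF : set_system {ptws X -> R} :=
    [set A | exists s n, forall u, small s n (u - v) -> A u].
  have FFf : Filter FF.
    split; first by exists [::], 0%N.
      move=> P Q [s [m sP]] [s' [n sQ]]; exists (s ++ s'), (maxn m n) => u su; split.
        apply: sP => x xs; apply: adJ_le (su _ _); first by rewrite leq_maxl.
        by apply/List.in_app_iff; left.
      apply: sQ => x xs; apply: adJ_le (su _ _); first by rewrite leq_maxr.
      by apply/List.in_app_iff; right.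
    by move=> P Q PQ [s [n sP]]; exists s, n => u /sP /PQ.
  suff: FF --> (v : {ptws X -> R}) by apply.
  apply/cvg_sup => x U [V [[W oW <-] Wv] WU].
  have [n nW] : exists n, forall g, adJ n (g - v x) -> W g.
    by apply/adJ_nbhs; apply: open_nbhs_nbhs; split.
  by exists [:: x], n => u su; apply: WU; apply: nW; apply: su; left.
have vF : Filter (nbhs (v : {ptws X -> R})) := @nbhs_filter {ptws X -> R} v.
suff: nbhs (v : {ptws X -> R}) [set u | small s n (u - v)] by apply: filterS.
elim: s {sA} => [|x s IH]; first by apply: (filterS _ filterT) => u _ x [].
have xn : nbhs (v : {ptws X -> R}) [set u | adJ n (u x - v x)].
  apply: (@proj_continuous {classic X} (fun _ => R) x v [set a | adJ n (a - v x)]).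
  by apply/adJ_nbhs; exists n.
by apply: filterS (filterI xn IH) => u [ux us] y [<-|/us].
Qed.

Lemma closed_ptwsP X (V : set (X -> R)) : closed (V : set {ptws X -> R}) <->
  forall u, (forall s n, exists2 v, V v & small s n (u - v)) -> V u.
Proof.
split=> [cV u uV|cV u uV].
  apply: cV => A /ptws_nbhsP [s [n sA]].
  have [v Vv uv] := uV s n; exists v; split=> //; apply: sA => x xs.
  by rewrite -opprB; apply: adJN; apply: uv.
apply: cV => s n; have /uV [v [Vv uv]] : nbhs (u : {ptws X -> R}) [set v | small s n (v - u)].
  by apply/ptws_nbhsP; exists s, n.
by exists v => // x xs; rewrite -opprB; apply: adJN; apply: uv.
Qed.

Definition dlt X (x : X) : X -> R := fun y => `[< x = y >]%:R.

Definition lin X (phi : (X -> R) -> R) :=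
  forall a u v, phi (a \*o u + v) = a * phi u + phi v.

Lemma lin0 X (phi : (X -> R) -> R) : lin phi -> phi 0 = 0.
Proof.
move=> lp; have := lp (-1) 0 0; rewrite mulN1r addNr => <-; congr phi.
by apply/funext => x; rewrite !fE mulr0 add0r.
Qed.

Lemma linD X (phi : (X -> R) -> R) u v : lin phi -> phi (u + v) = phi u + phi v.
Proof.
move=> lp; have := lp 1 u v; rewrite mul1r => <-; congr phi.
by apply/funext => x; rewrite !fE mul1r.
Qed.

Lemma linZ X (phi : (X -> R) -> R) a u : lin phi -> phi (a \*o u) = a * phi u.
Proof. by move=> lp; have := lp a u 0; rewrite lin0 // !addr0. Qed.

Lemma linN X (phi : (X -> R) -> R) u : lin phi -> phi (- u) = - phi u.
Proof.
move=> lp; rewrite -[RHS]mulN1r -(linZ _ _ lp); congr phi.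
by apply/funext => x; rewrite !fE mulN1r.
Qed.

Lemma linB X (phi : (X -> R) -> R) u v : lin phi -> phi (u - v) = phi u - phi v.
Proof. by move=> lp; rewrite linD // linN. Qed.

Definition zero_at X (x : X) (u : X -> R) : X -> R := fun y => if `[< x = y >] then 0 else u y.

Lemma zero_atE X (x : X) (u : X -> R) : u = u x \*o dlt x + zero_at x u.
Proof.
apply/funext => y; rewrite !fE /dlt /zero_at.
by case: asboolP => [<-|_]; rewrite ?mulr1 ?addr0 ?mulr0 ?add0r.
Qed.

Lemma cont_form_intro X (phi : (X -> R) -> R) : lin phi ->
  (forall n, exists s m, forall u, small s m u -> adJ n (phi u)) -> cont_form phi.
Proof.
move=> lp cp; split=> // v A /adJ_nbhs[n nA]; apply/ptws_nbhsP; have [s [m sn]] := cp n.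
by exists s, m => u /sn su; apply: nA; rewrite -linB.
Qed.

(** The gain is that the coordinates are needed only to the precision n of the value. By continuity
    phi is small on vectors vanishing on s, which are small to every precision; each coordinate in s
    contributes [u x * phi (dlt x)], which lies in the ideal as soon as [u x] does. *)
Lemma cont_formP X (phi : (X -> R) -> R) : cont_form phi <->
  lin phi /\ forall n, exists s, forall u, small s n u -> adJ n (phi u).
Proof.
split=> -[lp cp]; last first.
  by apply: cont_form_intro => // n; have [s sn] := cp n; exists s, n.
split=> // n; have p0 := lin0 lp.
have /cp/ptws_nbhsP[s [m sn]] : nbhs (phi 0) (adJ n).
  by apply/adJ_nbhs; exists n => g; rewrite p0 subr0.
exists s; have {}sn u : (forall x, List.In x (s ++ [::]) -> u x = 0) ->
    (forall x, List.In x [::] -> adJ n (u x)) -> adJ n (phi u).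
  rewrite cats0 => u0 _; apply: sn => x /u0 ux; rewrite subr0 ux; exact: adJ0.
have H : forall s1 s2 u, (forall u, (forall x, List.In x (s1 ++ s2) -> u x = 0) ->
  adJ n (phi u)) ->
   (forall x, List.In x s2 -> u x = 0) -> small s1 n u -> adJ n (phi u); last first.
  move=> u su; apply: (H s [::] u) => // v v0.
  by apply: sn => // x xs; apply: v0.
elim=> [|x s1 IH] s2 u Hs u2 u1; first by apply: Hs.
rewrite [u](zero_atE x) linD // linZ //; apply: adJD; first by apply: adJMr; apply: u1; left.
apply: (IH (x :: s2)) => [v v0| y ys | y ys].
- apply: Hs => y ys; apply: v0; move: ys; rewrite /= !List.in_app_iff /=; tauto.
- rewrite /zero_at; case: asboolP => // nxy; case: ys => [//|]; exact: u2.
- rewrite /zero_at; case: asboolP => [_|_]; first exact: adJ0.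
  by apply: u1; right.
Qed.

(** A neighbourhood in the target involves finitely many coordinates. All continuity proofs are
    thereby reduced to forms. *)
Lemma cont_linearP X Y (f : (X -> R) -> (Y -> R)) :
  cont_linear f <-> forall y, cont_form (fun u => f u y).
Proof.
split=> [[lf cf] y|cf].
  split; first by move=> a u v; rewrite lf.
  move=> u A /(@proj_continuous {classic Y} (fun _ => R) y (f u)) fA; exact: (cf u _ fA).
split; first by move=> a u v; apply/funext => y; rewrite (cf y).1.
move=> u A /ptws_nbhsP[s [n sA]]; apply/ptws_nbhsP.
suff [s' ss'] : exists s', forall v, small s' n v -> small s n (f v).
  exists s', n => v /ss' sv; apply: sA => y /sv.
  by have /cont_formP[l _] := cf y; have /= -> := linB v u l.
elim: s {sA} => [|y s [s' ss']]; first by exists [::] => v _ x [].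
have /cont_formP[_ /(_ n)[s1 ss1]] := cf y; exists (s1 ++ s') => v sv z [<-|zs].
  by apply: ss1 => x xs; apply: sv; apply/List.in_app_iff; left.
by apply: ss' zs => x xs; apply: sv; apply/List.in_app_iff; right.
Qed.

(** Finite combinations of basis vectors are dense. *)
Lemma submodule_closed_total X (V : set (X -> R)) : submodule V ->
  closed (V : set {ptws X -> R}) -> (forall x, V (dlt x)) -> forall u, V u.
Proof.
move=> [V0 Vl] /closed_ptwsP cV Vd u; apply: cV => s n.
elim: s u => [|x s IH] u; first by exists 0 => // x [].
have [v Vv uv] := IH (zero_at x u);
  (* The first summand is 0, as [zero_at x u] vanishes at [x]; the second makes the approximant
     equal to [u] at [x] and changes nothing elsewhere. *)
  exists (zero_at x u x \*o dlt x + (u x - v x) \*o dlt x + v).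
  by rewrite -addrA; apply: (Vl) => //; apply: (Vl).
have xx : `[<x = x>] by apply/asboolP.
move=> y ys; have := uv y; rewrite !fE /zero_at /dlt xx.
case: asboolP => [<- _|nxy]; last first.
  by rewrite !mulr0 !add0r; apply; case: ys.
by rewrite mul0r add0r mulr1 subrK subrr; exact: adJ0.
Qed.

Lemma tens_dlt X Y (x : X) (y : Y) : tens (dlt x) (dlt y) = dlt (x, y) :> (_ -> R).
Proof.
apply/funext => -[x' y']; rewrite /tens /dlt /=.
have -> : `[< (x, y) = (x', y') >] = `[< x = x' >] && `[< y = y' >].
  apply/asboolP/andP => [[-> ->]|[/asboolP -> /asboolP ->] //].
  by split; apply/asboolP.
by case: `[< _ >]; case: `[< _ >]; rewrite /= ?mulr1 ?mulr0.
Qed.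

(** The basis vectors of R^(X * Y) are pure tensors. This is the uniqueness half of the universal
    property of the completed tensor product. *)
Lemma tens_total X Y (V : set (X * Y -> R)) : submodule V ->
  closed (V : set {ptws X * Y -> R}) -> (forall u v, V (tens u v)) -> forall t, V t.
Proof. by move=> sV cV Vt; apply: submodule_closed_total => // -[x y]; rewrite -tens_dlt. Qed.

End Pointwise.

(** * Density, Fubini and closed spans *)

Section Calculus.
Context {R : topComNzRingType} {aR : adic R}.
Implicit Types X Y Z : Type.

Lemma cf_lin X (phi : (X -> R) -> R) : cont_form phi -> lin phi.
Proof. by case. Qed.

Lemma cf_small X (phi : (X -> R) -> R) n : cont_form phi ->
  exists s, forall u, small s n u -> adJ n (phi u).
Proof. by case/cont_formP. Qed.

Lemma cf_coord X (x : X) : cont_form (fun t : X -> R => t x).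
Proof. by apply/cont_formP; split=> // n; exists [:: x] => u; apply; left. Qed.

Lemma cf_comp X Y (phi : (Y -> R) -> R) (K : (X -> R) -> Y -> R) :
  cont_form phi -> (forall y, cont_form (fun t => K t y)) -> cont_form (fun t => phi (K t)).
Proof.
move=> [lp cp] /cont_linearP[lK cK]; split; first by move=> a u v; rewrite lK lp.
by move=> u; exact: (@continuous_comp {ptws X -> R} {ptws Y -> R} R K phi u (cK u) (cp (K u))).
Qed.

Lemma cf_compl X Y Z (f : (Y -> R) -> Z -> R) (K : (X -> R) -> Y -> R) z :
  cont_linear f -> (forall y, cont_form (fun t => K t y)) -> cont_form (fun t => f (K t) z).
Proof. by move=> /cont_linearP cf; apply: (cf_comp (phi := fun u => f u z)). Qed.

Lemma cf_add X (phi psi : (X -> R) -> R) : cont_form phi -> cont_form psi ->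
  cont_form (fun t => phi t + psi t).
Proof.
move=> /cont_formP[lp cp] /cont_formP[lq cq]; apply/cont_formP; split.
  by move=> a u v; rewrite lp lq; ring.
move=> n; have [s sp] := cp n; have [s' sq] := cq n; exists (s ++ s') => u su.
by apply: adJD; [apply: sp|apply: sq] => x xs; apply: su; apply/List.in_app_iff; tauto.
Qed.

Lemma cf_scale X a (phi : (X -> R) -> R) : cont_form phi -> cont_form (fun t => a * phi t).
Proof.
move=> /cont_formP[lp cp]; apply/cont_formP; split.
  by move=> b u v; rewrite lp; ring.
by move=> n; have [s sp] := cp n; exists s => u su; apply: adJM; apply: sp.
Qed.

Lemma cf_scaler X a (phi : (X -> R) -> R) : cont_form phi -> cont_form (fun t => phi t * a).
Proof.
by move=> cp; have := cf_scale a cp; congr cont_form; apply/funext => t; rewrite mulrC.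
Qed.

Lemma cf_opp X (phi : (X -> R) -> R) : cont_form phi -> cont_form (fun t => - phi t).
Proof.
by move=> cp; have := cf_scale (-1) cp; congr cont_form; apply/funext => t; rewrite mulN1r.
Qed.

Lemma cf_zero X : cont_form (fun _ : X -> R => 0 : R).
Proof.
apply/cont_formP; split; first by move=> a u v; rewrite mulr0 addr0.
by move=> n; exists [::] => u _; exact: adJ0.
Qed.

Lemma cf_ext_dlt X (phi psi : (X -> R) -> R) : cont_form phi -> cont_form psi ->
  (forall x, phi (dlt x) = psi (dlt x)) -> forall u, phi u = psi u.
Proof.
move=> cp cq pq u; apply/eqP; rewrite -subr_eq0; apply/eqP.
move: u; apply: (@submodule_closed_total _ _ _ [set u | phi u - psi u = 0]).
- split; first by rewrite /= !lin0 ?subr0 //; exact: cf_lin.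
  move=> a u v /= u0 v0; rewrite (cf_lin cp) (cf_lin cq).
  have -> : a * phi u + phi v - (a * psi u + psi v) =
    a * (phi u - psi u) + (phi v - psi v) by ring.
  by rewrite u0 v0 mulr0 addr0.
- apply/closed_ptwsP => u uV /=; apply: adJ_sep => n.
  have [s sn] := cf_small n (cf_add cp (cf_opp cq)).
  have [v /= v0 /sn] := uV s n.
  rewrite (linB _ _ (cf_lin cp)) (linB _ _ (cf_lin cq)) => H.
  have -> : phi u - psi u = phi u - phi v - (psi u - psi v) + (phi v - psi v) by ring.
  by rewrite v0 addr0.
- by move=> x /=; rewrite pq subrr.
Qed.

Lemma cf_ext X Y (phi psi : (X * Y -> R) -> R) : cont_form phi -> cont_form psi ->
  (forall u v, phi (tens u v) = psi (tens u v)) -> forall t, phi t = psi t.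
Proof. by move=> cp cq pq t; apply: cf_ext_dlt => // -[x y]; rewrite -tens_dlt. Qed.

Lemma cl_ext X Y Z (f g : (X * Y -> R) -> Z -> R) : cont_linear f -> cont_linear g ->
  (forall u v, f (tens u v) = g (tens u v)) -> forall t, f t = g t.
Proof.
move=> /cont_linearP cf /cont_linearP cg fg t; apply/funext => z.
by apply: (cf_ext (cf z) (cg z)) => u v; rewrite fg.
Qed.

Lemma cf_pull X Y (phi : (X -> R) -> R) (psi : (Y -> R) -> R) :
  cont_form phi -> cont_form psi ->
  cont_form (fun t : X * Y -> R => phi (fun x => psi (fun y => t (x, y)))).
Proof.
move=> cp cq; apply: (cf_comp (K := fun t x => psi (fun y => t (x, y)))) => // x.
apply: (cf_comp (K := fun (t : X * Y -> R) y => t (x, y))) => // y; exact: cf_coord.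
Qed.

(** Both sides are continuous in the kernel [t], and on a pure tensor of u and v both equal
    [phi u * psi v]. Hence operations on distinct tensor factors commute. *)
Lemma fubini X Y (phi : (X -> R) -> R) (psi : (Y -> R) -> R) (t : X -> Y -> R) :
  cont_form phi -> cont_form psi ->
  phi (fun x => psi (fun y => t x y)) = psi (fun y => phi (fun x => t x y)).
Proof.
move=> cp cq; pose s (p : X * Y) := t p.1 p.2.
apply: (@cf_ext _ _ (fun s : X * Y -> R => phi (fun x => psi (fun y => s (x, y))))
  (fun s : X * Y -> R => psi (fun y => phi (fun x => s (x, y)))) _ _ _ s).
  exact: cf_pull cp cq.
  apply: (cf_comp (K := fun t y => phi (fun x => t (x, y)))) => // y.
  apply: (cf_comp (K := fun (t : X * Y -> R) x => t (x, y))) => // x; exact: cf_coord.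
move=> u v; rewrite /tens /=.
have -> : (fun x => psi (fun y => u x * v y)) = psi v \*o u.
  by apply/funext => x; rewrite -[LHS]/(psi (u x \*o v)) (linZ _ _ (cf_lin cq)) mulrC.
have -> : (fun y => phi (fun x => u x * v y)) = phi u \*o v.
  apply/funext => y; have -> : (fun x => u x * v y) = v y \*o u by apply/funext => x;
    exact: mulrC.
  by rewrite (linZ _ _ (cf_lin cp)) mulrC.
by rewrite (linZ _ _ (cf_lin cp)) (linZ _ _ (cf_lin cq)) mulrC.
Qed.

Lemma closed_pre X Y (f : (X -> R) -> Y -> R) (V : set (Y -> R)) : cont_linear f ->
  closed (V : set {ptws Y -> R}) -> closed ([set u | V (f u)] : set {ptws X -> R}).
Proof.
move=> [_ cf] cV; apply: (@closed_comp {ptws X -> R} {ptws Y -> R} f V) => // u _; exact: cf.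
Qed.

Lemma closed_adJ X (phi : (X -> R) -> R) n : cont_form phi ->
  closed ([set u | adJ n (phi u)] : set {ptws X -> R}).
Proof.
move=> cp; apply/closed_ptwsP => u uV /=; have [s sn] := cf_small n cp.
have [v /= v0 /sn] := uV s n; rewrite (linB _ _ (cf_lin cp)) => uv.
by rewrite -(subrK (phi v) (phi u)); exact: adJD.
Qed.

Lemma submod_adJ X (phi : (X -> R) -> R) n : lin phi -> submodule [set u | adJ n (phi u)].
Proof.
move=> lp; split; first by rewrite /= lin0 //; exact: adJ0.
by move=> a u v /= up vp; rewrite lp; apply: adJD => //; exact: adJM.
Qed.

Lemma submod_pre X Y (f : (X -> R) -> Y -> R) (V : set (Y -> R)) : cont_linear f ->
  submodule V -> submodule [set u | V (f u)].
Proof.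
move=> cf [V0 Vl]; split=> [/=|a u v /= Vu Vv]; last by rewrite cf.1; exact: Vl.
suff -> : f 0 = 0 by [].
by apply/funext => y; have /cont_linearP/(_ y)/cf_lin/lin0 := cf.
Qed.

Lemma submodule_span X (S : set (X -> R)) : submodule (closed_span S).
Proof.
split; first by move=> V [].
by move=> a u v Su Sv V sV cV SV; apply: sV.2; [exact: Su|exact: Sv].
Qed.

Lemma closed_closed_span X (S : set (X -> R)) :
  closed (closed_span S : set {ptws X -> R}).
Proof.
apply/closed_ptwsP => u uS V sV cV SV; move/closed_ptwsP: (cV); apply => s n.
by have [v Sv uv] := uS s n; exists v => //; apply: Sv.
Qed.

Lemma sub_closed_span X (S : set (X -> R)) : S `<=` closed_span S.
Proof. by move=> u Su V _ _; apply. Qed.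

(** The induction principle for closed spans, to which the powers of ideals belong. *)
Lemma closed_span_map X Y (f : (X -> R) -> Y -> R) (S : set (X -> R)) (V : set (Y -> R)) :
  cont_linear f -> submodule V -> closed (V : set {ptws Y -> R}) ->
  (forall u, S u -> V (f u)) -> forall u, closed_span S u -> V (f u).
Proof.
move=> cf sV cV SV u Su.
exact: (Su [set u | V (f u)] (submod_pre cf sV) (closed_pre cf cV) SV).
Qed.

Lemma closed_span_form X (phi : (X -> R) -> R) n (S : set (X -> R)) :
  cont_form phi -> (forall u, S u -> adJ n (phi u)) ->
  forall u, closed_span S u -> adJ n (phi u).
Proof.
move=> cp SV u Su.
exact (Su [set u | adJ n (phi u)] (@submod_adJ _ _ n (cf_lin cp)) (@closed_adJ _ _ n cp) SV).
Qed.

End Calculus.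

(* The prefixes cf and cl stand for [cont_form] and [cont_linear]. The tactic treats
   a goal [cont_form (fun t => ...)] as an iterated integral: tensor operations are
   unfolded to coordinates and forms are integrated over their bound coordinates. *)
Create HintDb cf.

Ltac cf_leaf := first [eassumption | solve [eauto 4 with cf nocore]].
Ltac cf_step :=
  lazymatch goal with
  | |- forall y, _ => intros ?; cbv beta
  | |- cont_linear _ => apply/cont_linearP => ?; cbv beta
  | |- cont_form _ => first [
      cf_leaf |
      match goal with
      | |- cont_form (fun t => t ?x) => exact: cf_coord
      | |- cont_form (fun t => 0) => exact: cf_zero
      | |- cont_form (fun t => (@?a t + @?b t) ?y) => change (cont_form (fun t => a t y + b t
        y))
      | |- cont_form (fun t => (- @?a t) ?y) => change (cont_form (fun t => - a t y))
      | |- cont_form (fun t => (@?c t \*o @?a t) ?y) => change (cont_form (fun t => c t * a t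
        y))
      | |- cont_form (fun t => @?a t + @?b t) => apply: (@cf_add _ _ _ a b)
      | |- cont_form (fun t => - @?a t) => apply: (@cf_opp _ _ _ a)
      | |- cont_form (fun t => ?c * @?a t) => apply: (@cf_scale _ _ _ c a)
      | |- cont_form (fun t => @?a t * ?c) => apply: (@cf_scaler _ _ _ c a)
      | |- cont_form (fun t => ?phi (@?K t)) => apply: (@cf_comp _ _ _ _ phi K);
        [cf_leaf|cbv beta]
      | |- cont_form (fun t => ?f (@?K t) ?z) => apply: (@cf_compl _ _ _ _ _ f K z);
        [cf_leaf|cbv beta]
      end ]
  end.
Ltac cf := cbv beta delta [mulb brk tens tmap lmap rmap lform rform tform mid4 tassoc flip
  flip_form]; cbv beta; cbn [fst snd]; repeat (cf_step; cbv beta; cbn [fst snd]).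

Section TensorMaps.
Context {R : topComNzRingType} {aR : adic R}.
Lemma cl_tmap X Y X' Y' (f : (X -> R) -> Y -> R) (g : (X' -> R) -> Y' ->
  R) : cont_linear f -> cont_linear g -> cont_linear (tmap f g).
Proof. by move=> cf cg; cf. Qed.
Lemma cl_tassoc X Y Z : cont_linear (@tassoc R X Y Z).
Proof. by cf. Qed.
Lemma cl_flip X Y  : cont_linear (@flip R X Y).
Proof. by cf. Qed.
Lemma cf_flip_form X Y (phi : (X * Y -> R) -> R) : cont_form phi -> cont_form (flip_form phi).
Proof. by move=> cp; cf. Qed.
End TensorMaps.
#[export] Hint Resolve cl_tmap cl_tassoc cl_flip cf_flip_form : cf.

(** * Tensor products of coalgebras and bialgebras *)

Section Bialgebras.
Context {R : topComNzRingType} {aR : adic R}.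

Section Tens.
Implicit Types X Y Z : Type.

Lemma lin_mulr X (phi : (X -> R) -> R) u a : lin phi -> phi (fun x => u x * a) = phi u * a.
Proof.
move=> lp; rewrite mulrC -(linZ _ _ lp); congr phi; apply/funext => x; exact: mulrC.
Qed.

Lemma lin_mull X (phi : (X -> R) -> R) u a : lin phi -> phi (fun x => a * u x) = a * phi u.
Proof. exact: linZ. Qed.

Lemma cl_lin X Y (f : (X -> R) -> Y -> R) y : cont_linear f -> lin (fun u => f u y).
Proof. by move/cont_linearP/(_ y)/cf_lin. Qed.

Lemma cl_mulr X Y (f : (X -> R) -> Y -> R) u a y : cont_linear f ->
  f (fun x => u x * a) y = f u y * a.
Proof. by move=> cf; rewrite (lin_mulr _ _ (cl_lin y cf)). Qed.

Lemma cl_mull X Y (f : (X -> R) -> Y -> R) u a y : cont_linear f ->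
  f (fun x => a * u x) y = a * f u y.
Proof. by move=> cf; rewrite (lin_mull _ _ (cl_lin y cf)). Qed.

Lemma cl_form X Y (f : (X -> R) -> Y -> R) y : cont_linear f -> cont_form (fun u => f u y).
Proof. by move/cont_linearP. Qed.

Lemma clD X Y (f : (X -> R) -> Y -> R) u v : cont_linear f -> f (u + v) = f u + f v.
Proof. by move=> cf; apply/funext => y; have := linD u v (cl_lin y cf). Qed.

Lemma clN X Y (f : (X -> R) -> Y -> R) u : cont_linear f -> f (- u) = - f u.
Proof. by move=> cf; apply/funext => y; have := linN u (cl_lin y cf). Qed.

Lemma clB X Y (f : (X -> R) -> Y -> R) u v : cont_linear f -> f (u - v) = f u - f v.
Proof. by move=> cf; rewrite clD // clN. Qed.

Lemma cl0 X Y (f : (X -> R) -> Y -> R) : cont_linear f -> f 0 = 0.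
Proof. by move=> cf; apply/funext => y; have := lin0 (cl_lin y cf). Qed.

Lemma clZ X Y (f : (X -> R) -> Y -> R) a u : cont_linear f -> f (a \*o u) = a \*o f u.
Proof. by move=> cf; apply/funext => y; have := linZ a u (cl_lin y cf). Qed.

Lemma tmap_tens X Y X' Y' (f : (X -> R) -> Y -> R) (g : (X' -> R) -> Y' -> R) u v :
  cont_linear f -> cont_linear g -> tmap f g (tens u v) = tens (f u) (g v).
Proof.
move=> cf cg; apply/funext => -[y y']; rewrite /tmap /lmap /rmap /tens /=.
rewrite -(cl_mulr _ _ _ cf); congr (f _ y); apply/funext => x; exact: cl_mull.
Qed.

Lemma mid4_tens X Y Z T (a : X -> R) (b : Y -> R) (c : Z -> R) (d : T -> R) :
  mid4 (tens (tens a b) (tens c d)) = tens (tens a c) (tens b d).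
Proof. by apply/funext => -[[x z] [y t]]; rewrite /mid4 /tens /= mulrACA. Qed.

Lemma flip_tens X Y (u : X -> R) (v : Y -> R) : flip (tens u v) = tens v u.
Proof. by apply/funext => -[y x]; rewrite /flip /tens /= mulrC. Qed.

Lemma tform_tens X Y (phi : (X -> R) -> R) (psi : (Y -> R) -> R) u v :
  cont_form phi -> cont_form psi -> tform phi psi (tens u v) = phi u * psi v.
Proof.
move=> cp cq; rewrite /tform -(lin_mulr _ _ (cf_lin cp)); congr phi.
by apply/funext => x; rewrite /rform /tens /= (lin_mull _ _ (cf_lin cq)).
Qed.

Lemma rform_tens X Y (psi : (Y -> R) -> R) (u : X -> R) v :
  cont_form psi -> rform psi (tens u v) = psi v \*o u.
Proof. by move=> cq; apply/funext => x;
  rewrite /rform /tens /= (lin_mull _ _ (cf_lin cq)) mulrC. Qed.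

Lemma lform_tens X Y (psi : (X -> R) -> R) u (v : Y -> R) :
  cont_form psi -> lform psi (tens u v) = psi u \*o v.
Proof. by move=> cq; apply/funext => x; rewrite /lform /tens /= (lin_mulr _ _ (cf_lin cq)). Qed.

Lemma tformC X Y (phi : (X -> R) -> R) (psi : (Y -> R) -> R) t :
  cont_form phi -> cont_form psi -> tform phi psi t = psi (lform phi t).
Proof. by move=> cp cq; exact: (fubini (fun x y => t (x, y)) cp cq). Qed.

Lemma rform_lmap Y Z T (f : (Y -> R) -> Z -> R) (c : (T -> R) -> R) t :
  cont_linear f -> cont_form c -> rform c (lmap f t) = f (rform c t).
Proof.
move=> cf cc; apply/funext => z.
exact/esym/(fubini (fun y x => t (y, x)) (cl_form z cf) cc).
Qed.

Lemma lform_rmap Y Z T (f : (Y -> R) -> Z -> R) (c : (T -> R) -> R) t :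
  cont_linear f -> cont_form c -> lform c (rmap f t) = f (lform c t).
Proof.
move=> cf cc; apply/funext => z.
exact: (fubini (fun x y => t (x, y)) cc (cl_form z cf)).
Qed.

Lemma tmapC X Y X' Y' (f : (X -> R) -> Y -> R) (g : (X' -> R) -> Y' -> R) t :
  cont_linear f -> cont_linear g -> tmap f g t = rmap g (lmap f t).
Proof.
move=> cf cg; apply/funext => -[y y'].
exact: (fubini (fun x y => t (x, y)) (cl_form y cf) (cl_form y' cg)).
Qed.

Lemma tform_tmap X Y X' Y' (f : (X -> R) -> Y -> R) (g : (X' -> R) -> Y' -> R) phi psi t :
  cont_linear f -> cont_linear g -> cont_form phi -> cont_form psi ->
  tform phi psi (tmap f g t) = tform (phi \o f) (psi \o g) t.
Proof.
move=> cf cg cp cq; rewrite /tform /=; congr phi; apply/funext => y.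
exact: (fubini (fun y' x => g (fun x' => t (x, x')) y') cq (cl_form y cf)).
Qed.

Lemma tmap_comp X Y Z X' Y' Z' (f : (Y -> R) -> Z -> R) (g : (Y' -> R) -> Z' -> R)
  (f' : (X -> R) -> Y -> R) (g' : (X' -> R) -> Y' -> R) t :
  cont_linear f -> cont_linear g -> cont_linear f' -> cont_linear g' ->
  tmap f g (tmap f' g' t) = tmap (f \o f') (g \o g') t.
Proof.
move=> cf cg cf' cg'; apply/funext => -[z z'].
exact: (tform_tmap t cf' cg' (cl_form z cf) (cl_form z' cg)).
Qed.

End Tens.

(** For equal factors this is convertible to [bialg2]. Distinct factors are needed for the triple
    tensor products in the associativity of the deformation. *)
Definition btens X Y (H : bialg R X) (K : bialg R Y) : bialg R (X * Y) :=
  {| bmul := fun t => tmap (bmul H) (bmul K) (mid4 t);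
     bone := tens (bone H) (bone K);
     bcomul := fun t => mid4 (tmap (bcomul H) (bcomul K) t);
     bcounit := tform (bcounit H) (bcounit K) |}.

Record coalg X (H : bialg R X) : Prop := Coalg {
  coalg_comul : cont_linear (bcomul H);
  coalg_counit : cont_form (bcounit H);
  coalg_coassoc : forall x, tassoc (lmap (bcomul H) (bcomul H x)) =
    rmap (bcomul H) (bcomul H x);
  coalg_counitl : forall x, lform (bcounit H) (bcomul H x) = x;
  coalg_counitr : forall x, rform (bcounit H) (bcomul H x) = x }.

(** The antipode is left out: for the deformation it is built by [antipode_lift] once these axioms
    are known. *)
Record bialgebra X (H : bialg R X) : Prop := Bialgebra {
  bialg_coalg :> coalg H;
  bialg_mul : cont_linear (bmul H);
  bialg_mulA : forall x y z, mulb H (mulb H x y) z = mulb H x (mulb H y z);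
  bialg_mul1l : forall x, mulb H (bone H) x = x;
  bialg_mul1r : forall x, mulb H x (bone H) = x;
  bialg_comulM : forall x y, bcomul H (mulb H x y) = mulb (btens H H) (bcomul H x) (bcomul H y);
  bialg_comul1 : bcomul H (bone H) = tens (bone H) (bone H);
  bialg_counitM : forall x y, bcounit H (mulb H x y) = bcounit H x * bcounit H y;
  bialg_counit1 : bcounit H (bone H) = 1 }.

Lemma hopf_bialgebra X (H : bialg R X) : topological_hopf H -> bialgebra H.
Proof. by case=> *; split. Qed.

Hint Resolve coalg_comul coalg_counit bialg_coalg bialg_mul cl_form : cf.

Lemma coassocE X (H : bialg R X) (cH : coalg H) x1 x2 x3 u :
  bcomul H (fun x => bcomul H u (x, x3)) (x1, x2) =
    bcomul H (fun x => bcomul H u (x1, x)) (x2, x3).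
Proof. by have := congr1 (fun f => f (x1, (x2, x3))) (coalg_coassoc cH u). Qed.

Lemma counitlE X (H : bialg R X) (cH : coalg H) u y : bcounit H (fun x => bcomul H u (x, y))
  = u y.
Proof. by have := congr1 (fun f => f y) (coalg_counitl cH u). Qed.

Lemma counitrE X (H : bialg R X) (cH : coalg H) u y : bcounit H (fun x => bcomul H u (y, x))
  = u y.
Proof. by have := congr1 (fun f => f y) (coalg_counitr cH u). Qed.

(** Fubini moves all operations on Y inside those on X; then the axiom of each factor applies to one
    variable at a time. *)
Lemma coalg_btens X Y (H : bialg R X) (K : bialg R Y) : coalg H -> coalg K -> coalg (btens H K).
Proof.
move=> cH cK; split=> [||t|t|t] /=; [by cf|by cf|..].
- apply/funext => -[[x1 y1] [[x2 y2] [x3 y3]]].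
  rewrite /tassoc /lmap /rmap /mid4 /tmap /lmap /rmap /=.
  transitivity (bcomul H (fun x => bcomul H (fun x' => bcomul K (fun y => bcomul K (fun y' =>
    t (x', y')) (y, y3)) (y1, y2)) (x, x3)) (x1, x2)).
    congr (bcomul H _ _); apply/funext => x.
    exact: (fubini (fun y x' => bcomul K (fun y' => t (x', y')) (y, y3)) (cl_form (y1, y2)
      (coalg_comul cK)) (cl_form (x, x3) (coalg_comul cH))).
  rewrite coassocE //; congr (bcomul H _ _); apply/funext => x.
  have -> : (fun x' => bcomul K (fun y => bcomul K (fun y' => t (x', y')) (y, y3)) (y1, y2))
    = (fun x' => bcomul K (fun y => bcomul K (fun y' => t (x', y')) (y1, y)) (y2, y3)).
    by apply/funext => x'; rewrite coassocE.
  exact: (fubini (fun x' y => bcomul K (fun y' => t (x', y')) (y1, y)) (cl_form (x1, x)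
    (coalg_comul cH)) (cl_form (y2, y3) (coalg_comul cK))).
- apply/funext => -[x y]; rewrite /lform /tform /rform /mid4 /tmap /lmap /rmap /=.
  transitivity (bcounit H (fun x' => bcomul H (fun x => bcounit K (fun y' => bcomul K (fun y
    => t (x, y)) (y', y))) (x', x))).
    congr (bcounit H _); apply/funext => x'.
    exact: (fubini (fun y' x => bcomul K (fun y => t (x, y)) (y', y)) (coalg_counit cK)
      (cl_form (x', x) (coalg_comul cH))).
  rewrite counitlE // counitlE //.
- apply/funext => -[x y]; rewrite /lform /tform /rform /mid4 /tmap /lmap /rmap /=.
  transitivity (bcounit H (fun x' => bcomul H (fun x => bcounit K (fun y' => bcomul K (fun y
    => t (x, y)) (y, y'))) (x, x'))).
    congr (bcounit H _); apply/funext => x'.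
    exact: (fubini (fun y' x => bcomul K (fun y => t (x, y)) (y, y')) (coalg_counit cK)
      (cl_form (x, x') (coalg_comul cH))).
  rewrite counitrE // counitrE //.
Qed.

Lemma cl_mulbl X (H : bialg R X) x : cont_linear (bmul H) -> cont_linear (mulb H x).
Proof. by move=> cH; rewrite /mulb; cf. Qed.

Lemma cl_mulbr X (H : bialg R X) x : cont_linear (bmul H) -> cont_linear (fun y => mulb H y x).
Proof. by move=> cH; rewrite /mulb; cf. Qed.

End Bialgebras.
#[export] Hint Resolve coalg_comul coalg_counit bialg_coalg bialg_mul cl_form cl_mulbl
  cl_mulbr : cf.

Section BialgebraTensor.
Context {R : topComNzRingType} {aR : adic R}.

Lemma mulb_btens X Y (H : bialg R X) (K : bialg R Y) a b c d : bialgebra H -> bialgebra K ->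
  mulb (btens H K) (tens a b) (tens c d) = tens (mulb H a c) (mulb K b d).
Proof. by move=> bH bK; rewrite /mulb /= mid4_tens tmap_tens //; cf. Qed.

Lemma cl_bmul_btens X Y (H : bialg R X) (K : bialg R Y) : bialgebra H -> bialgebra K ->
  cont_linear (bmul (btens H K)).
Proof. by move=> bH bK /=; cf. Qed.

Lemma mulb_mid4 X Y (H : bialg R X) (K : bialg R Y) s s' t t' : bialgebra H -> bialgebra K ->
  mid4 (tens (mulb (btens H H) s s') (mulb (btens K K) t t')) =
  mulb (btens (btens H K) (btens H K)) (mid4 (tens s t)) (mid4 (tens s' t')).
Proof.
move=> bH bK.
have mHH := cl_bmul_btens bH bH; have mKK := cl_bmul_btens bK bK.
have mHK : cont_linear (bmul (btens (btens H K) (btens H K))).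
  by have := cl_bmul_btens bH bK => mHK /=; cf.
move: s; apply: cl_ext => [||a1 a2]; [by cf|by cf|].
move: s'; apply: cl_ext => [||a1' a2']; [by cf|by cf|].
move: t; apply: cl_ext => [||b1 b2]; [by cf|by cf|].
move: t'; apply: cl_ext => [||b1' b2']; [by cf|by cf|].
rewrite !mid4_tens (mulb_btens _ _ _ _ bH bH) (mulb_btens _ _ _ _ bK bK) mid4_tens.
rewrite {1}/mulb /= mid4_tens tmap_tens; [|by apply: cl_bmul_btens..].
by congr tens; exact/esym/mulb_btens.
Qed.

Lemma bialgebra_btens X Y (H : bialg R X) (K : bialg R Y) : bialgebra H -> bialgebra K ->
  bialgebra (btens H K).
Proof.
move=> bH bK; have cHK : coalg (btens H K) by apply: coalg_btens; exact: bialg_coalg.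
have mHK := cl_bmul_btens bH bK.
have dHK := coalg_comul cHK; have eHK := coalg_counit cHK.
split=> //.
- move=> x y z.
  move: x; apply: cl_ext => [||a1 a2]; [by cf|by cf|].
  move: y; apply: cl_ext => [||b1 b2]; [by cf|by cf|].
  move: z; apply: cl_ext => [||c1 c2]; [by cf|by cf|].
  by rewrite !mulb_btens // !bialg_mulA.
- apply: cl_ext => [||a b]; [by cf|by cf|].
  by rewrite mulb_btens // !bialg_mul1l.
- apply: cl_ext => [||a b]; [by cf|by cf|].
  by rewrite mulb_btens // !bialg_mul1r.
- move=> x y.
  have m3 : cont_linear (bmul (btens (btens H K) (btens H K))) by rewrite /=; cf.
  move: x; apply: cl_ext => [||a1 a2]; [by cf|by cf|].
  move: y; apply: cl_ext => [||b1 b2]; [by cf|by cf|].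
  rewrite mulb_btens // /= !tmap_tens; [|by cf..].
  by rewrite !bialg_comulM // mulb_mid4.
- by rewrite /= tmap_tens ?bialg_comul1 ?mid4_tens //; cf.
- move=> x y.
  move: x; apply: cf_ext => [||a1 a2]; [by cf|by cf|].
  move: y; apply: cf_ext => [||b1 b2]; [by cf|by cf|].
  rewrite mulb_btens // /= !tform_tens; [|by cf..].
  by rewrite !bialg_counitM // mulrACA.
- by rewrite /= tform_tens ?bialg_counit1 ?mulr1 //; cf.
Qed.
End BialgebraTensor.

(** * Convolution, and the dual as a convolution algebra *)

Section Convolution.
Context {R : topComNzRingType} {aR : adic R}.
Variables (X : Type) (H : bialg R X) (cH : coalg H).
Implicit Types a b c : (X -> R) -> R.

Lemma cf_conv a b : cont_form a -> cont_form b -> cont_form (conv H a b).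
Proof. by move=> ca cb; rewrite /conv; cf. Qed.

Lemma convA a b c : cont_form a -> cont_form b -> cont_form c ->
  conv H (conv H a b) c = conv H a (conv H b c).
Proof.
move=> ca cb cc; apply/funext => t; rewrite /conv.
transitivity (tform a (tform b c) (tassoc (lmap (bcomul H) (bcomul H t)))).
  by rewrite [LHS]/tform -rform_lmap //; cf.
by rewrite coalg_coassoc.
Qed.

Lemma conv1l a : cont_form a -> conv H (bcounit H) a = a.
Proof.
move=> ca; apply/funext => t; rewrite /conv tformC //; last by cf.
by rewrite coalg_counitl.
Qed.

Lemma conv1r a : conv H a (bcounit H) = a.
Proof. by apply/funext => t; rewrite /conv /tform coalg_counitr. Qed.

Lemma convDr a b c : cont_form a -> conv H a (b + c) = conv H a b + conv H a c.
Proof.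
move=> ca; apply/funext => t.
exact: (linD (rform b (bcomul H t)) (rform c (bcomul H t)) (cf_lin ca)).
Qed.

Lemma convZl r a b : conv H (r \*o a) b = r \*o conv H a b.
Proof. by []. Qed.

Lemma convZr r a b : cont_form a -> conv H a (r \*o b) = r \*o conv H a b.
Proof.
move=> ca; apply/funext => t; exact: (linZ r (rform b (bcomul H t)) (cf_lin ca)).
Qed.

End Convolution.
#[export] Hint Resolve cf_conv : cf.

Section Dual.
Variables (k : fieldType) (X : Type) (H : bialg (series k) X) (bH : bialgebra H).
Let I := quantum_ideal H.
Let Ip := ideal_pow H I.

Let cH : coalg H := bialg_coalg bH.
Let mH : cont_linear (bmul H) := bialg_mul bH.

Lemma quantum_ideal_mull h x : I x -> I (mulb H h x).
Proof.
move=> [y [z [z0 ->]]]; exists (mulb H h y), (mulb H h z); split.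
  by rewrite bialg_counitM // z0 mulr0.
by rewrite (clD _ _ (cl_mulbl h mH)) (clZ _ _ (cl_mulbl h mH)).
Qed.

Lemma submod_ideal_pow n : submodule (Ip n).
Proof. by case: n => [|n]; [split|exact: submodule_span]. Qed.

Lemma closed_ideal_pow n : closed (Ip n : set {ptws X -> series k}).
Proof. by case: n => [|n]; [exact: closedT|exact: closed_closed_span]. Qed.

Lemma ideal_pow_mul n x y : I x -> Ip n y -> Ip n.+1 (mulb H x y).
Proof. by move=> Ix Iy; apply: sub_closed_span; exists x, y. Qed.

(** The recursion multiplies by I on the left, and h (u v) = (h u) v with h u again in I. *)
Lemma ideal_pow_mull n h x : Ip n x -> Ip n (mulb H h x).
Proof.
case: n => // n; apply: (closed_span_map (f := mulb H h) (V := Ip n.+1)).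
- exact: cl_mulbl.
- exact: (submod_ideal_pow n.+1).
- exact: (@closed_ideal_pow n.+1).
move=> _ [u [v [Iu Iv ->]]]; rewrite -bialg_mulA //.
by apply: ideal_pow_mul => //; exact: quantum_ideal_mull.
Qed.

Lemma ideal_pow_le m n x : (m <= n)%N -> Ip n x -> Ip m x.
Proof.
move=> /subnK <-; elim: (n - m)%N => // d IH Ix; apply: IH; move: Ix; rewrite addSn.
apply: (closed_span_map (f := id) (V := Ip (d + m))) => //;
  [by cf|exact: submod_ideal_pow|exact: closed_ideal_pow|].
by move=> _ [u [v [Iu Iv ->]]]; exact: ideal_pow_mull.
Qed.

(* The closure of the sum of the I^i (x) I^j with i + j = m; it contains Delta(I^m),
   which is why convolution preserves the dual. *)
Definition tens_pow m : set (X * X -> series k) := closed_span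
  [set t | exists i j u v, [/\ (i + j)%N = m, Ip i u, Ip j v & t = tens u v]].

(** The closure of I (x) H + H (x) I. Multiplication by one of its generators raises one of the two
    exponents in [tens_pow]. *)
Definition tens1 : set (X * X -> series k) := closed_span
  [set t | exists u v, (I u \/ I v) /\ t = tens u v].

Lemma tens_powS m s t : tens1 s -> tens_pow m t -> tens_pow m.+1 (mulb (btens H H) s t).
Proof.
have mHH : cont_linear (bmul (btens H H)) by exact: bialg_mul (bialgebra_btens bH bH).
move=> Ts Tt; move: s Ts; apply: (closed_span_map (f := fun s => mulb (btens H H) s t) (V :=
  tens_pow m.+1)).
- exact: cl_mulbr.
- exact: submodule_span.
- exact: closed_closed_span.
move=> _ [a [b [Iab ->]]]; move: t Tt.
apply: (closed_span_map (f := mulb (btens H H) (tens a b)) (V := tens_pow m.+1)).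
- exact: cl_mulbl.
- exact: submodule_span.
- exact: closed_closed_span.
move=> _ [i [j [c [d [ij Ic Id ->]]]]]; rewrite mulb_btens //; apply: sub_closed_span.
case: Iab => [Ia|Ib].
  exists i.+1, j, (mulb H a c), (mulb H b d); split=> //; first by rewrite addSn ij.
    exact: ideal_pow_mul.
  exact: ideal_pow_mull.
exists i, j.+1, (mulb H a c), (mulb H b d); split=> //; first by rewrite addnS ij.
  exact: ideal_pow_mull.
exact: ideal_pow_mul.
Qed.

(** Since u - eps(u) 1 lies in I, the splitting u (x) v - eps(u) eps(v) 1 (x) 1 = (u - eps(u) 1) (x)
    v + eps(u) 1 (x) (v - eps(v) 1) settles pure tensors, and density the others. In particular a
    tensor killed by eps (x) eps lies in [tens1]. *)
Lemma tens1_unit t : tens1 (t - bcounit (btens H H) t \*o tens (bone H) (bone H)).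
Proof.
have eH := coalg_counit cH.
have I1 u : I (u - bcounit H u \*o bone H).
  exists 0, (u - bcounit H u \*o bone H); split; last by apply/funext => x;
    rewrite !fE mulr0 add0r.
  by rewrite linB ?linZ ?bialg_counit1 ?mulr1 ?subrr //; exact: cf_lin.
have [T0 Tl] := submodule_span [set t | exists u v, (I u \/ I v) /\ t = tens u v].
have TD u v : tens1 u -> tens1 v -> tens1 (u + v).
  move=> Tu Tv; have := Tl 1 _ _ Tu Tv; congr tens1; apply/funext => x.
  by rewrite !fE mul1r.
move: t; apply: tens_total.
- apply: (submod_pre (f := fun t => t - bcounit (btens H H) t \*o tens (bone H) (bone H)));
  last exact: submodule_span.
  by rewrite /=; cf.
- apply: (closed_pre (f := fun t => t - bcounit (btens H H) t \*o tens (bone H) (bone H)));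
  last exact: closed_closed_span.
  by rewrite /=; cf.
move=> u v; rewrite /= tform_tens //.
have -> : tens u v - (bcounit H u * bcounit H v) \*o tens (bone H) (bone H) =
  tens (u - bcounit H u \*o bone H) v +
  tens (bcounit H u \*o bone H) (v - bcounit H v \*o bone H).
  by apply/funext => -[x y]; rewrite !fE /tens !fE /=; ring.
by apply: TD; apply: sub_closed_span; do 2 eexists; split; try by []; [left|right].
Qed.

Lemma tens1_hbar t : tens1 (hbar \*o t).
Proof.
move: t; apply: tens_total.
- apply: (submod_pre (f := fun t => hbar \*o t)); [by cf|exact: submodule_span].
- apply: (closed_pre (f := fun t => hbar \*o t)); [by cf|exact: closed_closed_span].
move=> u v; apply: sub_closed_span; exists (hbar \*o u), v; split.
  left; exists u, 0; split; first exact: lin0 (cf_lin (coalg_counit cH)).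
  by apply/funext => x; rewrite !fE addr0.
by apply/funext => -[x y]; rewrite !fE /tens mulrA.
Qed.

Lemma comul_ideal x : I x -> tens1 (bcomul H x).
Proof.
have dH := coalg_comul cH; have eH := coalg_counit cH.
move=> [y [z [z0 ->]]].
have [T0 Tl] := submodule_span [set t | exists u v, (I u \/ I v) /\ t = tens u v].
have -> : bcomul H (hbar \*o y + z) = 1 \*o (hbar \*o bcomul H y) + bcomul H z.
  by rewrite dH.1; congr (_ + _); apply/funext => t; rewrite !fE mul1r.
apply: Tl; first exact: tens1_hbar.
have := tens1_unit (bcomul H z).
have -> : bcounit (btens H H) (bcomul H z) = 0.
  by rewrite -z0 /= /tform (coalg_counitr cH).
by congr tens1; apply/funext => t; rewrite !fE mul0r subr0.
Qed.

Lemma comul_ideal_pow m x : Ip m x -> tens_pow m (bcomul H x).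
Proof.
have dH := coalg_comul cH.
elim: m x => [|m IH] x.
  move=> _; move: (bcomul H x); apply: tens_total.
  - exact: submodule_span.
  - exact: closed_closed_span.
  by move=> u v; apply: sub_closed_span; exists 0%N, 0%N, u, v.
apply: (closed_span_map (f := bcomul H) (V := tens_pow m.+1)) => //.
- exact: submodule_span.
- exact: closed_closed_span.
move=> _ [u [v [Iu Iv ->]]]; rewrite bialg_comulM //.
by apply: tens_powS; [exact: comul_ideal|exact: IH].
Qed.

Lemma dual_conv a b : dual H a -> dual H b -> dual H (conv H a b).
Proof.
move=> [ca da] [cb db]; split; first exact: cf_conv.
move=> n; have [N aN] := da n; have [M bM] := db n; exists (N + M)%N => x /comul_ideal_pow.
apply: (closed_span_form (phi := tform a b) (n := n)); first by cf.
move=> _ [i [j [u [v [ij Iu Iv ->]]]]]; rewrite tform_tens //.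
(* As i + j = N + M, either i >= N and a is small on u, or j >= M and b is small on v. *)
case: (leqP N i) => [Ni|iN].
  by apply: adJMr; apply: aN; exact: ideal_pow_le Iu.
apply: adJM; apply: bM; apply: ideal_pow_le Iv.
by rewrite -(leq_add2l i) ij leq_add2r ltnW.
Qed.

(** On an element hbar y + z of I the counit is hbar eps(y), so on I^n it is divisible by hbar^n. *)
Lemma dual_counit : dual H (bcounit H).
Proof.
have eH := coalg_counit cH.
split=> // n; exists n; elim: n => [|n IH] x; first by move=> _; exists (bcounit H x);
  rewrite mul1r.
apply: (@closed_span_form _ _ X (bcounit H) n.+1) => //.
move=> _ [u [v [[y [z [z0 ->]]] Iv ->]]]; rewrite bialg_counitM // eH.1 z0 addr0.
have [w ->] := IH _ Iv; exists (bcounit H y * w); rewrite exprS; ring.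
Qed.

Lemma dualD a b : dual H a -> dual H b -> dual H (a + b).
Proof.
move=> [ca da] [cb db]; split; first exact: cf_add.
move=> n; have [N aN] := da n; have [M bM] := db n; exists (N + M)%N => x Ix.
by apply: hdvdD; [apply: aN|apply: bM]; apply: ideal_pow_le Ix; rewrite ?leq_addl ?leq_addr.
Qed.

Lemma dualZ r a : dual H a -> dual H (r \*o a).
Proof.
move=> [ca da]; split; first exact: cf_scale.
by move=> n; have [N aN] := da n; exists N => x Ix; apply: hdvdM; exact: aN.
Qed.

Lemma dual0 : dual H 0.
Proof. by split; [exact: cf_zero|move=> n; exists 0%N => x _; exact: hdvd0]. Qed.

(** Both continuity conditions are tested modulo each hbar^n, where s is a finite sum of elements of
    the dual; so nothing but divisibility is asked of the remainders. *)
Lemma dual_sum (r : nat -> (X -> series k) -> series k) (s : (X -> series k) -> series k) :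
  (forall n, dual H (r n)) ->
  (forall n, exists2 rho, forall x, hdvd n (rho x) & s =
    \sum_(i < n) hbar ^+ i \*o r i + rho) ->
  lin s -> dual H s.
Proof.
move=> rd sr ls.
have dM n : dual H (\sum_(i < n) hbar ^+ i \*o r i).
  by elim/big_ind: _ => [||i _]; [exact: dual0|exact: dualD|exact: dualZ].
split.
  apply/cont_formP; split=> // n; have [rho rn ->] := sr n.
  have [t tn] := cf_small n (dM n).1; exists t => u /tn Hu; exact: (hdvdD Hu (rn u)).
move=> n; have [rho rn ->] := sr n; have [N Nn] := (dM n).2 n.
by exists N => x /Nn Ix; apply: hdvdD.
Qed.

End Dual.

(** * Exponential and logarithm in complete algebras *)

Section ExpLogPoly.
Variables (k : fieldType) (char0 : [pchar k] =i pred0).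

Lemma natn0 n : (n.+1%:R : k) != 0.
Proof. by have /pcharf0P -> := char0. Qed.

Definition expp (n : nat) : {poly k} := \sum_(i < n) ((i`!)%:R^-1 : k) *: 'X^i.
Definition logp (n : nat) : {poly k} := \sum_(i < n) ((-1) ^+ i / i.+1%:R) *: 'X^(i.+1).

Lemma deriv_expp n : (expp n.+1)^`() = expp n.
Proof.
rewrite /expp big_ord_recl derivD derivZ derivXn /= mulr0n scaler0 add0r raddf_sum.
apply: eq_bigr => i _; rewrite /= derivZ derivXn /= -scaler_nat scalerA; congr (_ *: _).
by rewrite /bump leq0n add1n factS natrM invfM mulrAC mulVf ?natn0 // mul1r.
Qed.

Lemma deriv_logp n : (1 + 'X) * (logp n)^`() = 1 - (- 'X) ^+ n.
Proof.
have -> : (logp n)^`() = \sum_(i < n) (- 'X) ^+ i.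
  rewrite /logp raddf_sum; apply: eq_bigr => i _ /=.
  rewrite derivZ derivXn /= -scaler_nat scalerA -mulrA mulVf ?natn0 // mulr1.
  by rewrite [RHS]exprNn -mul_polyC polyC_exp polyCN polyC1.
by apply: oppr_inj; rewrite opprB subrX1 -mulNr; congr (_ * _); ring.
Qed.

Definition Xdvd (n : nat) (p : {poly k}) := exists q, p = 'X^n * q.

Lemma XdvdP n p : Xdvd n p <-> forall i, (i < n)%N -> p`_i = 0.
Proof.
split=> [[q ->] i lt|p0]; first by rewrite coefXnM lt.
exists (\poly_(i < size p) p`_(n + i)); apply/polyP => i; rewrite coefXnM coef_poly.
case: ltnP => [/p0 //|le]; rewrite subnKC //; case: ltnP => // le'.
by rewrite nth_default // (leq_trans le') // leq_subr.
Qed.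

Lemma logp_dvd n : exists q, logp n = 'X * q.
Proof.
exists (\sum_(i < n) ((-1) ^+ i / i.+1%:R) *: 'X^i); rewrite mulr_sumr.
by apply: eq_bigr => i _; rewrite exprS -scalerAr.
Qed.

Lemma expp_comp n (p : {poly k}) : expp n \Po p = \sum_(i < n) (i`!%:R)^-1 *: p ^+ i.
Proof.
rewrite /expp raddf_sum; apply: eq_bigr => i _ /=.
by rewrite comp_polyZ comp_Xn_poly.
Qed.

(* D = exp(log(1 + X)) satisfies (1 + X) D' = D up to truncation, which forces its
   coefficients to be those of 1 + X. *)
Lemma exp_log n : Xdvd n (expp n \Po logp n - (1 + 'X)).
Proof.
case: n => [|n]; first by exists (expp 0 \Po logp 0 - (1 + 'X)); rewrite mul1r.
set L := logp n.+1; set D := expp n.+1 \Po L.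
have [q Lq] : exists q, L = 'X * q := logp_dvd n.+1.
have DD : Xdvd n ((1 + 'X) * D^`() - D).
  rewrite deriv_comp deriv_expp mulrCA deriv_logp.
  have -> : D = expp n \Po L + (n`!%:R)^-1 *: L ^+ n.
    by rewrite /D !expp_comp big_ord_recr.
  (* Two defects of truncation: (- X)^(n+1) from [deriv_logp], and L^n / n!, the top term of D that
     is missing in its derivative. X^n divides both, since X divides L. *)
  exists (- ((expp n \Po L) * (- 1) ^+ n.+1 * 'X) - (n`!%:R)^-1 *: q ^+ n).
  rewrite Lq exprMn [(- 'X) ^+ _]exprNn.
  rewrite -!mul_polyC !exprS; move: 'X ((-1) ^+ n) ('X^n) (q ^+ n) (n`!%:R^-1)%:P (expp n \Po
    ('X * q)) => x s Xn qn c e; ring.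
have D0 : D`_0 = 1.
  rewrite -horner_coef0 horner_comp Lq !hornerE horner_sum big_ord_recl.
  rewrite !hornerE big1 ?addr0 ?fact0 ?invr1 // => i _.
  by rewrite hornerZ hornerXn exprS mul0r mulr0.
have rec j : (j < n)%N -> D`_j.+1 *+ j.+1 + D`_j *+ j = D`_j.
  move=> lt; have /XdvdP/(_ j lt) := DD.
  rewrite mulrDl mul1r !coefB coefD coefXM coef_deriv => /eqP; rewrite subr_eq0 => /eqP.
  by case: j {lt} => [|j]; rewrite /= ?mulr0n // coef_deriv.
apply/XdvdP => -[|j] lt; first by rewrite !coefB coefD coef1 coefX D0 /= addr0 subrr.
rewrite !coefB coefD coef1 coefX /= add0r.
elim: j lt => [|j IH] lt.
  by have := rec 0%N lt; rewrite mulr1n mulr0n addr0 D0 => ->; rewrite subrr.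
(* The recurrence reads (j + 2) D_(j+2) = - j D_(j+1), and by induction D_(j+1) = 0 unless j = 0. *)
have := rec j.+1 lt.
have Dj : D`_j.+1 = (j == 0)%:R.
  by apply/eqP; rewrite -subr_eq0; apply/eqP; rewrite -[RHS](IH (ltnW lt)).
rewrite Dj subr0 => E; apply/eqP.
have /eqP : D`_j.+2 *+ j.+2 = 0.
  by case: j {lt IH Dj} E => [|j];
    rewrite /= ?mulr1n ?mul0rn ?addr0 // => /(canRL (addrK _)) ->; rewrite subrr.
by rewrite -mulr_natr mulf_eq0 (negbTE (natn0 _)) orbF.
Qed.

(** The product has constant term 1, and its derivative consists of truncation terms of high degree;
    in characteristic 0 the other coefficients below degree n vanish. *)
Lemma exp_mulN n : Xdvd n (expp n * (expp n \Po (- 'X)) - 1).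
Proof.
case: n => [|n]; first by exists (expp 0 * (expp 0 \Po (- 'X)) - 1); rewrite mul1r.
set P := expp n.+1; set Q := P \Po (- 'X).
have P' : P = P^`() + (n`!%:R)^-1 *: 'X^n by rewrite deriv_expp /P /expp big_ord_recr.
have Q' : Q = - Q^`() + (n`!%:R)^-1 *: (- 'X) ^+ n.
  rewrite /Q deriv_comp {1}P' comp_polyD comp_polyZ comp_Xn_poly; congr (_ + _).
  by rewrite derivN derivX mulrN1 opprK.
have PQ : Xdvd n ((P * Q)^`()).
  rewrite derivM.
  have -> : P^`() = P - (n`!%:R)^-1 *: 'X^n by rewrite {2}P' addrK.
  have -> : Q^`() = - Q + (n`!%:R)^-1 *: (- 'X) ^+ n by rewrite {2}Q'; ring.
  exists (- ((n`!%:R)^-1 *: Q) + (n`!%:R)^-1 *: (P * (-1) ^+ n)).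
  by rewrite [(- 'X) ^+ _]exprNn -!mul_polyC; ring.
apply/XdvdP => -[|j] lt; rewrite coefB coef1 /=.
  have E0 : P`_0 = 1.
    rewrite -horner_coef0 horner_sum big_ord_recl.
    rewrite !hornerE big1 ?addr0 ?fact0 ?invr1 // => i _.
    by rewrite hornerZ hornerXn exprS mul0r mulr0.
  by rewrite coef0M E0 mul1r -horner_coef0 horner_comp !hornerE oppr0 horner_coef0 E0 subrr.
have /XdvdP/(_ j lt) := PQ; rewrite coef_deriv subr0 => /eqP.
by rewrite -mulr_natr mulf_eq0 (negbTE (natn0 _)) orbF => /eqP.
Qed.

End ExpLogPoly.

Section CompleteRing.
Variables (A : nzRingType) (h : A).

Definition hmul n (a : A) := exists b, a = h ^+ n * b.

(* h is a central non-zero-divisor for which A is h-adically separated and complete. *)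
Record hcomplete : Prop := HComplete {
  hcentral : forall a, h * a = a * h;
  hregular : forall a, h * a = 0 -> a = 0;
  hsep : forall a, (forall n, hmul n a) -> a = 0;
  hsum : forall u : nat -> A, exists s, forall n, hmul n (s - \sum_(i < n) h ^+ i * u i) }.

Hypothesis hA : hcomplete.

Lemma hcentralX n a : h ^+ n * a = a * h ^+ n.
Proof. by apply: esym; apply: commrX; apply: esym; exact: hcentral. Qed.

Lemma hmul0 n : hmul n 0. Proof. by exists 0; rewrite mulr0. Qed.

Lemma hmulD n a b : hmul n a -> hmul n b -> hmul n (a + b).
Proof. by move=> [u ->] [v ->]; exists (u + v); rewrite mulrDr. Qed.

Lemma hmulN n a : hmul n a -> hmul n (- a).
Proof. by move=> [u ->]; exists (- u); rewrite mulrN. Qed.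

Lemma hmulB n a b : hmul n a -> hmul n b -> hmul n (a - b).
Proof. by move=> ? ?; apply: hmulD => //; exact: hmulN. Qed.

Lemma hmulMl n a b : hmul n b -> hmul n (a * b).
Proof. by move=> [u ->]; exists (a * u); rewrite mulrA -hcentralX mulrA. Qed.

Lemma hmulMr n a b : hmul n a -> hmul n (a * b).
Proof. by move=> [u ->]; exists (u * b); rewrite mulrA. Qed.

Lemma hmul_le m n a : (m <= n)%N -> hmul n a -> hmul m a.
Proof. by move=> /subnKC <- [u ->]; exists (h ^+ (n - m) * u); rewrite exprD mulrA. Qed.

Lemma hmulX n a : hmul n (h ^+ n * a). Proof. by exists a. Qed.

Lemma hmul_sum n m (F : 'I_m -> A) : (forall i, hmul n (F i)) -> hmul n (\sum_i F i).
Proof. by move=> Fn; elim/big_ind: _ => //; [exact: hmul0|exact: hmulD]. Qed.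

Lemma hexpM n a : (h * a) ^+ n = h ^+ n * a ^+ n.
Proof. by rewrite exprMn_comm //; exact: hcentral. Qed.

Lemma hreg_inj : injective ( *%R h).
Proof.
move=> a b /eqP; rewrite -subr_eq0 -mulrBr => /eqP /(hregular hA) /eqP.
by rewrite subr_eq0 => /eqP.
Qed.

(** The inverse is the h-adic sum of the powers of - h x; both products are checked because A is not
    commutative. *)
Lemma inv_1Dh x : exists y, (1 + h * x) * y = 1 /\ y * (1 + h * x) = 1.
Proof.
have [s sP] := hsum hA (fun i => (- x) ^+ i).
have geo n : \sum_(i < n) h ^+ i * (- x) ^+ i = \sum_(i < n) (- (h * x)) ^+ i.
  by apply: eq_bigr => i _; rewrite -mulrN hexpM.
have E n : hmul n (1 - (- (h * x)) ^+ n - 1).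
  by rewrite addrAC subrr add0r -mulrN hexpM; apply/hmulN/hmulX.
exists s; split; apply/eqP; rewrite -subr_eq0; apply/eqP; apply: (hsep hA) => n;
  have := sP n; rewrite geo => sn.
  have -> : (1 + h * x) * s - 1 = (1 + h * x) * (s - \sum_(i < n) (- (h * x)) ^+ i)
     + ((1 + h * x) * \sum_(i < n) (- (h * x)) ^+ i - 1) by rewrite mulrBr subrKA.
  apply: hmulD; first exact: hmulMl.
  have -> : (1 + h * x) * \sum_(i < n) (- (h * x)) ^+ i = 1 - (- (h * x)) ^+ n; last exact: E.
  by apply: oppr_inj; rewrite opprB subrX1 -mulNr; congr (_ * _); rewrite opprD addrC.
have -> : s * (1 + h * x) - 1 = (s - \sum_(i < n) (- (h * x)) ^+ i) * (1 + h * x)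
     + ((\sum_(i < n) (- (h * x)) ^+ i) * (1 + h * x) - 1) by rewrite mulrBl subrKA.
apply: hmulD; first exact: hmulMr.
have -> : (\sum_(i < n) (- (h * x)) ^+ i) * (1 + h * x) = 1 - (- (h * x)) ^+ n; last exact: E.
have comm : (1 + h * x) * (\sum_(i < n) (- (h * x)) ^+ i) =
  (\sum_(i < n) (- (h * x)) ^+ i) * (1 + h * x).
  apply: commr_sum => i _; apply/commrX/commrN/commr_sym/commrD; [exact: commr1|by []].
rewrite -comm.
by apply: oppr_inj; rewrite opprB subrX1 -mulNr; congr (_ * _); rewrite opprD addrC.
Qed.

End CompleteRing.

Section ExpLog.
Variables (k : fieldType) (char0 : [pchar k] =i pred0) (A : algType k) (h : A).
Hypothesis hA : hcomplete h.
Local Notation hmul := (hmul h).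

Definition expsum (x s : A) := forall n, exists N, forall M, (N <= M)%N ->
  hmul n (s - \sum_(i < M) (i`!%:R^-1 : k) *: x ^+ i).

Local Notation ev a := (@horner_alg k A a).

Lemma hmulZ n c a : hmul n a -> hmul n (c *: a).
Proof. by move=> [u ->]; exists (c *: u); rewrite scalerAr. Qed.

Lemma horner_alg_exp n a : ev a (expp k n) = \sum_(i < n) (i`!%:R^-1 : k) *: a ^+ i.
Proof.
rewrite raddf_sum; apply: eq_bigr => i _.
by rewrite [LHS]linearZ /= rmorphXn /= horner_algX mulr_algl.
Qed.

Lemma horner_alg_comp p q (a : A) : ev a (p \Po q) = ev (ev a q) p.
Proof.
elim/poly_ind: p => [|p c IH]; first by rewrite comp_poly0 !raddf0.
by rewrite comp_poly_MXaddC !rmorphD !rmorphM /= IH horner_algX !horner_algC.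
Qed.

Lemma hmul_horner n x p : Xdvd n p -> hmul n (ev (h * x) p).
Proof.
move=> [q ->]; rewrite rmorphM /= rmorphXn /= horner_algX; apply: hmulMr.
by rewrite (hexpM hA); exact: hmulX.
Qed.

Lemma hmul_pow n i a b : hmul n (a - b) -> hmul n (a ^+ i - b ^+ i).
Proof.
move=> ab; elim: i => [|i IH]; first by rewrite subrr; exact: hmul0.
have -> : a ^+ i.+1 - b ^+ i.+1 = a * (a ^+ i - b ^+ i) + (a - b) * b ^+ i.
  by rewrite !exprS mulrBr mulrBl subrKA.
by apply: hmulD; [exact: hmulMl|exact: hmulMr].
Qed.

(** Here v is h^-1 log(1 + h x), the division by h being made term by term: v is the sum of (-1)^i
    h^i x^(i+1) / (i+1). The exponential identity is the polynomial congruence [exp_log] evaluated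
    at h x, where multiples of X^n become multiples of h^n. *)
Lemma exp_log_exists x : exists v, [/\ hmul 1 (v - x),
  forall M, hmul M.+1 (h * v - \sum_(i < M) ((-1) ^+ i / i.+1%:R) *: (h * x) ^+ i.+1) &
  expsum (h * v) (1 + h * x)].
Proof.
have [v vP] := hsum hA (fun i => ((-1) ^+ i / i.+1%:R) *: x ^+ i.+1).
have logE M : hmul M.+1 (h * v - \sum_(i < M) ((-1) ^+ i / i.+1%:R) *: (h * x) ^+ i.+1).
  have [b vb] := vP M; exists b; rewrite exprS -mulrA -vb mulrBr; congr (_ - _).
  rewrite mulr_sumr; apply: eq_bigr => i _; rewrite (hexpM hA) exprS.
  by rewrite -!scalerAr -!mulrA.
exists v; split=> //.
  have := vP 1%N; rewrite big_ord_recl big_ord0 addr0 expr0 mul1r.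
  by rewrite divr1 expr0 scale1r expr1.
move=> n; exists n => M nM; apply: (hmul_le nM).
have -> : 1 + h * x - \sum_(i < M) (i`!%:R^-1 : k) *: (h * v) ^+ i =
  - (ev (h * x) (expp k M \Po logp k M - (1 + 'X))) -
   (\sum_(i < M) (i`!%:R^-1 : k) *: ((h * v) ^+ i - (ev (h * x) (logp k M)) ^+ i)).
  rewrite rmorphB rmorphD rmorph1 /= horner_algX horner_alg_comp horner_alg_exp opprB.
  by under [in RHS]eq_bigr do rewrite scalerBr; rewrite sumrB opprB addrA subrK.
apply: hmulB; first by apply: hmulN; apply: hmul_horner; exact: exp_log.
apply: hmul_sum => i; apply: hmulZ; apply: hmul_pow; apply: (hmul_le (leqnSn _)).
have := logE M; congr (hmul _ (_ - _)).
rewrite raddf_sum; apply: eq_bigr => j _.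
by rewrite [RHS]linearZ /= rmorphXn /= horner_algX mulr_algl.
Qed.

Lemma exp_exists x : exists s, expsum (h * x) s.
Proof.
have [s sP] := hsum hA (fun i => (i`!%:R^-1 : k) *: x ^+ i).
exists s => n; exists n => M nM; apply: (hmul_le nM); have := sP M.
by under eq_bigr do rewrite -scalerAr -(hexpM hA).
Qed.

Lemma exp_mulN1 x s s' : expsum (h * x) s -> expsum (h * - x) s' -> s * s' = 1.
Proof.
move=> xs xs'; apply/eqP; rewrite -subr_eq0; apply/eqP; apply: (hsep hA) => n.
have [N NP] := xs n; have [N' NP'] := xs' n; pose M := (n + (N + N'))%N.
have /NP : (N <= M)%N by rewrite /M addnCA leq_addr.
have /NP' : (N' <= M)%N by rewrite /M addnA leq_addl.
set e' := \sum_(_ < _) _; set e := \sum_(_ < _) _ => es' es.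
have -> : s * s' - 1 = (s - e) * s' + e * (s' - e') + (e * e' - 1).
  by rewrite mulrBl mulrBr !subrKA.
apply: hmulD; first by apply: hmulD; [exact: hmulMr|exact: hmulMl].
apply: (@hmul_le _ _ n M); first exact: leq_addr.
have -> : e * e' - 1 = ev (h * x) (expp k M * (expp k M \Po (- 'X)) - 1).
  rewrite rmorphB rmorphM rmorph1 /= horner_alg_comp rmorphN /= horner_algX !horner_alg_exp.
  by rewrite /e' mulrN.
by apply: hmul_horner; exact: exp_mulN.
Qed.

(** Bootstrapping: if h^n divides a - b, it divides every a^i - b^i, so the terms of degree at least
    2 of exp(h a) - exp(h b) are divisible by h^(n+2). Hence so is the linear term h (a - b), and
    h^(n+1) divides a - b. *)
Lemma exp_inj a b s : expsum (h * a) s -> expsum (h * b) s -> a = b.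
Proof.
move=> ea eb; apply/eqP; rewrite -subr_eq0; apply/eqP; apply: (hsep hA) => n.
elim: n => [|n IH]; first by exists (a - b); rewrite mul1r.
suff [c E] : hmul n.+2 (h * (a - b)).
  by exists c; apply: (hreg_inj hA); rewrite E exprS mulrA.
have [N NP] := ea n.+2; have [N' NP'] := eb n.+2.
have /NP Ea : (N <= (N + N').+2)%N by rewrite -addn2 -addnA leq_addr.
have /NP' Eb : (N' <= (N + N').+2)%N by rewrite -addn2 -addnAC leq_addl.
have := hmulB Eb Ea; rewrite opprB addrC subrKA -sumrB.
under eq_bigr do rewrite -scalerBr.
rewrite 2!big_ord_recl /= !expr0 subrr scaler0 add0r !expr1 (_ : (bump 0 0)`! =
  1%N) // invr1 scale1r -mulrBr => H.
rewrite -[X in hmul _ X](addrK (\sum_(i < N + N') ((bump 0 (bump 0 i))`!%:R^-1 : k) *: ((h *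
  a) ^+ bump 0 (bump 0 i) - (h * b) ^+ bump 0 (bump 0 i)))).
apply: hmulB => //; apply: hmul_sum => i; apply: hmulZ.
rewrite /bump !leq0n !add1n !(hexpM hA) -mulrBr.
have [c ->] := hmul_pow i.+2 IH; exists (h ^+ i * c).
by rewrite !mulrA -!exprD; congr (_ ^+ _ * _); lia.
Qed.

End ExpLog.

Section Hlim.
Variable k : fieldType.

Lemma seriesCD (c d : k) : seriesC (c + d) = seriesC c + seriesC d.
Proof. by apply/funext => -[|n]; rewrite series_addE /= ?addr0. Qed.

Lemma seriesCE (c : k) (f : series k) n : (seriesC c * f) n = c * f n.
Proof.
rewrite [LHS]/GRing.mul /= /series_mul big_ord_recl /= subn0 big1 ?addr0 // => i _.
by rewrite mul0r.
Qed.

Lemma seriesCM (c d : k) : seriesC (c * d) = seriesC c * seriesC d.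
Proof. by apply/funext => -[|n]; rewrite seriesCE /= ?mulr0. Qed.

Lemma seriesC1 : seriesC (1 : k) = 1. Proof. by []. Qed.

(** The sum of all hbar^i r_i. The i-th term does not reach the coefficients below i, so each
    coefficient is that of a finite sum. *)
Definition hlim (r : nat -> series k) : series k :=
  fun n => (\sum_(i < n.+1) hbar ^+ i * r i) n.

Lemma series_sumE n (F : 'I_n -> series k) m : (\sum_i F i) m = \sum_i F i m.
Proof. by elim/big_rec2: _ => // i x y _ <-. Qed.

Lemma hlim_trunc r N m : (m < N)%N -> hlim r m = (\sum_(i < N) hbar ^+ i * r i) m.
Proof.
move=> lt; rewrite /hlim -(subnKC lt) big_split_ord; rewrite /= series_addE /=.
rewrite [X in _ + X]series_sumE [X in _ + X]big1 ?addr0 // => i _.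
by rewrite hbarXE leqNgt ltnS leq_addr.
Qed.

Lemma hlim_split r n :
  hlim r = \sum_(i < n) hbar ^+ i * r i + hbar ^+ n * hlim (fun i => r (n + i)%N).
Proof.
apply/funext => m; rewrite (@hlim_trunc r (n + m.+1)) ?leq_addl // big_split_ord /=.
rewrite !series_addE; congr (_ + _).
rewrite hbarXE; case: leqP => nm.
  rewrite (@hlim_trunc _ m.+1) ?ltnS ?leq_subr // !series_sumE; apply: eq_bigr => i _ /=.
  by rewrite exprD -mulrA hbarXE nm.
rewrite series_sumE big1 // => i _ /=.
by rewrite exprD -mulrA hbarXE leqNgt nm.
Qed.

Lemma hlim_lin (a : series k) r r' :
  hlim (fun i => a * r i + r' i) = a * hlim r + hlim r'.
Proof.
apply/eqP; rewrite -subr_eq0; apply/eqP; apply: (@adJ_sep _ (series_adic k)) => n /=.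
rewrite (hlim_split (fun i => a * r i + r' i) n) (hlim_split r n) (hlim_split r' n).
under eq_bigr do rewrite mulrDr mulrCA.
rewrite big_split /= -mulr_sumr.
set u := hlim _; set v := hlim _; set w := hlim _; set x := \sum_(_ < _) _;
  set y := \sum_(_ < _) _.
exists (u - a * v - w); ring.
Qed.
End Hlim.

(** * The dual as an hbar-adically complete algebra *)

Section DualAlgebra.
Variables (k : fieldType) (X : Type) (H : bialg (series k) X).

(* The proof [bH] is a parameter of the type because the ring axioms depend on it. *)
Definition dform (bH : bialgebra H) : Type :=
  {phi : (X -> series k) -> series k | `[< dual H phi >]}.

Variable bH : bialgebra H.
Implicit Types a b c : dform bH.

Lemma dformP a : dual H (val a). Proof. exact/asboolP/(valP a). Qed.
Lemma dform_cont a : cont_form (val a). Proof. by case: (dformP a). Qed.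

Definition mk_dform phi (d : dual H phi) : dform bH := exist _ phi (asboolT d).

Lemma dform_eq a b : val a = val b -> a = b. Proof. exact: val_inj. Qed.

HB.instance Definition _ := Choice.copy (dform bH) {phi : (X -> series k) ->
  series k | `[< dual H phi >]}.

Definition dadd a b := mk_dform (dualD bH (dformP a) (dformP b)).
Definition dscale (r : series k) a := mk_dform (dualZ r (dformP a)).
Definition dzero : dform bH := mk_dform (@dual0 k X H).
Definition dopp a := dscale (-1) a.
Definition dmul a b := mk_dform (dual_conv bH (dformP a) (dformP b)).
Definition dunit : dform bH := mk_dform (dual_counit bH).

Lemma daddA : associative dadd. Proof. by move=> a b c; apply: dform_eq; exact: addrA. Qed.
Lemma daddC : commutative dadd. Proof. by move=> a b; apply: dform_eq; exact: addrC. Qed.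
Lemma dadd0 : left_id dzero dadd. Proof. by move=> a; apply: dform_eq; exact: add0r. Qed.
Lemma daddN : left_inverse dzero dopp dadd.
Proof. by move=> a; apply: dform_eq; apply/funext => x;
  rewrite -[LHS]/(-1 * val a x + val a x) mulN1r addNr. Qed.

HB.instance Definition _ := GRing.isZmodule.Build (dform bH) daddA daddC dadd0 daddN.

Let cH := bialg_coalg bH.

Lemma dmulA : associative dmul.
Proof. by move=> a b c; apply: dform_eq; rewrite /= convA //; exact: dform_cont. Qed.
Lemma dmul1l : left_id dunit dmul.
Proof. by move=> a; apply: dform_eq; rewrite /= conv1l //; exact: dform_cont. Qed.
Lemma dmul1r : right_id dunit dmul.
Proof. by move=> a; apply: dform_eq; rewrite /= conv1r. Qed.
Lemma dmulDl : left_distributive dmul dadd.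
Proof. by move=> a b c; apply: dform_eq. Qed.
Lemma dmulDr : right_distributive dmul dadd.
Proof. by move=> a b c; apply: dform_eq; rewrite /= convDr //; exact: dform_cont. Qed.
Lemma dunit_neq0 : dunit != 0.
Proof.
apply/eqP => /(congr1 (fun a => val a (bone H))) /=; rewrite bialg_counit1 //.
by move/eqP; rewrite oner_eq0.
Qed.

HB.instance Definition _ := GRing.Zmodule_isNzRing.Build (dform bH)
  dmulA dmul1l dmul1r dmulDl dmulDr dunit_neq0.

(** Scalars are restricted to k because the partial sums of exp and log are evaluated polynomials
    over k; hbar becomes the algebra element [dhbar]. *)
Definition dscalek (c : k) a := dscale (seriesC c) a.

Lemma dscalekA (c d : k) a : dscalek c (dscalek d a) = dscalek (c * d) a.
Proof. by apply: dform_eq; apply/funext => x; rewrite /= seriesCM mulrA. Qed.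
Lemma dscalek1 : left_id 1 dscalek.
Proof. by move=> a; apply: dform_eq; apply/funext => x; rewrite /= seriesC1 mul1r. Qed.
Lemma dscalekDr : right_distributive dscalek +%R.
Proof. by move=> c a b; apply: dform_eq; apply/funext => x; exact: mulrDr. Qed.
Lemma dscalekDl a : {morph dscalek^~ a : c d / c + d}.
Proof. by move=> c d; apply: dform_eq; apply/funext => x;
  rewrite -[LHS]/(seriesC (c + d) * val a x) seriesCD mulrDl. Qed.

HB.instance Definition _ := GRing.Zmodule_isLmodule.Build k (dform bH)
  dscalekA dscalek1 dscalekDr dscalekDl.

Lemma dscalekAl (c : k) a b : c *: (a * b) = (c *: a) * b.
Proof. by apply: dform_eq. Qed.
HB.instance Definition _ := GRing.Lmodule_isLalgebra.Build k (dform bH) dscalekAl.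
Lemma dscalekAr (c : k) a b : c *: (a * b) = a * (c *: b).
Proof. by apply: dform_eq; rewrite /= convZr //; exact: dform_cont. Qed.
HB.instance Definition _ := GRing.Lalgebra_isAlgebra.Build k (dform bH) dscalekAr.

Lemma dform_addE a b : val (a + b) = val a + val b. Proof. by []. Qed.

Definition dhbar : dform bH := dscale hbar 1.

Lemma dhbarE a : val (dhbar * a) = hbar \*o val a.
Proof. by rewrite /= convZl conv1l //; exact: dform_cont. Qed.

Lemma dhbarXE n a : val (dhbar ^+ n * a) = hbar ^+ n \*o val a.
Proof.
elim: n => [|n IH]; first by rewrite mul1r; apply/funext => x; rewrite !fE mul1r.
by rewrite exprS -mulrA dhbarE IH; apply/funext => x; rewrite !fE exprS mulrA.
Qed.

Lemma dform_sumE n (F : 'I_n -> dform bH) : val (\sum_i F i) = \sum_i val (F i).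
Proof. by elim/big_rec2: _ => // i x y _ <-. Qed.

Lemma form_sumE n (F : 'I_n -> (X -> series k) -> series k) x : (\sum_i F i) x = \sum_i F i x.
Proof. by elim/big_rec2: _ => // i u v _ <-. Qed.

Definition hlim_form (u : nat -> dform bH) : (X -> series k) -> series k :=
  fun x => hlim (fun i => val (u i) x).

Lemma hlim_form_split u n : hlim_form u =
  \sum_(i < n) hbar ^+ i \*o val (u i) + hbar ^+ n \*o hlim_form (fun i => u (n + i)%N).
Proof. by apply/funext => x; rewrite !fE form_sumE /hlim_form (hlim_split _ n). Qed.

Lemma dual_hlim u : dual H (hlim_form u).
Proof.
apply: (@dual_sum _ _ _ bH (fun n => val (u n))) => [n|n|].
- exact: dformP.
- exists (hbar ^+ n \*o hlim_form (fun i => u (n + i)%N)); last exact: hlim_form_split.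
  by move=> x; eexists; reflexivity.
move=> a x y; rewrite /hlim_form -hlim_lin; congr hlim; apply/funext => i.
exact: (cf_lin (dform_cont (u i))).
Qed.

(** Sums are taken pointwise and stay in the dual by [dual_sum]. The remainder after n terms is
    hbar^n times a sum of the same kind, so convergence takes place inside the dual, as [hadic_sum]
    demands. *)
Lemma dform_hcomplete : hcomplete dhbar.
Proof.
split.
- move=> a; apply: dform_eq; rewrite dhbarE /= convZr ?conv1r //; exact: dform_cont.
- move=> a /(congr1 val); rewrite dhbarE => a0; apply: dform_eq; apply/funext => x.
  by apply: hbar_inj; rewrite mulr0; exact: (congr1 (fun f => f x) a0).
- move=> a aP; apply: dform_eq; apply/funext => x; apply: (@adJ_sep _ (series_adic k)) => n.
  by have [b ->] := aP n; rewrite dhbarXE; eexists; reflexivity.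
- move=> u; exists (mk_dform (dual_hlim u)) => n.
  exists (mk_dform (dual_hlim (fun i => u (n + i)%N))); apply/eqP; rewrite subr_eq; apply/eqP.
  apply: dform_eq; rewrite dform_addE dhbarXE dform_sumE addrC.
  rewrite [LHS]/= (hlim_form_split u n); congr (_ + _).
  by apply: eq_bigr => i _; rewrite dhbarXE.
Qed.

End DualAlgebra.

(** * Antipodes, lifted from the reduction modulo hbar *)

Section HdivMap.
Variable k : fieldType.

Lemma hdivK (f : series k) : f 0%N = 0 -> f = hbar * hdiv f.
Proof. by move=> f0; apply/funext => -[|n]; rewrite hbarE. Qed.

(** Dividing by hbar costs one order of precision: the quotient modulo hbar^n is governed by the
    dividend modulo hbar^(n+1). *)
Lemma cl_hdiv X Y (f : (X -> series k) -> Y -> series k) : cont_linear f ->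
  (forall t, red (f t) = 0) -> cont_linear (fun t y => hdiv (f t y)).
Proof.
move=> cf f0; have fE t y : f t y = hbar * hdiv (f t y).
  by apply: hdivK; exact: (congr1 (fun g => g y) (f0 t)).
apply/cont_linearP => y.
have /cont_formP[lf sf] : cont_form (fun t => f t y) by exact: cl_form.
apply: cont_form_intro.
  by move=> a u v; apply: hbar_inj; rewrite -fE lf mulrDr mulrCA -!fE.
move=> n; have [s sn] := sf n.+1; exists s, n.+1 => u /sn /hdvdP fu.
by apply/hdvdP => i lt; exact: fu.
Qed.

End HdivMap.

Section EndConvolution.
Context {R : topComNzRingType} {aR : adic R}.
Variables (X : Type) (H : bialg R X) (bH : bialgebra H).
Implicit Types f g h : (X -> R) -> X -> R.

(** The convolution of endomorphisms, for which an antipode is an inverse of the identity map. *)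
Definition cmul f g : (X -> R) -> X -> R := fun x => bmul H (tmap f g (bcomul H x)).
Definition cone : (X -> R) -> X -> R := fun x => bcounit H x \*o bone H.

Lemma cl_cmul f g : cont_linear f -> cont_linear g -> cont_linear (cmul f g).
Proof.
have dH := coalg_comul (bialg_coalg bH); have mH := bialg_mul bH.
by rewrite /cmul => cf cg; cf.
Qed.

Lemma cl_cone : cont_linear cone.
Proof. by have eH := coalg_counit (bialg_coalg bH); rewrite /cone; cf. Qed.

Lemma bmulA s : bmul H (lmap (bmul H) s) = bmul H (rmap (bmul H) (tassoc s)).
Proof.
have mH := bialg_mul bH; move: s; apply: cl_ext => [||t z]; [by cf|by cf|].
move: t; apply: cl_ext => [||x y]; [by cf|by cf|].
transitivity (mulb H (mulb H x y) z).
  congr (bmul H _); apply/funext => -[a b]; rewrite /lmap /tens /=.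
  by rewrite (cl_mulr _ _ _ mH).
rewrite bialg_mulA //; congr (bmul H _); apply/funext => -[a b].
rewrite /rmap /tassoc /tens /= -(cl_mull _ _ _ mH); congr (bmul H _ b).
by apply/funext => p; rewrite mulrA.
Qed.

Lemma cmulA f g h : cont_linear f -> cont_linear g -> cont_linear h ->
  cmul (cmul f g) h = cmul f (cmul g h).
Proof.
have dH := coalg_comul (bialg_coalg bH); have mH := bialg_mul bH.
move=> cf cg ch; apply/funext => x; rewrite /cmul.
transitivity (bmul H (lmap (bmul H) (tmap (tmap f g) h (lmap (bcomul H) (bcomul H x))))).
  transitivity (bmul H (lmap (bmul H) (lmap (tmap f g) (tmap (bcomul H) h (bcomul H x))))) =>
    //.
  by rewrite tmapC.
rewrite bmulA.
transitivity (bmul H (rmap (bmul H) (lmap f (rmap (tmap g h) (tassoc (lmap (bcomul H) (bcomul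
  H x))))))) => //.
by rewrite coalg_coassoc -?tmapC //; exact: bialg_coalg.
Qed.

Lemma cmul1l f : cont_linear f -> cmul cone f = f.
Proof.
have dH := coalg_comul (bialg_coalg bH); have eH := coalg_counit (bialg_coalg bH).
move=> cf; apply/funext => x; rewrite -[RHS](bialg_mul1l bH).
congr (bmul H _); apply/funext => -[a b]; rewrite /tens /tmap /lmap /rmap /cone /= mulrC.
congr (_ * _); rewrite (fubini (fun x' y => bcomul H x (x', y)) eH (cl_form b cf)).
by congr (f _ b); exact: coalg_counitl (bialg_coalg bH) x.
Qed.

Lemma cmul1r f : cont_linear f -> cmul f cone = f.
Proof.
have dH := coalg_comul (bialg_coalg bH); have eH := coalg_counit (bialg_coalg bH).
move=> cf; apply/funext => x; rewrite -[RHS](bialg_mul1r bH).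
congr (bmul H _); apply/funext => -[a b]; rewrite /tens /tmap /lmap /rmap /cone /=.
rewrite (cl_mulr _ _ _ cf); congr (f _ a * _); exact: coalg_counitr (bialg_coalg bH) x.
Qed.

Lemma cmulDl f g h : cmul (f + g) h = cmul f h + cmul g h.
Proof. by have mH := bialg_mul bH; apply/funext => x; exact: clD. Qed.

Lemma cmulDr f g h : cont_linear f -> cmul f (g + h) = cmul f g + cmul f h.
Proof.
have mH := bialg_mul bH; move=> cf; apply/funext => x.
rewrite -[RHS]/(bmul H (tmap f g (bcomul H x)) + bmul H (tmap f h (bcomul H x))) -clD //.
congr (bmul H _); apply/funext => -[a b].
exact: (linD (rform (fun u => g u b) (bcomul H x)) (rform (fun u => h u b) (bcomul H x))
  (cl_lin a cf)).
Qed.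

Lemma cmulZl r f g : cmul (fun x => r \*o f x) g = fun x => r \*o cmul f g x.
Proof. by have mH := bialg_mul bH; apply/funext => x; rewrite /cmul -clZ. Qed.

Lemma cmulZr r f g : cont_linear f -> cmul f (fun x => r \*o g x) = fun x => r \*o cmul f g x.
Proof.
have mH := bialg_mul bH; move=> cf; apply/funext => x; rewrite /cmul -clZ //.
congr (bmul H _); apply/funext => -[a b].
exact: (linZ r (rform (fun u => g u b) (bcomul H x)) (cl_lin a cf)).
Qed.

End EndConvolution.

Section EndAlgebra.
Variables (k : fieldType) (X : Type) (H : bialg (series k) X).

Definition eform (bH : bialgebra H) : Type :=
  {f : (X -> series k) -> X -> series k | `[< cont_linear f >]}.

Variable bH : bialgebra H.
Implicit Types a b c : eform bH.

Lemma eformP a : cont_linear (val a). Proof. exact/asboolP/(valP a). Qed.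

Definition mk_eform f (cf : cont_linear f) : eform bH := exist _ f (asboolT cf).

Lemma eform_eq a b : val a = val b -> a = b. Proof. exact: val_inj. Qed.

HB.instance Definition _ := Choice.copy (eform bH)
  {f : (X -> series k) -> X -> series k | `[< cont_linear f >]}.

Lemma cl_add Y (f g : (X -> series k) -> Y -> series k) :
  cont_linear f -> cont_linear g -> cont_linear (f + g).
Proof. by move=> cf cg; change (cont_linear (fun x => f x + g x)); cf. Qed.

Lemma cl_scale Y r (f : (X -> series k) -> Y -> series k) :
  cont_linear f -> cont_linear (fun x => r \*o f x).
Proof. by move=> cf; cf. Qed.

Lemma cl_zero Y : cont_linear (0 : (X -> series k) -> Y -> series k).
Proof. by change (cont_linear (fun (_ : X -> series k) (_ : Y) => 0 : series k)); cf. Qed.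

Definition eadd a b := mk_eform (cl_add (eformP a) (eformP b)).
Definition escale r a := mk_eform (cl_scale r (eformP a)).
Definition ezero : eform bH := mk_eform (@cl_zero X).
Definition eopp a := escale (-1) a.
Definition emul a b := mk_eform (cl_cmul bH (eformP a) (eformP b)).
Definition eone : eform bH := mk_eform (cl_cone bH).

Lemma eaddA : associative eadd. Proof. by move=> a b c; apply: eform_eq; exact: addrA. Qed.
Lemma eaddC : commutative eadd. Proof. by move=> a b; apply: eform_eq; exact: addrC. Qed.
Lemma eadd0 : left_id ezero eadd. Proof. by move=> a; apply: eform_eq; exact: add0r. Qed.
Lemma eaddN : left_inverse ezero eopp eadd.
Proof.
move=> a; apply: eform_eq; apply/funext => x; apply/funext => y.
by rewrite -[LHS]/(-1 * val a x y + val a x y) mulN1r addNr.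
Qed.

HB.instance Definition _ := GRing.isZmodule.Build (eform bH) eaddA eaddC eadd0 eaddN.

Lemma emulA : associative emul.
Proof. by move=> a b c; apply: eform_eq; rewrite /= cmulA //; exact: eformP. Qed.
Lemma emul1l : left_id eone emul.
Proof. by move=> a; apply: eform_eq; rewrite /= cmul1l //; exact: eformP. Qed.
Lemma emul1r : right_id eone emul.
Proof. by move=> a; apply: eform_eq; rewrite /= cmul1r //; exact: eformP. Qed.
Lemma emulDl : left_distributive emul eadd.
Proof. by move=> a b c; apply: eform_eq; rewrite /= cmulDl. Qed.
Lemma emulDr : right_distributive emul eadd.
Proof. by move=> a b c; apply: eform_eq; rewrite /= cmulDr //; exact: eformP. Qed.
Lemma eone_neq0 : eone != 0.
Proof.
have eH := coalg_counit (bialg_coalg bH).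
apply/eqP => /(congr1 (fun a => bcounit H (val a (bone H)))) /=.
rewrite /cone (linZ _ _ (cf_lin eH)) bialg_counit1 // mulr1 (_ : (0 : _ -> _) _ = 0) //.
by rewrite (lin0 (cf_lin eH)) => /eqP; rewrite oner_eq0.
Qed.

HB.instance Definition _ := GRing.Zmodule_isNzRing.Build (eform bH)
  emulA emul1l emul1r emulDl emulDr eone_neq0.

Definition ehbar : eform bH := escale hbar 1.

Lemma ehbarE a : val (ehbar * a) = fun x => hbar \*o val a x.
Proof. by rewrite /= cmulZl // cmul1l //; exact: eformP. Qed.

Lemma ehbarXE n a : val (ehbar ^+ n * a) = fun x => hbar ^+ n \*o val a x.
Proof.
elim: n => [|n IH]; first by rewrite mul1r; apply/funext => x; apply/funext => y;
  rewrite !fE mul1r.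
by rewrite exprS -mulrA ehbarE IH; apply/funext => x; apply/funext => y;
  rewrite !fE exprS mulrA.
Qed.

Lemma eform_addE a b x y : val (a + b) x y = val a x y + val b x y. Proof. by []. Qed.

Lemma eform_sumE n (F : 'I_n -> eform bH) x y : val (\sum_i F i) x y = \sum_i val (F i) x y.
Proof. by elim/big_rec2: _ => // i u v _ <-. Qed.

Definition hlim_map (u : nat -> eform bH) : (X -> series k) -> X -> series k :=
  fun x y => hlim (fun i => val (u i) x y).

Lemma hlim_map_split u n x y : hlim_map u x y =
  \sum_(i < n) hbar ^+ i * val (u i) x y + hbar ^+ n * hlim_map (fun i => u (n + i)%N) x y.
Proof. exact: hlim_split. Qed.

Lemma cl_hlim u : cont_linear (hlim_map u).
Proof.
apply/cont_linearP => y; apply/cont_formP; split.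
  move=> a x z; rewrite /hlim_map -hlim_lin; congr hlim; apply/funext => i.
  exact: (cl_lin y (eformP (u i))).
move=> n; have [s sn] : exists s, forall x, small s n x -> forall i, (i < n)%N ->
  hdvd n (val (u i) x y).
  elim: n {1 3}n => [m|n IH m]; first by exists [::].
  have [s sn] := IH m; have [t tn] := cf_small m (cl_form y (eformP (u n))).
  exists (s ++ t) => x xs i; rewrite ltnS leq_eqVlt => /predU1P[->|lt].
    by apply: tn => z zt; apply: xs; apply/List.in_app_iff; right.
  by apply: sn => // z zt; apply: xs; apply/List.in_app_iff; left.
exists s => x xs; rewrite (hlim_map_split _ n); apply: hdvdD; last by eexists; reflexivity.
elim/big_ind: _ => [||i _]; [exact: hdvd0|exact: hdvdD|apply: hdvdM; exact: sn].
Qed.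

Lemma eform_hcomplete : hcomplete ehbar.
Proof.
split.
- move=> a; apply: eform_eq; rewrite ehbarE /= cmulZr ?cmul1r //; exact: eformP.
- move=> a /(congr1 val); rewrite ehbarE => a0; apply: eform_eq; apply/funext => x;
  apply/funext => y.
  by apply: hbar_inj; rewrite mulr0; exact: (congr1 (fun f => f x y) a0).
- move=> a aP; apply: eform_eq; apply/funext => x; apply/funext => y.
  apply: (@adJ_sep _ (series_adic k)) => n.
  by have [b ->] := aP n; rewrite ehbarXE; eexists; reflexivity.
- move=> u; exists (mk_eform (cl_hlim u)) => n.
  exists (mk_eform (cl_hlim (fun i => u (n + i)%N))); apply/eqP; rewrite subr_eq; apply/eqP.
  apply: eform_eq; apply/funext => x; apply/funext => y.
  rewrite eform_addE ehbarXE eform_sumE addrC [LHS]/= (hlim_map_split u n); congr (_ + _).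
  by apply: eq_bigr => i _; rewrite ehbarXE.
Qed.

(* A convolution inverse of the identity modulo hbar is corrected by a geometric
   series, so that no formula for the antipode of a deformation is needed. *)
Lemma antipode_lift S : cont_linear S ->
  (forall x, red (bmul H (lmap S (bcomul H x))) = red (bcounit H x \*o bone H)) ->
  (forall x, red (bmul H (rmap S (bcomul H x))) = red (bcounit H x \*o bone H)) ->
  exists S' : (X -> series k) -> (X -> series k), cont_linear S' /\
    forall x, bmul H (lmap S' (bcomul H x)) = bcounit H x \*o bone H /\
              bmul H (rmap S' (bcomul H x)) = bcounit H x \*o bone H.
Proof.
move=> cS Sl Sr.
have cid : cont_linear (id : (X -> series k) -> X -> series k) by cf.
pose s := mk_eform cS; pose i := mk_eform cid.
(* A map that reduces to the convolution unit has the form 1 + hbar g, hence is invertible. *)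
have lift f (cf : cont_linear f) : (forall x, red (f x) = red (cone H x)) ->
    exists g, mk_eform cf = 1 + ehbar * g.
  move=> fr; have cd : cont_linear (fun x => f x - cone H x).
    have c1 : cont_linear (cone H) by exact: cl_cone.
    by cf.
  have d0 x : red (f x - cone H x) = 0.
    apply/funext => y; have := congr1 (fun u => u y) (fr x); rewrite /red => E.
    by change (f x y 0%N - cone H x y 0%N = 0 :> k); rewrite E subrr.
  exists (mk_eform (cl_hdiv cd d0)); apply: eform_eq; apply/funext => x; apply/funext => y.
  rewrite eform_addE ehbarE !fE /= -hdivK; first by rewrite !fE addrC subrK.
  exact: (congr1 (fun u => u y) (d0 x)).
have [g1 E1] := lift _ (cl_cmul bH cS cid) Sl.
have [g2 E2] := lift _ (cl_cmul bH cid cS) Sr.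
have [y1 [_ Y1]] := inv_1Dh eform_hcomplete g1.
have [y2 [Y2 _]] := inv_1Dh eform_hcomplete g2.
have SI : s * i = 1 + ehbar * g1 by rewrite -E1; apply: eform_eq.
have IS : i * s = 1 + ehbar * g2 by rewrite -E2; apply: eform_eq.
(* From the invertibility of s i and i s, the identity i has a left and a right inverse, which then
   coincide. *)
have L : (y1 * s) * i = 1 by rewrite -mulrA SI.
have Rr : i * (s * y2) = 1 by rewrite mulrA IS.
have E : y1 * s = s * y2.
  by rewrite -[LHS]mulr1 -Rr [LHS]mulrA L mul1r.
exists (val (y1 * s)); split; first exact: eformP.
move=> x; split; first exact: (congr1 (fun f => val f x) L).
by rewrite E; exact: (congr1 (fun f => val f x) Rr).
Qed.

End EndAlgebra.

(** * The deformation is a bialgebra *)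

Section Translations.
Context {R : topComNzRingType} {aR : adic R}.

Section OneCoalgebra.
Variables (X : Type) (H : bialg R X) (cH : coalg H).
Implicit Types a b : (X -> R) -> R.
Let dH := coalg_comul cH.
Let eH := coalg_counit cH.

(* [ltrans a x] is a(x_(1)) x_(2) and [rtrans a x] is x_(1) a(x_(2)). *)
Definition ltrans a x := lform a (bcomul H x).
Definition rtrans a x := rform a (bcomul H x).

Lemma cl_ltrans a : cont_form a -> cont_linear (ltrans a).
Proof. by move=> ca; rewrite /ltrans; cf. Qed.

Lemma cl_rtrans a : cont_form a -> cont_linear (rtrans a).
Proof. by move=> ca; rewrite /rtrans; cf. Qed.

Lemma ltrans1 x : ltrans (bcounit H) x = x. Proof. exact: coalg_counitl. Qed.
Lemma rtrans1 x : rtrans (bcounit H) x = x. Proof. exact: coalg_counitr. Qed.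

Lemma conv_ltrans a b x : cont_form a -> cont_form b -> conv H a b x = b (ltrans a x).
Proof. by move=> ca cb; exact: tformC. Qed.

Lemma conv_rtrans a b x : conv H a b x = a (rtrans b x).
Proof. by []. Qed.

Lemma comul_ltrans a x : cont_form a -> bcomul H (ltrans a x) = lmap (ltrans a) (bcomul H x).
Proof.
move=> ca; apply/funext => -[x1 x2]; rewrite /ltrans /lmap /lform /=.
rewrite (fubini (fun x' y => bcomul H x (y, x')) (cl_form (x1, x2) dH) ca); congr a.
by apply/funext => x0; rewrite (coassocE cH).
Qed.

Lemma comul_rtrans a x : cont_form a -> bcomul H (rtrans a x) = rmap (rtrans a) (bcomul H x).
Proof.
move=> ca; apply/funext => -[x1 x2]; rewrite /rtrans /rmap /rform /=.
rewrite (fubini (fun x' y => bcomul H x (x', y)) (cl_form (x1, x2) dH) ca); congr a.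
by apply/funext => x0; rewrite (coassocE cH).
Qed.

Lemma lmap_rtrans a x : cont_form a ->
  lmap (rtrans a) (bcomul H x) = rmap (ltrans a) (bcomul H x).
Proof.
move=> ca; apply/funext => -[x1 x2]; rewrite /rtrans /ltrans /rmap /lmap /rform /lform /=.
by congr a; apply/funext => x0; rewrite (coassocE cH).
Qed.

Lemma ltrans_ltrans a b x : cont_form a -> cont_form b ->
  ltrans a (ltrans b x) = ltrans (conv H b a) x.
Proof.
move=> ca cb; rewrite {1}/ltrans comul_ltrans //; apply/funext => y.
rewrite /lform /lmap /= /ltrans /lform conv_ltrans //.
Qed.

Lemma rtrans_rtrans a b x : cont_form a -> cont_form b ->
  rtrans a (rtrans b x) = rtrans (conv H a b) x.
Proof. by move=> ca cb; rewrite {1}/rtrans comul_rtrans. Qed.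

Lemma ltrans_rtrans a b x : cont_form a -> cont_form b ->
  ltrans a (rtrans b x) = rtrans b (ltrans a x).
Proof.
move=> ca cb; rewrite {1}/ltrans comul_rtrans // [in RHS]/rtrans comul_ltrans //.
apply/funext => y; rewrite /lform /rform /rmap /lmap /= /rtrans /ltrans /lform /rform.
rewrite (fubini (fun z x0 => bcomul H (fun x' => bcomul H x (x', z)) (x0, y)) cb ca).
by congr a; apply/funext => x0; congr b; apply/funext => z; rewrite (coassocE cH).
Qed.

(** By coassociativity the left side is x_(1) (x) a(x_(2)) b(x_(3)) x_(4), and a(x_(2)) b(x_(3))
    contracts to the counit. *)
Lemma tmap_rtrans_ltrans a b x : cont_form a -> cont_form b -> conv H a b = bcounit H ->
  tmap (rtrans a) (ltrans b) (bcomul H x) = bcomul H x.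
Proof.
move=> ca cb ab; rewrite tmapC; [|exact: cl_rtrans|exact: cl_ltrans].
rewrite lmap_rtrans //; apply/funext => -[x1 x2]; rewrite /rmap /=.
by rewrite -[ltrans a _]/(ltrans a _) ltrans_ltrans // ab ltrans1.
Qed.

End OneCoalgebra.

Section Morphism.
Variables (X Y : Type) (H : bialg R X) (K : bialg R Y) (cH : coalg H) (cK : coalg K).
Variables (p : (X -> R) -> Y -> R) (cp : cont_linear p).
Hypothesis pD : forall x, bcomul K (p x) = tmap p p (bcomul H x).
Hypothesis pE : forall x, bcounit K (p x) = bcounit H x.

Lemma rtrans_morph a x : cont_form a -> rtrans K a (p x) = p (rtrans H (a \o p) x).
Proof.
move=> ca; rewrite /rtrans pD; apply/funext => y; rewrite /rform /tmap /lmap /rmap /=.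
exact: (fubini (fun y' x' => p (fun z => bcomul H x (x', z)) y') ca (cl_form y cp)).
Qed.

Lemma ltrans_morph a x : cont_form a -> ltrans K a (p x) = p (ltrans H (a \o p) x).
Proof.
move=> ca; rewrite /ltrans pD tmapC //; apply/funext => y; rewrite /lform /lmap /rmap /=.
rewrite (fubini (fun y' x' => p (fun z => bcomul H x (z, x')) y') ca (cl_form y cp)) //.
Qed.

Lemma conv_morph a b : cont_form a -> cont_form b -> conv K a b \o p = conv H (a \o p) (b \o p).
Proof. by move=> ca cb; apply/funext => x; rewrite /= /conv pD tform_tmap. Qed.

End Morphism.

Section TensorCoalgebra.
Variables (X Y : Type) (H : bialg R X) (K : bialg R Y) (cH : coalg H) (cK : coalg K).
Let dH := coalg_comul cH.
Let dK := coalg_comul cK.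
Let eH := coalg_counit cH.
Let eK := coalg_counit cK.

Lemma comul_btens_tens x y :
  bcomul (btens H K) (tens x y) = mid4 (tens (bcomul H x) (bcomul K y)).
Proof. by rewrite /= tmap_tens. Qed.

Lemma ltrans_tens a b x y : cont_form a -> cont_form b ->
  ltrans (btens H K) (tform a b) (tens x y) = tens (ltrans H a x) (ltrans K b y).
Proof.
move=> ca cb; rewrite /ltrans comul_btens_tens; apply/funext => -[x1 y1].
exact: (tform_tens (fun x0 => bcomul H x (x0, x1)) (fun y0 => bcomul K y (y0, y1)) ca cb).
Qed.

Lemma rtrans_tens a b x y : cont_form a -> cont_form b ->
  rtrans (btens H K) (tform a b) (tens x y) = tens (rtrans H a x) (rtrans K b y).
Proof.
move=> ca cb; rewrite /rtrans comul_btens_tens; apply/funext => -[x1 y1].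
exact: (tform_tens (fun x0 => bcomul H x (x1, x0)) (fun y0 => bcomul K y (y1, y0)) ca cb).
Qed.

Lemma conv_tform a b c d : cont_form a -> cont_form b -> cont_form c -> cont_form d ->
  conv (btens H K) (tform a b) (tform c d) = tform (conv H a c) (conv K b d).
Proof.
move=> ca cb cc cd; apply/funext.
have c1 : cont_form (conv H a c) by exact: cf_conv.
have c2 : cont_form (conv K b d) by exact: cf_conv.
have cHK : coalg (btens H K) by exact: coalg_btens.
apply: cf_ext => [||x y]; [|by cf|].
  by apply: cf_conv => //; cf.
by rewrite conv_rtrans rtrans_tens // !tform_tens.
Qed.

End TensorCoalgebra.

Lemma conv_inv_uniq X (H : bialg R X) (cH : coalg H) l r r' :
  cont_form l -> cont_form r -> cont_form r' ->
  conv H r l = bcounit H -> conv H l r' = bcounit H -> r = r'.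
Proof.
move=> cl cr cr' rl lr'.
by rewrite -(conv1r cH r) -lr' -(convA cH) // rl conv1l.
Qed.

End Translations.

Record comorph (R : topComNzRingType) X Y (H : bialg R X) (K : bialg R Y)
    (p : (X -> R) -> Y -> R) : Prop := Comorph {
  comorph_cl : cont_linear p;
  comorph_comul : forall x, bcomul K (p x) = tmap p p (bcomul H x);
  comorph_counit : forall x, bcounit K (p x) = bcounit H x }.

Section Comorphisms.
Context {R : topComNzRingType} {aR : adic R}.

Lemma comorph_id X (H : bialg R X) : comorph H H id.
Proof.
split=> // [|x]; first by cf.
by apply/funext => -[x1 x2].
Qed.

Lemma mid4_tmap X Y X' Y' X1 Y1 X1' Y1' (f : (X -> R) -> X' -> R) (f1 : (X1 -> R) -> X1' -> R)
  (g : (Y -> R) -> Y' -> R) (g1 : (Y1 -> R) -> Y1' -> R) u v :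
  cont_linear f -> cont_linear f1 -> cont_linear g -> cont_linear g1 ->
  tmap (tmap f g) (tmap f1 g1) (mid4 (tens u v)) = mid4 (tens (tmap f f1 u) (tmap g g1 v)).
Proof.
move=> cf cf1 cg cg1.
have c1 := @cl_tmap _ aR _ _ _ _ f g cf cg.
have c2 := @cl_tmap _ aR _ _ _ _ f1 g1 cf1 cg1.
have c3 := @cl_tmap _ aR _ _ _ _ f f1 cf cf1.
have c4 := @cl_tmap _ aR _ _ _ _ g g1 cg cg1.
move: u; apply: cl_ext => [||a b]; [by cf|by cf|].
move: v; apply: cl_ext => [||c d]; [by cf|by cf|].
rewrite mid4_tens !tmap_tens //. by rewrite mid4_tens.
Qed.

Lemma comorph_tmap X Y X' Y' (H : bialg R X) (K : bialg R Y) (H' : bialg R X') (K' : bialg R Y')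
  p q : coalg H -> coalg K -> coalg H' -> coalg K' ->
  comorph H H' p -> comorph K K' q -> comorph (btens H K) (btens H' K') (tmap p q).
Proof.
move=> cH cK cH' cK' [cp pD pE] [cq qD qE].
have cHK : coalg (btens H K) by exact: coalg_btens.
have cHK' : coalg (btens H' K') by exact: coalg_btens.
have d1 := coalg_comul cHK; have d2 := coalg_comul cHK'.
have e1 := coalg_counit cHK; have e2 := coalg_counit cHK'.
have cpq : cont_linear (tmap p q) by exact: cl_tmap.
split=> //.
- apply: cl_ext => [||x y]; [by cf|by cf|].
  by rewrite tmap_tens // !comul_btens_tens // pD qD mid4_tmap.
- apply: cf_ext => [||x y]; [by cf|by cf|].
  have ? := coalg_counit cH; have ? := coalg_counit cK.
  have ? := coalg_counit cH'; have ? := coalg_counit cK'.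
  by rewrite tmap_tens //= !tform_tens // pE qE.
Qed.

Lemma tassoc_tens X Y Z (x : X -> R) (y : Y -> R) (z : Z -> R) :
  tassoc (tens (tens x y) z) = tens x (tens y z).
Proof. by apply/funext => -[a [b c]]; rewrite /tassoc /tens /= mulrA. Qed.

Lemma comorph_tassoc X Y Z (H : bialg R X) (K : bialg R Y) (L : bialg R Z) :
  coalg H -> coalg K -> coalg L ->
  comorph (btens (btens H K) L) (btens H (btens K L)) (@tassoc R X Y Z).
Proof.
move=> cH cK cL.
have cHK : coalg (btens H K) by exact: coalg_btens.
have cKL : coalg (btens K L) by exact: coalg_btens.
have c1 : coalg (btens (btens H K) L) by exact: coalg_btens.
have c2 : coalg (btens H (btens K L)) by exact: coalg_btens.
have d1 := coalg_comul c1; have d2 := coalg_comul c2.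
have e1 := coalg_counit c1; have e2 := coalg_counit c2.
split; first exact: cl_tassoc.
- apply: cl_ext => [||t z]; [by cf|by cf|].
  move: t; apply: cl_ext => [||x y]; [by cf|by cf|].
  rewrite tassoc_tens !comul_btens_tens //.
  move: (bcomul H x); apply: cl_ext => [||x1 x2]; [by cf|by cf|].
  move: (bcomul K y); apply: cl_ext => [||y1 y2]; [by cf|by cf|].
  move: (bcomul L z); apply: cl_ext => [||z1 z2]; [by cf|by cf|].
  by rewrite !mid4_tens tmap_tens ?tassoc_tens //; cf.
- have ? := coalg_counit cHK; have ? := coalg_counit cKL.
  have ? := coalg_counit cH; have ? := coalg_counit cK; have ? := coalg_counit cL.
  apply: cf_ext => [||t z]; [by cf|by cf|].
  move: t; apply: cf_ext => [||x y]; [by cf|by cf|].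
  by rewrite tassoc_tens /= !tform_tens ?mulrA //; cf.
Qed.

End Comorphisms.

Section CocycleDeformation.
Variables (k : fieldType) (E : Type) (F : bialg (series k) E) (bF : bialgebra F).
Variables (sigma sigma' : (E * E -> series k) -> series k).
Hypothesis sc : hopf_2cocycle F sigma sigma'.

Let F2 := btens F F.
Let bF2 : bialgebra F2 := bialgebra_btens bF bF.
Let cF : coalg F := bialg_coalg bF.
Let cF2 : coalg F2 := bialg_coalg bF2.
Let mF : cont_linear (bmul F) := bialg_mul bF.
Let dF : cont_linear (bcomul F) := coalg_comul cF.
Let eF : cont_form (bcounit F) := coalg_counit cF.
Let dF2 : cont_linear (bcomul F2) := coalg_comul cF2.
Let eF2 : cont_form (bcounit F2) := coalg_counit cF2.

Lemma coc_cont : cont_form sigma. Proof. exact: (coc_dual sc).1. Qed.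
Lemma coc_cont' : cont_form sigma'. Proof. exact: (coc_dual_inv sc).1. Qed.
Let cs := coc_cont.
Let cs' := coc_cont'.

Let invr : conv F2 sigma sigma' = bcounit F2 := coc_invr sc.
Let invl : conv F2 sigma' sigma = bcounit F2 := coc_invl sc.

Let Fs := cocycle_deform F sigma sigma'.

(** The deformation precedes the old product by a left translation and a right translation of the
    tensor square, so its axioms become statements about translations. *)
Lemma bmul_deform t : bmul Fs t = bmul F (rtrans F2 sigma' (ltrans F2 sigma t)).
Proof.
rewrite /Fs /=; congr (bmul F _); rewrite /rtrans; congr (rform _ _).
exact: lform_rmap.
Qed.

Let cla : cont_linear (ltrans F2 sigma) := cl_ltrans cF2 cs.
Let cra : cont_linear (rtrans F2 sigma') := cl_rtrans cF2 cs'.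

Lemma cl_bmul_deform : cont_linear (bmul Fs).
Proof.
have -> : bmul Fs = fun t => bmul F (rtrans F2 sigma' (ltrans F2 sigma t)).
  by apply/funext => t; exact: bmul_deform.
by cf.
Qed.

Lemma comul_bmul t : bcomul F (bmul F t) = tmap (bmul F) (bmul F) (bcomul F2 t).
Proof.
move: t; apply: cl_ext => [||x y]; [by cf|by cf|].
by rewrite -[bmul F _]/(mulb F x y) bialg_comulM // /F2 comul_btens_tens.
Qed.

Lemma counit_bmul t : bcounit F (bmul F t) = bcounit F2 t.
Proof.
move: t; apply: cf_ext => [||x y]; [by cf|by []|].
by rewrite -[bmul F _]/(mulb F x y) bialg_counitM // /= tform_tens.
Qed.

Let cs2 : cont_linear (bmul Fs) := cl_bmul_deform.

(** Delta of a deformed product carries sigma on the far left and sigma' on the far right. The two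
    deformed products on the other side have in addition sigma' sigma in the middle, which
    cancels. *)
Lemma comul_bmul_deform t : bcomul F (bmul Fs t) = tmap (bmul Fs) (bmul Fs) (bcomul F2 t).
Proof.
rewrite bmul_deform comul_bmul comul_rtrans // comul_ltrans //.
have -> : tmap (bmul Fs) (bmul Fs) (bcomul F2 t) =
    tmap ((bmul F \o ltrans F2 sigma) \o rtrans F2 sigma') ((bmul F \o rtrans F2 sigma') \o
      ltrans F2 sigma) (bcomul F2 t).
  congr (tmap _ _ _); apply/funext => u; rewrite bmul_deform //=.
  by rewrite ltrans_rtrans.
rewrite -[RHS]tmap_comp; [|by rewrite /comp; cf..].
by rewrite tmap_rtrans_ltrans // -tmap_comp // (tmapC (bcomul F2 t)).
Qed.

Lemma counit_bmul_deform t : bcounit F (bmul Fs t) = bcounit F2 t.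
Proof. by rewrite bmul_deform counit_bmul -conv_rtrans conv1l // -conv_ltrans // invr. Qed.

Lemma cocycle_unitl x : sigma (tens (bone F) x) = bcounit F x.
Proof. exact: (coc_norml sc). Qed.
Lemma cocycle_unitr x : sigma (tens x (bone F)) = bcounit F x.
Proof. exact: (coc_normr sc). Qed.

Lemma ltrans_unitl a x : cont_form a -> (forall x, a (tens (bone F) x) = bcounit F x) ->
  ltrans F2 a (tens (bone F) x) = tens (bone F) x.
Proof.
move=> ca a1; rewrite /ltrans comul_btens_tens // bialg_comul1 //; apply/funext => -[y1 y2].
have := a1 (fun q => bcomul F x (q, y2)); rewrite (counitlE cF) => eE.
rewrite [RHS]/tens /= -eE -(linZ _ _ (cf_lin ca)); congr a; apply/funext => -[q1 q2].
by rewrite /mid4 /tens /=; ring.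
Qed.

Lemma ltrans_unitr a x : cont_form a -> (forall x, a (tens x (bone F)) = bcounit F x) ->
  ltrans F2 a (tens x (bone F)) = tens x (bone F).
Proof.
move=> ca a1; rewrite /ltrans comul_btens_tens // bialg_comul1 //; apply/funext => -[y1 y2].
have := a1 (fun q => bcomul F x (q, y1)); rewrite (counitlE cF) => eE.
rewrite [RHS]/tens /= -eE mulrC -(linZ _ _ (cf_lin ca)); congr a; apply/funext => -[q1 q2].
by rewrite /mid4 /tens /=; ring.
Qed.

Lemma rtrans_unitl a x : cont_form a -> (forall x, a (tens (bone F) x) = bcounit F x) ->
  rtrans F2 a (tens (bone F) x) = tens (bone F) x.
Proof.
move=> ca a1; rewrite /rtrans comul_btens_tens // bialg_comul1 //; apply/funext => -[y1 y2].
have := a1 (fun q => bcomul F x (y2, q)); rewrite (counitrE cF) => eE.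
rewrite [RHS]/tens /= -eE -(linZ _ _ (cf_lin ca)); congr a; apply/funext => -[q1 q2].
by rewrite /mid4 /tens /=; ring.
Qed.

Lemma rtrans_unitr a x : cont_form a -> (forall x, a (tens x (bone F)) = bcounit F x) ->
  rtrans F2 a (tens x (bone F)) = tens x (bone F).
Proof.
move=> ca a1; rewrite /rtrans comul_btens_tens // bialg_comul1 //; apply/funext => -[y1 y2].
have := a1 (fun q => bcomul F x (y1, q)); rewrite (counitrE cF) => eE.
rewrite [RHS]/tens /= -eE mulrC -(linZ _ _ (cf_lin ca)); congr a; apply/funext => -[q1 q2].
by rewrite /mid4 /tens /=; ring.
Qed.

(** Left translation by sigma fixes 1 (x) x, so sigma' takes there the value of sigma * sigma', the
    counit. *)
Lemma cocycle_unitl' x : sigma' (tens (bone F) x) = bcounit F x.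
Proof.
rewrite -{1}(ltrans_unitl x cs cocycle_unitl) -conv_ltrans // invr /= tform_tens //.
by rewrite bialg_counit1 // mul1r.
Qed.

Lemma cocycle_unitr' x : sigma' (tens x (bone F)) = bcounit F x.
Proof.
rewrite -{1}(ltrans_unitr x cs cocycle_unitr) -conv_ltrans // invr /= tform_tens //.
by rewrite bialg_counit1 // mulr1.
Qed.

Lemma deform_mul1l x : mulb Fs (bone F) x = x.
Proof.
rewrite /mulb bmul_deform ltrans_unitl //; last exact: cocycle_unitl.
rewrite rtrans_unitl //; [exact: bialg_mul1l|exact: cocycle_unitl'].
Qed.

Lemma deform_mul1r x : mulb Fs x (bone F) = x.
Proof.
rewrite /mulb bmul_deform ltrans_unitr //; last exact: cocycle_unitr.
rewrite rtrans_unitr //; [exact: bialg_mul1r|exact: cocycle_unitr'].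
Qed.

Let F3 := btens F2 F.
Let F3' := btens F F2.
Let cF3 : coalg F3 := coalg_btens cF2 cF.
Let cF3' : coalg F3' := coalg_btens cF cF2.

Lemma comorph_bmul : comorph F2 F (bmul F).
Proof. by split=> // t; [exact: comul_bmul|exact: counit_bmul]. Qed.

Let p := tmap (bmul F) (@id (E -> series k)).
Let q := tmap (@id (E -> series k)) (bmul F).
Let pm : comorph F3 F2 p := comorph_tmap cF2 cF cF cF comorph_bmul (comorph_id F).
Let qm : comorph F3' F2 q := comorph_tmap cF cF2 cF cF (comorph_id F) comorph_bmul.
Let am : comorph F3 F3' (@tassoc (series k) E E E) := comorph_tassoc cF cF cF.

Local Notation ta := (@tassoc (series k) E E E).

Lemma bmul_tassoc t : bmul F (q (tassoc t)) = bmul F (p t).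
Proof.
have cp := comorph_cl pm; have cq := comorph_cl qm.
move: t; apply: cl_ext => [||t z]; [by cf|by cf|].
move: t; apply: cl_ext => [||x y]; [by cf|by cf|].
rewrite tassoc_tens /p /q !tmap_tens //; [|by cf..].
exact/esym/(bialg_mulA bF).
Qed.

(** A coalgebra morphism r turns the translations of the outer product into translations by sigma \o
    r before r, which compose with those already made. It is used for r = m (x) id and r = id (x)
    m. *)
Lemma deform_pull Y (G : bialg (series k) Y) r b b' T : coalg G -> comorph G F2 r ->
  cont_form b -> cont_form b' ->
  bmul Fs (r (rtrans G b' (ltrans G b T))) =
  bmul F (r (rtrans G (conv G (sigma' \o r) b') (ltrans G (conv G b (sigma \o r)) T))).
Proof.
move=> cG [cr rD rE] cb cb'.
have c1 : cont_form (sigma \o r) by rewrite /comp; cf.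
have c2 : cont_form (sigma' \o r) by rewrite /comp; cf.
rewrite bmul_deform (ltrans_morph cr rD) // (rtrans_morph cr rD) //.
by rewrite ltrans_rtrans // rtrans_rtrans // ltrans_ltrans.
Qed.

(* Both iterated products of the deformation are obtained from m (m (x) id) by
   translations by the two sides of the cocycle identity and their inverses. *)
Lemma deform_mulA x y z : mulb Fs (mulb Fs x y) z = mulb Fs x (mulb Fs y z).
Proof.
have cp := comorph_cl pm; have cq := comorph_cl qm.
pose B := tform sigma (bcounit F); pose B' := tform sigma' (bcounit F).
pose D := tform (bcounit F) sigma; pose D' := tform (bcounit F) sigma'.
have cB : cont_form B by rewrite /B; cf.
have cB' : cont_form B' by rewrite /B'; cf.
have cD : cont_form D by rewrite /D; cf.
have cD' : cont_form D' by rewrite /D'; cf.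
have cA : cont_form (sigma \o p) by rewrite /comp; cf.
have cA' : cont_form (sigma' \o p) by rewrite /comp; cf.
have cC : cont_form (sigma \o q) by rewrite /comp; cf.
have cC' : cont_form (sigma' \o q) by rewrite /comp; cf.
pose L := conv F3 B (sigma \o p); pose L' := conv F3 (sigma' \o p) B'.
pose M := conv F3' D (sigma \o q); pose M' := conv F3' (sigma' \o q) D'.
have cL : cont_form L by exact: cf_conv.
have cL' : cont_form L' by exact: cf_conv.
have cM : cont_form M by exact: cf_conv.
have cM' : cont_form M' by exact: cf_conv.
have ca : cont_linear (@tassoc (series k) E E E) by cf.
(* This is the cocycle identity, carried along the associativity isomorphism. *)
have LM : L = M \o ta.
  apply/funext; apply: cf_ext => [||t c]; [by []|by rewrite /comp; cf|].
  have ct : cont_form (fun t => L (tens t c)) by cf.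
  move: t; apply: cf_ext => [||a b]; [by []|by rewrite /comp; cf|].
  rewrite /L /M /= tassoc_tens !conv_ltrans // !ltrans_tens // !ltrans1 //= /p /q !tmap_tens
    //; [|by cf..].
  have := coc_eq sc a b c; rewrite tformC //; last by cf.
  by rewrite [X in _ = X -> _]tformC //; cf.
(* The matching identity for sigma' follows from uniqueness of inverses: L' is a left inverse of L,
   and M' pulled back along the associator is a right inverse. *)
have LL : conv F3 L' L = bcounit F3.
  rewrite /L /L' convA // -[in X in conv _ _ X]convA // /B /B' conv_tform // invl conv1l //.
  have -> : tform (bcounit F2) (bcounit F) = bcounit F3 by [].
  rewrite conv1l // -(conv_morph (comorph_cl pm) (comorph_comul pm)) // invl.
  by apply/funext => t; exact: comorph_counit pm t.
have MM : conv F3 L (M' \o ta) = bcounit F3.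
  rewrite LM -(conv_morph (comorph_cl am) (comorph_comul am)) //.
  apply/funext => t; rewrite /= -[RHS](comorph_counit am); congr (_ (tassoc t)).
  rewrite /M /M' convA //.
  rewrite -[in X in conv _ _ X]convA // -(conv_morph (comorph_cl qm) (comorph_comul qm)) //
    invr.
  have -> : bcounit F2 \o q = bcounit F3' by apply/funext => u; exact: comorph_counit qm u.
  by rewrite conv1l // /D /D' conv_tform // invr conv1l.
have cMa : cont_form (M' \o ta) by rewrite /comp; cf.
have LM' : L' = M' \o ta by exact: (conv_inv_uniq cF3 cL).
transitivity (bmul Fs (p (rtrans F3 B' (ltrans F3 B (tens (tens x y) z))))).
  rewrite /B /B' ltrans_tens // rtrans_tens // ltrans1 // rtrans1 // /p tmap_tens //;
    last by cf.
  by rewrite -bmul_deform.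
transitivity (bmul Fs (q (rtrans F3' D' (ltrans F3' D (tens x (tens y z)))))); last first.
  rewrite /D /D' ltrans_tens // rtrans_tens // ltrans1 // rtrans1 // /q tmap_tens //;
    last by cf.
  by rewrite -bmul_deform.
rewrite (deform_pull _ cF3 pm) // (deform_pull _ cF3' qm) // -/L -/L' -/M -/M'.
rewrite -tassoc_tens (ltrans_morph (comorph_cl am) (comorph_comul am)) //.
by rewrite (rtrans_morph (comorph_cl am) (comorph_comul am)) // bmul_tassoc -LM -LM'.
Qed.

Lemma bialgebra_deform : bialgebra Fs.
Proof.
split.
- by case: cF => *; split.
- exact: cs2.
- exact: deform_mulA.
- exact: deform_mul1l.
- exact: deform_mul1r.
- move=> x y; rewrite [LHS]comul_bmul_deform /mulb /F2 comul_btens_tens //.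
- exact: bialg_comul1 bF.
- by move=> x y; rewrite [LHS]counit_bmul_deform /= tform_tens.
- exact: bialg_counit1 bF.
Qed.

End CocycleDeformation.

Local Notation lift := Defs.lift.

(** * Reduction modulo hbar and the semiclassical limit *)

Section Reduction.
Variable k : fieldType.
Implicit Types X Y Z : Type.

Lemma redE X (u : X -> series k) x : red u x = u x 0%N. Proof. by []. Qed.

Lemma lift_lin X a (u v : X -> discr k) : lift (a \*o u + v) = seriesC a \*o lift u + lift v.
Proof. by apply/funext => x; rewrite !fE /lift -seriesCM -seriesCD. Qed.

Lemma red_lift X (u : X -> discr k) : red (lift u) = u. Proof. by []. Qed.

Lemma red_eq0 X (u : X -> series k) : red u = 0 -> u = hbar \*o (fun x => hdiv (u x)).
Proof. by move=> u0; apply/funext => x; apply: hdivK; exact: (congr1 (fun f => f x) u0). Qed.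

Lemma red_eq X (u v : X -> series k) : red u = red v ->
  u = v + hbar \*o (fun x => hdiv (u x - v x)).
Proof.
move=> uv; apply/funext => x.
have E : u x 0%N = v x 0%N by exact: (congr1 (fun f => f x) uv).
have d0 : (u x - v x) 0%N = 0.
  by rewrite -[LHS]/(u x 0%N - v x 0%N) E subrr.
by rewrite -[RHS]/(v x + hbar * hdiv (u x - v x)) -(hdivK d0) addrC subrK.
Qed.

Lemma hbar0 (f : series k) : (hbar * f) 0%N = 0. Proof. by rewrite hbarE. Qed.

(** A change of u by a multiple of hbar changes phi u by a multiple of hbar, so any lift computes
    the reduction. *)
Lemma red_form_red X (phi : (X -> series k) -> series k) u : cont_form phi ->
  phi u 0%N = red_form phi (red u).
Proof.
move=> cp; have e : u = lift (red u) + hbar \*o (fun x => hdiv (u x - lift (red u) x)).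
  exact: red_eq.
have -> : phi u = phi (lift (red u)) + hbar * phi (fun x => hdiv (u x - lift (red u) x)).
  by rewrite {1}e (linD _ _ (cf_lin cp)) (linZ _ _ (cf_lin cp)).
by rewrite series_addE hbar0 addr0.
Qed.

Lemma red_map_red X Y (f : (X -> series k) -> Y -> series k) u : cont_linear f ->
  red (f u) = red_map f (red u).
Proof. by move=> cf; apply/funext => y; exact: (red_form_red u (cl_form y cf)). Qed.

Lemma cf_red_form X (phi : (X -> series k) -> series k) : cont_form phi ->
  cont_form (red_form phi : (X -> discr k) -> discr k).
Proof.
move=> cp; apply: cont_form_intro.
  move=> a u v; rewrite /red_form lift_lin (cf_lin cp).
  by rewrite series_addE series_mul0E.
move=> n; have [s sn] := cf_small 1 cp; exists s, 0%N => u us /=.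
have /hdvdP/(_ 0%N isT) : hdvd 1 (phi (lift u)).
  apply: sn => x /us /= ux; rewrite /Defs.lift ux;
    suff -> : seriesC (0 : discr k) = 0 :> series k by exact: hdvd0.
  by apply/funext => -[].
by [].
Qed.

Lemma cl_red_map X Y (f : (X -> series k) -> Y -> series k) : cont_linear f ->
  cont_linear (red_map f : (X -> discr k) -> Y -> discr k).
Proof. by move=> cf; apply/cont_linearP => y; exact: (cf_red_form (cl_form y cf)). Qed.

Lemma red_tens X Y (u : X -> series k) (v : Y -> series k) :
  red (tens u v) = tens (red u) (red v).
Proof. by apply/funext => -[x y]; rewrite redE /tens series_mul0E. Qed.

Lemma red_add X (u v : X -> series k) : red (u + v) = red u + red v. Proof. by []. Qed.
Lemma red_opp X (u : X -> series k) : red (- u) = - red u. Proof. by []. Qed.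
Lemma red_scale X a (u : X -> series k) : red (a \*o u) = a 0%N \*o red u :> (X -> discr k).
Proof. by apply/funext => x; exact: series_mul0E. Qed.

Lemma red_lmap X Y Z (f : (X -> series k) -> Y -> series k) (t : X * Z -> series k) :
  cont_linear f -> red (lmap f t) = lmap (red_map f) (red t).
Proof. by move=> cf; apply/funext => -[y z]; exact: (red_form_red _ (cl_form y cf)). Qed.

Lemma red_rmap X Y Z (f : (X -> series k) -> Y -> series k) (t : Z * X -> series k) :
  cont_linear f -> red (rmap f t) = rmap (red_map f) (red t).
Proof. by move=> cf; apply/funext => -[z y]; exact: (red_form_red _ (cl_form y cf)). Qed.

Lemma red_tmap X Y X' Y' (f : (X -> series k) -> Y -> series k)
  (g : (X' -> series k) -> Y' -> series k) t :
  cont_linear f -> cont_linear g -> red (tmap f g t) = tmap (red_map f) (red_map g) (red t).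
Proof. by move=> cf cg; rewrite /tmap red_lmap // red_rmap. Qed.

Lemma red_lform X Y (phi : (X -> series k) -> series k) (t : X * Y -> series k) :
  cont_form phi -> red (lform phi t) = lform (red_form phi) (red t).
Proof. by move=> cp; apply/funext => y; exact: red_form_red. Qed.

Lemma red_rform X Y (phi : (Y -> series k) -> series k) (t : X * Y -> series k) :
  cont_form phi -> red (rform phi t) = rform (red_form phi) (red t).
Proof. by move=> cp; apply/funext => y; exact: red_form_red. Qed.

Lemma red_mulb X (H : bialg (series k) X) x y : cont_linear (bmul H) ->
  red (mulb H x y) = mulb (red_bialg H) (red x) (red y).
Proof. by move=> mH; rewrite /mulb red_map_red // red_tens. Qed.

End Reduction.

Section Semiclassical.
Variables (k : fieldType) (X : Type) (H : bialg (series k) X) (bH : bialgebra H).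
Hypothesis comm : commutative_bialg (red_bialg H).
Let mH : cont_linear (bmul H) := bialg_mul bH.
Let dH : cont_linear (bcomul H) := coalg_comul bH.
Let eH : cont_form (bcounit H) := coalg_counit bH.
Local Notation G := (semiclassical H).
Local Notation fl := (@flip (series k) X X).

(** The bracket before reduction. Commutator identities are exact in H, and hbar is cancelled there,
    even twice for Jacobi, before passing to the limit. *)
Definition hbr (t : X * X -> series k) : X -> series k :=
  fun e => hdiv (bmul H t e - bmul H (flip t) e).

Let hcomm t := bmul H t - bmul H (flip t).

Lemma cl_hcomm : cont_linear hcomm.
Proof. by rewrite /hcomm; cf. Qed.

Lemma red_bmul_flip t : red (bmul H (flip t)) = red (bmul H t).
Proof.
have mG := cl_red_map mH.
rewrite (red_map_red (flip t) mH) (red_map_red t mH);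
  change (red_map (bmul H) (flip (red t : _ -> discr k)) = red_map (bmul H) (red t)).
move: (red t); apply: cl_ext => [||x y]; [by cf|by []|].
by rewrite flip_tens; exact: comm.
Qed.

Lemma red_hcomm t : red (hcomm t) = 0.
Proof. by rewrite /hcomm red_add red_opp red_bmul_flip subrr. Qed.

Lemma cl_hbr : cont_linear hbr.
Proof. exact: (cl_hdiv cl_hcomm red_hcomm). Qed.

Lemma hbrE t : bmul H t - bmul H (flip t) = hbar \*o hbr t.
Proof. exact: (red_eq0 (red_hcomm t)). Qed.

Definition hbrk x y := hbr (tens x y).

Lemma hbrkE x y : mulb H x y - mulb H y x = hbar \*o hbrk x y.
Proof. by rewrite -hbrE flip_tens. Qed.

Lemma hbar_sc_inj Y (u v : Y -> series k) : hbar \*o u = hbar \*o v -> u = v.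
Proof. by move=> uv; apply/funext => x; apply: hbar_inj; exact: (congr1 (fun f => f x) uv). Qed.

Lemma pbrE : pbr G = red_map hbr. Proof. by []. Qed.

Lemma poisson_red x y : poisson G (red x) (red y) = red (hbrk x y).
Proof. by rewrite /poisson pbrE -red_tens -red_map_red //; exact: cl_hbr. Qed.

Lemma poisson_lift x y : poisson G x y = red (hbrk (lift x) (lift y)).
Proof. by rewrite -poisson_red. Qed.

Let ml x : cont_linear (mulb H x) := cl_mulbl x mH.
Let mr x : cont_linear (fun y => mulb H y x) := cl_mulbr x mH.
Lemma hbrk_anti x y : hbrk x y = - hbrk y x.
Proof.
apply: hbar_sc_inj; rewrite -hbrkE.
have -> : hbar \*o - hbrk y x = - (hbar \*o hbrk y x).
  by apply/funext => e; rewrite !fE mulrN.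
by rewrite -hbrkE opprB.
Qed.

Lemma mulbBl x y z : mulb H (x - y) z = mulb H x z - mulb H y z.
Proof. exact: clB (mr z). Qed.
Lemma mulbBr x y z : mulb H z (x - y) = mulb H z x - mulb H z y.
Proof. exact: clB (ml z). Qed.
Lemma mulbZl a x z : mulb H (a \*o x) z = a \*o mulb H x z.
Proof. exact: clZ (mr z). Qed.
Lemma mulbZr a x z : mulb H z (a \*o x) = a \*o mulb H z x.
Proof. exact: clZ (ml z). Qed.

Lemma hbrk_leibniz x y z : hbrk x (mulb H y z) = mulb H (hbrk x y) z + mulb H y (hbrk x z).
Proof.
apply: hbar_sc_inj; rewrite -hbrkE.
have -> : hbar \*o (mulb H (hbrk x y) z + mulb H y (hbrk x z)) =
   mulb H (hbar \*o hbrk x y) z + mulb H y (hbar \*o hbrk x z).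
  by rewrite mulbZl mulbZr; apply/funext => e; rewrite !fE mulrDr.
by rewrite -!hbrkE mulbBl mulbBr !bialg_mulA // subrKA.
Qed.

Lemma hbrk_jacobi x y z : hbrk (hbrk x y) z + hbrk (hbrk y z) x + hbrk (hbrk z x) y = 0.
Proof.
have K a b c : hbar \*o (hbar \*o hbrk (hbrk a b) c) =
    mulb H (mulb H a b) c - mulb H (mulb H b a) c - (mulb H c (mulb H a b) - mulb H c (mulb H
      b a)).
  rewrite -mulbBl -mulbBr (hbrkE a b) mulbZl mulbZr -(hbrkE (hbrk a b) c).
  by apply/funext => e; rewrite !fE mulrBr.
apply: hbar_sc_inj; apply: hbar_sc_inj.
have -> : hbar \*o (hbar \*o (hbrk (hbrk x y) z + hbrk (hbrk y z) x + hbrk (hbrk z x) y)) =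
  hbar \*o (hbar \*o hbrk (hbrk x y) z) + hbar \*o (hbar \*o hbrk (hbrk y z) x) +
  hbar \*o (hbar \*o hbrk (hbrk z x) y) by apply/funext => e; rewrite !fE; ring.
by rewrite !K !bialg_mulA //; apply/funext => e; rewrite !fE; ring.
Qed.

(** The splitting is [a (x) b, c (x) d] = [a, c] (x) b d + c a (x) [b, d]. The flip in c a is
    harmless, since the reduction is commutative. *)
Lemma comul_hbrk x y : let t := mid4 (tens (bcomul H x) (bcomul H y)) in
  bcomul H (hbrk x y) = tmap hbr (bmul H) t + tmap (bmul H \o fl) hbr t.
Proof.
move=> t; have cb := cl_hbr; have cfl := @cl_flip _ (series_adic k) X X.
have cmf : cont_linear (bmul H \o fl) by rewrite /comp; cf.
apply: hbar_sc_inj; rewrite -(clZ _ _ dH) -hbrkE (clB _ _ dH) !bialg_comulM //.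
have -> : mulb (btens H H) (bcomul H x) (bcomul H y) = tmap (bmul H) (bmul H) t by [].
have -> : mulb (btens H H) (bcomul H y) (bcomul H x) = tmap (bmul H \o fl) (bmul H \o fl) t.
  rewrite /mulb /=; apply/funext => -[a b]; rewrite /tmap /lmap /rmap /= ; congr (bmul H _ a).
  apply/funext => p; congr (bmul H _ b); apply/funext => q.
  by rewrite /t /mid4 /flip /tens /= mulrC.
apply/funext => -[a b]; rewrite !fE /tmap /lmap /rmap /=.
pose K1 x' := bmul H (fun y' => t (x', y')) b.
pose K2 x' := bmul H (flip (fun y' => t (x', y'))) b.
have E1 : K1 = K2 + hbar \*o (fun x' => hbr (fun y' => t (x', y')) b).
  apply/funext => x'; rewrite !fE.
  by have /= <- := congr1 (fun f => f b) (hbrE (fun y' => t (x', y'))); rewrite addrC subrK.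
have E2 : bmul H K1 a = bmul H (flip K1) a + hbar * hbr K1 a.
  by have /= <- := congr1 (fun f => f a) (hbrE K1); rewrite !fE addrC subrK.
rewrite -/K1 E2 -/K2.
move: (hbr K1 a) => h1.
rewrite E1 (clD _ _ cfl) (clZ _ _ cfl) (clD _ _ mH) (clZ _ _ mH) !fE.
ring.
Qed.

(** Applied to the deformed algebra, this provides the Poisson axioms of G_zeta without any
    computation with the deformed bracket. *)
Lemma semiclassical_formal_poisson_group :
  topological_hopf (red_bialg H) -> adic_complete (red_bialg H) -> formal_poisson_group G.
Proof.
move=> hG aG; have cb := cl_hbr; have mG := cl_red_map mH.
have cfl := @cl_flip _ (series_adic k) X X.
split=> //.
- exact: cl_red_map cl_hbr.
- by move=> x y; rewrite !poisson_lift hbrk_anti red_opp.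
- move=> x y z; rewrite -(red_lift x) -(red_lift y) -(red_lift z) !poisson_red -!red_add.
  by rewrite hbrk_jacobi.
- move=> x y z; rewrite -(red_lift x) -(red_lift y) -(red_lift z).
  rewrite -[mulb G _ _]/(mulb (red_bialg H) _ _) -red_mulb // !poisson_red hbrk_leibniz red_add.
  by rewrite !red_mulb.
- move=> x y t.
  have tE : t = red (mid4 (tens (bcomul H (lift x)) (bcomul H (lift y)))).
    transitivity (mid4 (red (tens (bcomul H (lift x)) (bcomul H (lift y))) : _ ->
      discr k)) => //.
    by rewrite red_tens.
  have cmf : cont_linear (bmul H \o fl) by rewrite /comp; cf.
  rewrite poisson_lift; transitivity (red (bcomul H (hbrk (lift x) (lift y)))).
    exact: (esym (red_map_red (hbrk (lift x) (lift y)) dH)).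
  rewrite comul_hbrk red_add (red_tmap _ cb mH) (red_tmap _ cmf cb) -tE.
  have -> : red_map (bmul H \o fl) = red_map (bmul H).
    by apply/funext => u; exact: red_bmul_flip.
  by [].
Qed.

End Semiclassical.

Lemma comul_flip (R : topComNzRingType) {aR : adic R} X (H : bialg R X) (cH : coalg H) t p q :
  bcomul (btens H H) (flip t) (p, q) = bcomul (btens H H) t ((p.2, p.1), (q.2, q.1)).
Proof.
have dH := coalg_comul cH.
exact: (fubini (fun x y => t (y, x)) (cl_form (p.1, q.1) dH) (cl_form (p.2, q.2) dH)).
Qed.

Lemma lform_comul_flip (R : topComNzRingType) {aR : adic R} X (H : bialg R X) (cH : coalg H)
  phi t :
  lform phi (bcomul (btens H H) (flip t)) = flip (lform (flip_form phi) (bcomul (btens H H) t)).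
Proof.
apply/funext => -[y1 y2]; rewrite /flip /lform /flip_form /=.
congr phi; apply/funext => -[x1 x2]; rewrite /flip /=.
exact: (comul_flip cH t (x1, x2) (y1, y2)).
Qed.

Lemma rform_comul_flip (R : topComNzRingType) {aR : adic R} X (H : bialg R X) (cH : coalg H)
  phi t :
  rform phi (bcomul (btens H H) (flip t)) = flip (rform (flip_form phi) (bcomul (btens H H) t)).
Proof.
apply/funext => -[y1 y2]; rewrite /flip /rform /flip_form /=.
congr phi; apply/funext => -[x1 x2]; rewrite /flip /=.
exact: (comul_flip cH t (y1, y2) (x1, x2)).
Qed.

Lemma red_hbarD (k : fieldType) X (u w : X -> series k) : red (u + hbar \*o w) = red u.
Proof. by apply/funext => x; rewrite redE !fE series_addE hbar0 addr0. Qed.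

(** * The deformed product and bracket modulo hbar *)

Section DeformReduction.
Variables (k : fieldType) (E : Type) (F : bialg (series k) E) (bF : bialgebra F).
Variables (sigma sigma' : (E * E -> series k) -> series k).
Hypothesis sc : hopf_2cocycle F sigma sigma'.
Variable rho : (E * E -> series k) -> series k.
Hypothesis crho : cont_form rho.
Hypothesis srho : sigma = bcounit (bialg2 F) + hbar \*o rho.
Hypothesis comm : commutative_bialg (red_bialg F).

Hypothesis bG : bialgebra (red_bialg F).

Let F2 := btens F F.
Let bF2 : bialgebra F2 := bialgebra_btens bF bF.
Let cF : coalg F := bialg_coalg bF.
Let cF2 : coalg F2 := bialg_coalg bF2.
Let mF : cont_linear (bmul F) := bialg_mul bF.
Let dF : cont_linear (bcomul F) := coalg_comul cF.
Let eF : cont_form (bcounit F) := coalg_counit cF.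
Let dF2 : cont_linear (bcomul F2) := coalg_comul cF2.
Let eF2 : cont_form (bcounit F2) := coalg_counit cF2.
Let cs : cont_form sigma := coc_cont sc.
Let cs' : cont_form sigma' := coc_cont' sc.
Let Fs := cocycle_deform F sigma sigma'.
Let G0 := red_bialg F.

(* sigma' is eps + hbar rho_inv. *)
Definition rho_inv : (E * E -> series k) -> series k := fun t => - rho (rtrans F2 sigma' t).

Lemma cl_rtrans' : cont_linear (rtrans F2 sigma'). Proof. exact: cl_rtrans. Qed.
Let cra := cl_rtrans'.
Let crho_inv : cont_form rho_inv. Proof. by rewrite /rho_inv; cf. Qed.

Lemma sigmaE t : sigma t = bcounit F2 t + hbar * rho t.
Proof. by rewrite srho. Qed.

(** The equation sigma * sigma' = eps reads sigma' + hbar (rho * sigma') = eps. *)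
Lemma sigma'E t : sigma' t = bcounit F2 t + hbar * rho_inv t.
Proof.
have invr : conv F2 sigma sigma' t =
  bcounit F2 t by exact: (congr1 (fun f => f t) (coc_invr sc)).
move: invr; rewrite conv_rtrans sigmaE -[bcounit F2 (rtrans _ _ _)]conv_rtrans conv1l // => <-.
by rewrite /rho_inv mulrN addrK.
Qed.

Lemma ltransE t : ltrans F2 sigma t = t + hbar \*o ltrans F2 rho t.
Proof. by rewrite -{2}(ltrans1 cF2 t); apply/funext => y; exact: sigmaE. Qed.

Lemma rtransE t : rtrans F2 sigma' t = t + hbar \*o rtrans F2 rho_inv t.
Proof. by rewrite -{2}(rtrans1 cF2 t); apply/funext => y; exact: sigma'E. Qed.

(** The exact quotient by hbar of the difference of the two products, all orders included. On x (x)
    y it reduces to rho(x_(1), y_(1)) x_(2) y_(2) - x_(1) y_(1) rho(x_(2), y_(2)). *)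
Definition deform_term t := bmul F (ltrans F2 rho t + rtrans F2 rho_inv (ltrans F2 sigma t)).

Lemma bmul_deformE t : bmul Fs t = bmul F t + hbar \*o deform_term t.
Proof.
rewrite (bmul_deform bF sc) rtransE {1}ltransE -(clZ _ _ mF) -(clD _ _ mF); congr (bmul F _).
by apply/funext => e; rewrite !fE; ring.
Qed.

Lemma red_bialg_deform : red_bialg Fs = red_bialg F.
Proof.
congr Bialg; apply/funext => t; apply/funext => e.
have := congr1 (fun f => f e 0%N) (bmul_deformE (lift t)); rewrite /red_map redE => ->.
by rewrite fadE series_addE scE hbar0 addr0.
Qed.

(** The two products agree modulo hbar, so the antipode of F inverts the identity of the deformation
    modulo hbar, which is all that [antipode_lift] asks. *)
Lemma topological_hopf_deform : topological_hopf F -> topological_hopf Fs.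
Proof.
move=> hF; have bFs : bialgebra Fs by exact: bialgebra_deform sc.
have redm t : red (bmul Fs t) = red (bmul F t).
  by rewrite bmul_deformE red_hbarD.
have [S [cS SE]] := hopf_antipode hF.
have anti := @antipode_lift _ _ _ bFs S cS.
case: (bFs) => -[d e ca cl cr] m ma m1 m2 cm c1 cum cu1; split=> //.
by apply: anti => x; rewrite redm; congr red; [exact: (SE x).1|exact: (SE x).2].
Qed.

Lemma QFSHA_deform : QFSHA F -> QFSHA Fs.
Proof.
move=> [hF cF' aF]; split; first exact: topological_hopf_deform.
  by rewrite red_bialg_deform.
by rewrite red_bialg_deform.
Qed.

Lemma hbr_deform t : hbr Fs t = hbr F t + deform_term t - deform_term (flip t).
Proof.
have bFs : bialgebra Fs by exact: bialgebra_deform sc.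
have commFs : commutative_bialg (red_bialg Fs) by rewrite red_bialg_deform.
apply: hbar_sc_inj; rewrite -(hbrE bFs commFs) !bmul_deformE.
have -> : hbar \*o (hbr F t + deform_term t - deform_term (flip t)) =
   hbar \*o hbr F t + hbar \*o deform_term t - hbar \*o deform_term (flip t).
  by apply/funext => e; rewrite !fE mulrBr mulrDr.
rewrite -(hbrE bF comm).
by apply/funext => e; rewrite !fE; ring.
Qed.

Local Notation r0 := (red_form rho : (E * E -> discr k) -> discr k).

Lemma red_deform_term t : red (deform_term t) =
  bmul G0 (lform r0 (bcomul (btens G0 G0) (red t)) - rform r0 (bcomul (btens G0 G0) (red t))).
Proof.
have redD u : red (bcomul F2 u) = bcomul (btens G0 G0) (red u).
  transitivity (mid4 (red (tmap (bcomul F) (bcomul F) u) : _ -> discr k)) => //.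
  by rewrite red_tmap.
rewrite /deform_term (red_map_red _ mF) -[red_map (bmul F)]/(bmul G0) red_add.
congr (bmul G0 (_ + _)); first by rewrite red_lform // redD.
have ltrans_red u : red (ltrans F2 sigma u) = red u.
  by rewrite ltransE red_hbarD.
rewrite red_rform // redD ltrans_red; apply/funext => y; rewrite /rform.
rewrite /red_form /rho_inv.
have rr u : red (rtrans F2 sigma' u) = red u.
  by rewrite rtransE red_hbarD.
rewrite -[LHS]/(- (rho _ 0%N)) (red_form_red _ crho) rr //.
Qed.

(** By commutativity of the limit, flipping the argument of [deform_term] only flips the form, so
    the commutator sees the antisymmetrization of rho alone. *)
Lemma pbr_deform t : pbr (semiclassical Fs) t =
  pbr (semiclassical F) t +
  (bmul G0 (lform (r0 - flip_form r0) (bcomul (btens G0 G0) t))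
   - bmul G0 (rform (r0 - flip_form r0) (bcomul (btens G0 G0) t))).
Proof.
have mG : cont_linear (bmul G0) by exact: cl_red_map.
have dG : cont_linear (bcomul G0) by exact: cl_red_map.
have cG : coalg G0 by exact: bialg_coalg.
have bflip u : bmul G0 (flip u) = bmul G0 u.
  move: u; apply: cl_ext => [||x y]; [by cf|by []|].
  by rewrite flip_tens; exact: comm.
transitivity (red (hbr Fs (lift t))) => //.
rewrite hbr_deform.
transitivity (red (hbr F (lift t)) + red (deform_term (lift t)) - red (deform_term (flip
  (lift t)))) => //.
rewrite !red_deform_term -addrA; congr (_ + _).
have -> : red (flip (lift t)) = flip t by [].
rewrite red_lift lform_comul_flip // rform_comul_flip //.
have -> : lform (r0 - flip_form r0) (bcomul (btens G0 G0) t) =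
  lform r0 (bcomul (btens G0 G0) t) - lform (flip_form r0) (bcomul (btens G0 G0) t) by [].
have -> : rform (r0 - flip_form r0) (bcomul (btens G0 G0) t) =
  rform r0 (bcomul (btens G0 G0) t) - rform (flip_form r0) (bcomul (btens G0 G0) t) by [].
rewrite !(clB _ _ mG) !bflip.
by apply/funext => e; rewrite !fE; ring.
Qed.

End DeformReduction.

(** * The form hbar^-1 log(sigma) *)

Section Flip.
Variables (k : fieldType) (E : Type) (F : bialg (series k) E) (bF : bialgebra F).
Let F2 := btens F F.
Let bF2 : bialgebra F2 := bialgebra_btens bF bF.
Let eF : cont_form (bcounit F) := coalg_counit bF.
Let eF2 : cont_form (bcounit F2) := coalg_counit bF2.
Local Notation fl := (@flip (series k) E E).
Let cfl : cont_linear fl := @cl_flip _ (series_adic k) E E.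

(** The flip, being an automorphism of F (x) F, acts on the convolution algebra by automorphisms
    that fix hbar; so it commutes with the exponential, as part (a) requires. *)
Lemma comorph_flip : comorph F2 F2 fl.
Proof.
split=> // [t|t].
  by apply/funext => -[p q]; rewrite (comul_flip (bialg_coalg bF)).
move: t; apply: cf_ext => [||x y]; [by cf|by []|].
by rewrite flip_tens /= !tform_tens // mulrC.
Qed.

Lemma flip_mulb x y : fl (mulb F2 x y) = mulb F2 (fl x) (fl y).
Proof.
have mF2 := bialg_mul bF2.
move: x; apply: cl_ext => [||a b]; [by cf|by cf|].
move: y; apply: cl_ext => [||c d]; [by cf|by cf|].
by rewrite mulb_btens // !flip_tens mulb_btens.
Qed.

Lemma flip_ideal_pow n x : ideal_pow F2 (quantum_ideal F2) n x ->
  ideal_pow F2 (quantum_ideal F2) n (fl x).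
Proof.
elim: n x => // n IH x.
apply: (closed_span_map (f := fl) (V := ideal_pow F2 (quantum_ideal F2) n.+1)) => //.
- exact: submodule_span.
- exact: closed_closed_span.
move=> _ [u [v [[y [z [z0 ->]]] Iv ->]]]; rewrite flip_mulb; apply: sub_closed_span.
exists (fl (hbar \*o y + z)), (fl v); split=> //; last exact: IH.
exists (fl y), (fl z); split=> //.
by rewrite (comorph_counit comorph_flip).
Qed.

Lemma dual_flip phi : dual F2 phi -> dual F2 (flip_form phi).
Proof.
move=> [cp dp]; split; first exact: cf_flip_form.
by move=> n; have [N NP] := dp n; exists N => x Ix; apply: NP; exact: flip_ideal_pow.
Qed.

Local Notation A := (dform bF2).

Definition dflip (a : A) : A := mk_dform bF2 (dual_flip (dformP a)).

Lemma dflipD a b : dflip (a + b) = dflip a + dflip b.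
Proof. by apply: dform_eq. Qed.

Lemma dflipZ (c : k) a : dflip (c *: a) = c *: dflip a.
Proof. by apply: dform_eq. Qed.

Lemma dflipB a b : dflip (a - b) = dflip a - dflip b.
Proof. by apply: dform_eq. Qed.

Lemma dflipM a b : dflip (a * b) = dflip a * dflip b.
Proof.
apply: dform_eq; rewrite /=.
exact: (conv_morph (comorph_cl comorph_flip) (comorph_comul comorph_flip) (dform_cont a)
  (dform_cont b)).
Qed.

Lemma dflip1 : dflip 1 = 1.
Proof. by apply: dform_eq; apply/funext => t; exact: (comorph_counit comorph_flip). Qed.

Lemma dflipX a n : dflip (a ^+ n) = dflip a ^+ n.
Proof. by elim: n => [|n IH]; rewrite ?expr0 ?dflip1 // !exprS dflipM IH. Qed.

Lemma dflip_hbar : dflip (dhbar bF2) = dhbar bF2.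
Proof.
apply: dform_eq; apply/funext => t; rewrite /= /flip_form.
by congr (_ * _); exact: (comorph_counit comorph_flip).
Qed.

Lemma dflip_sum n (f : 'I_n -> A) : dflip (\sum_i f i) = \sum_i dflip (f i).
Proof.
elim/big_rec2: _ => [|i x y _ <-]; last exact: dflipD.
by apply: dform_eq.
Qed.

Lemma expsum_flip x s : expsum (dhbar bF2) (dhbar bF2 * x) s ->
  expsum (dhbar bF2) (dhbar bF2 * dflip x) (dflip s).
Proof.
move=> xs n; have [N NP] := xs n; exists N => M /NP[b sb]; exists (dflip b).
have := congr1 dflip sb; rewrite dflipB dflipM dflipX dflip_hbar => <-.
rewrite dflip_sum; congr (_ - _); apply: eq_bigr => i _.
by rewrite dflipZ dflipX dflipM dflip_hbar.
Qed.

End Flip.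

Section ConvExpLog.
Variables (k : fieldType) (char0 : [pchar k] =i pred0).
Variables (E : Type) (F : bialg (series k) E) (bF : bialgebra F).
Variables (sigma sigma' : (E * E -> series k) -> series k).
Hypothesis sc : hopf_2cocycle F sigma sigma'.
Variable rho : (E * E -> series k) -> series k.
Hypothesis drho : dual (bialg2 F) rho.
Hypothesis srho : sigma = bcounit (bialg2 F) + hbar \*o rho.
Let bF2 : bialgebra (btens F F) := bialgebra_btens bF bF.
Let hA := dform_hcomplete bF2.

Lemma conv_pow_val (a : dform bF2) n : conv_pow (bialg2 F) (val a) n = val (a ^+ n).
Proof. by elim: n => // n IH; rewrite exprS [RHS]/= -IH. Qed.

Lemma hmul_val n (a : dform bF2) : hmul (dhbar bF2) n a ->
  exists2 r, dual (bialg2 F) r & val a = hbar ^+ n \*o r.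
Proof. by move=> [b ->]; exists (val b); [exact: dformP|rewrite dhbarXE]. Qed.

Lemma conv_log_exp : exists vs : (E * E -> series k) -> series k,
  [/\ dual (bialg2 F) vs, is_conv_log (bialg2 F) sigma (hbar \*o vs),
      is_conv_exp (bialg2 F) (hbar \*o vs) sigma,
      (flip_form vs = - vs <-> flip_form sigma = sigma') &
      exists2 w, dual (bialg2 F) w & vs = rho + hbar \*o w].
Proof.
pose x : dform bF2 := mk_dform bF2 drho.
have [v [v1 vlog vexp]] := exp_log_exists char0 hA x.
have valx : sigma - bcounit (bialg2 F) = val (dhbar bF2 * x).
  by rewrite dhbarE srho addrC addKr.
have vals : val (1 + dhbar bF2 * x) = sigma.
  by rewrite dform_addE dhbarE srho.
exists (val v); split.
- exact: dformP.
- move=> n; exists n => M nM.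
  have [|r dr E1] := @hmul_val n (dhbar bF2 * v - \sum_(i < M) ((-1) ^+ i / i.+1%:R) *:
    (dhbar bF2 * x) ^+ i.+1).
    by apply: (@hmul_le _ _ _ M.+1); [exact: leq_trans nM _|exact: vlog].
  exists r => //; rewrite -E1 -dhbarE valx dform_addE; congr (_ + _).
  rewrite [RHS](_ : _ = - val (\sum_(i < M) ((-1) ^+ i / i.+1%:R) *: (dhbar bF2 * x) ^+
    i.+1)); last first.
    by apply/funext => t; rewrite -[LHS]/(-1 * _) mulN1r.
  congr (- _); rewrite dform_sumE; apply: eq_bigr => i _.
  by rewrite conv_pow_val.
- move=> n; have [N NP] := vexp n; exists N => M /NP /hmul_val[r dr E1].
  exists r => //; rewrite -E1 dform_addE vals; congr (_ + _).
  rewrite [RHS](_ : _ = - val (\sum_(i < M) (i`!%:R^-1 : k) *: (dhbar bF2 * v) ^+ i));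
    last first.
    by apply/funext => t; rewrite -[LHS]/(-1 * _) mulN1r.
  congr (- _); rewrite dform_sumE; apply: eq_bigr => i _.
  rewrite -dhbarE; exact: (congr1 (fun u => seriesC (i`!%:R^-1 : k) \*o u) (conv_pow_val
    (dhbar bF2 * v) i)).
- pose s := 1 + dhbar bF2 * x; pose s' : dform bF2 := mk_dform bF2 (coc_dual_inv sc).
  have ss' : s * s' = 1 by apply: dform_eq; rewrite [LHS]/= -[X in conv _ X _]/(val s) vals;
    exact: coc_invr sc.
  have s's : s' * s = 1 by apply: dform_eq; rewrite [LHS]/= -[X in conv _ _ X]/(val s) vals;
    exact: coc_invl sc.
  have uniq e : s * e = 1 -> e = s'.
    by move=> se; rewrite -[e]mul1r -s's -mulrA se mulr1.
  have fexp := expsum_flip vexp.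
  have valN (a : dform bF2) : val (- a) = - val a.
    by apply/funext => t; rewrite -[LHS]/(-1 * _) mulN1r.
  (* If v_{2,1} = - v, then sigma_{2,1} = exp(- hbar v) is inverse to sigma. Conversely sigma' is
     both exp(hbar v_{2,1}) and exp(- hbar v), and injectivity applies. *)
  split=> [vN|sN].
    have vN' : dflip v = - v by apply: dform_eq; rewrite valN.
    have := uniq (dflip s) (exp_mulN1 char0 hA vexp _); rewrite -vN' => /(_ fexp) /(congr1 val).
    by rewrite /= -[X in flip_form X = _]/(val s) vals.
  have sN' : dflip s = s' by apply: dform_eq; rewrite /= -[X in flip_form X = _]/(val s) vals.
  have [e eexp] := exp_exists hA (- v).
  have es' := uniq e (exp_mulN1 char0 hA vexp eexp).
  move: fexp; rewrite -/s sN' -es' => fexp.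
  by have /(congr1 val) := exp_inj hA fexp eexp; rewrite valN.
have [w dw E1] := hmul_val v1; exists w => //.
rewrite expr1 in E1; rewrite -E1; apply/funext => t.
by rewrite -[RHS]/(rho t + (val v t + -1 * rho t)) mulN1r addrC subrK.
Qed.

End ConvExpLog.

(** * The cotangent space *)

Section Cotangent.
Variables (k : fieldType) (E B : Type).
Local Notation D := (discr k).
Variables (G : poisson_bialg D E) (fG : formal_poisson_group G).
Variables (pi : (E -> D) -> B -> D) (L : lie_data D B).
Hypothesis cot : cotangent_lie_bialgebra G pi L.

Lemma fpg_bialgebra : bialgebra G. Proof. exact: hopf_bialgebra (fpg_hopf fG). Qed.
Let bG := fpg_bialgebra.
Let cG : coalg G := bialg_coalg bG.
Let mG : cont_linear (bmul G) := bialg_mul bG.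
Let dG : cont_linear (bcomul G) := coalg_comul cG.
Let eG : cont_form (bcounit G) := coalg_counit cG.
Let cpi : cont_linear pi := cot_cont cot.
Let cpbr : cont_linear (pbr G) := fpg_pbr_cont fG.
Let cbr : cont_linear (lbr L) := lb_br_cont (cot_lie cot).
Let ccobr : cont_linear (lcobr L) := lb_cobr_cont (cot_lie cot).

Definition aug (x : E -> D) : E -> D := x - bcounit G x \*o bone G.

Lemma aug_in x : aug_ideal G (aug x).
Proof.
rewrite /aug_ideal /= /aug (linB _ _ (cf_lin eG)) (linZ _ _ (cf_lin eG)).
by rewrite bialg_counit1 // mulr1 subrr.
Qed.

Lemma pi_aug x : pi (aug x) = pi x.
Proof.
rewrite /aug (clB _ _ cpi) (clZ _ _ cpi) (cot_one cot).
by apply/funext => b; rewrite !fE mulr0 subr0.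
Qed.

Lemma mulb_aug x y : aug_ideal G x -> aug_ideal G y -> aug_ideal G (mulb G x y).
Proof. by rewrite /aug_ideal /= => x0 y0; rewrite bialg_counitM // x0 mul0r. Qed.

Lemma pi_mulb_aug x y : aug_ideal G x -> aug_ideal G y -> pi (mulb G x y) = 0.
Proof.
move=> x0 y0; apply/(cot_ker cot); first exact: mulb_aug.
apply: sub_closed_span; exists x, y; split=> //.
(* The first power of m is by definition the closed span of products of m with the whole algebra, so
   y is written as y times 1. *)
by apply: sub_closed_span; exists y, (bone G); split=> //; rewrite bialg_mul1r.
Qed.

Lemma mulb_augE x y : mulb G x y =
  mulb G (aug x) (aug y) + bcounit G x \*o y + bcounit G y \*o x
    - (bcounit G x * bcounit G y) \*o bone G.
Proof.
have r z : cont_linear (fun x => mulb G x z) by exact: cl_mulbr.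
have l z : cont_linear (mulb G z) by exact: cl_mulbl.
rewrite /aug (clB _ _ (r _)) (clZ _ _ (r _)) bialg_mul1l // (clB _ _ (l _)) (clZ _ _ (l _)).
by rewrite bialg_mul1r //; apply/funext => e; rewrite !fE; ring.
Qed.

(** Once constants are split off, the remaining product lies in m^2; thus [pi] is a derivation over
    eps. *)
Lemma pi_mulb x y : pi (mulb G x y) = bcounit G x \*o pi y + bcounit G y \*o pi x.
Proof.
rewrite mulb_augE (clB _ _ cpi) !(clD _ _ cpi) !(clZ _ _ cpi) (cot_one cot).
rewrite pi_mulb_aug; [|exact: aug_in..].
by apply/funext => b; rewrite !fE mulr0 subr0 add0r.
Qed.

Definition pib b : (E -> D) -> D := fun x => pi x b.
Lemma cf_pib b : cont_form (pib b). Proof. exact: cl_form. Qed.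

Lemma pi_bmul t b : pi (bmul G t) b = tform (bcounit G) (pib b) t + tform (pib b) (bcounit G) t.
Proof.
have cb := cf_pib b.
move: t; apply: cf_ext => [||x y]; [by cf|by cf|].
by rewrite -[bmul G _]/(mulb G x y) pi_mulb !tform_tens // !fE /pib [X in _ + X]mulrC.
Qed.

Lemma poisson_one x : poisson G x (bone G) = 0.
Proof.
have := fpg_leibniz fG x (bone G) (bone G).
rewrite (bialg_mul1l bG) (bialg_mul1r bG) (bialg_mul1l bG) => /eqP.
by rewrite -subr_eq0 opprD addNKr oppr_eq0 => /eqP.
Qed.

(** Constants are Casimirs. This lets [brk_pi] hold for all x and y, not only for those in m. *)
Lemma poisson_aug x y : poisson G (aug x) (aug y) = poisson G x y.
Proof.
have cl z : cont_linear (poisson G z) by rewrite /poisson; cf.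
have s z y' : poisson G z (aug y') = poisson G z y'.
  rewrite /aug (clB _ _ (cl z)) (clZ _ _ (cl z)) poisson_one.
  by apply/funext => e; rewrite !fE mulr0 subr0.
by rewrite s (fpg_anti fG) s (fpg_anti fG y) opprK.
Qed.

Lemma brk_pi x y : brk L (pi x) (pi y) = pi (poisson G x y).
Proof.
rewrite -(pi_aug x) -(pi_aug y) (cot_br cot) ?poisson_aug //; exact: aug_in.
Qed.

Lemma pi_surj v : exists x, pi x = v.
Proof. by have [x _ <-] := cot_surj cot v; exists x. Qed.

Lemma lcobr_pi x : lcobr L (pi x) = tmap pi pi (bcomul G x - flip (bcomul G x)).
Proof.
rewrite -(pi_aug x) (cot_cobr cot (aug_in x)).
have ct : cont_linear (tmap pi pi) by exact: cl_tmap.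
have cf' := @cl_flip _ (discr_adic k) E E.
rewrite /aug (clB _ _ dG) (clZ _ _ dG) bialg_comul1 // (clB _ _ cf') (clZ _ _ cf') flip_tens.
congr (tmap _ _ _); apply/funext => -[a b]; rewrite !fE; ring.
Qed.

End Cotangent.

Section Zeta.
Variables (k : fieldType) (E B : Type).
Local Notation D := (discr k).
Variables (G : poisson_bialg D E) (fG : formal_poisson_group G).
Variables (pi : (E -> D) -> B -> D) (L : lie_data D B).
Hypothesis cot : cotangent_lie_bialgebra G pi L.
Variable z : (E * E -> D) -> D.
Hypothesis cz : cont_form z.
Hypothesis z_anti : forall t, z (flip t) = - z t.
Hypothesis z_der : forall a b c,
  z (tens (mulb G a b) c) = bcounit G a * z (tens b c) + bcounit G b * z (tens a c).

Let bG : bialgebra G := fpg_bialgebra fG.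
Let cG : coalg G := bialg_coalg bG.
Let mG : cont_linear (bmul G) := bialg_mul bG.
Let dG : cont_linear (bcomul G) := coalg_comul cG.
Let eG : cont_form (bcounit G) := coalg_counit cG.
Let cpi : cont_linear pi := cot_cont cot.
Let czl y : cont_form (fun x => z (tens x y)). Proof. by cf. Qed.
Let czr x : cont_form (fun y => z (tens x y)). Proof. by cf. Qed.

Lemma z_tensC x y : z (tens x y) = - z (tens y x).
Proof. by rewrite -z_anti flip_tens. Qed.

Lemma z_one y : z (tens (bone G) y) = 0.
Proof.
have := z_der (bone G) (bone G) y; rewrite bialg_mul1l // bialg_counit1 // !mul1r => /eqP.
by rewrite -subr_eq0 opprD addNKr oppr_eq0 => /eqP.
Qed.

Lemma z_aug x y : z (tens (aug G x) y) = z (tens x y).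
Proof.
rewrite /aug; have /= -> := linB x (bcounit G x \*o bone G) (cf_lin (czl y)).
by have /= -> := linZ (bcounit G x) (bone G) (cf_lin (czl y)); rewrite z_one mulr0 subr0.
Qed.

(** By the derivation rule z(-, y) vanishes on products of two elements of m, and by continuity on
    their closed span. *)
Lemma z_ker x y : pi x = 0 -> z (tens x y) = 0.
Proof.
move=> x0; rewrite -z_aug.
have : ideal_pow G (aug_ideal G) 2 (aug G x).
  by apply/(cot_ker cot); [exact: (aug_in fG)|rewrite (pi_aug cot)].
apply: (@closed_span_form _ (discr_adic k) _ (fun u => z (tens u y)) 0%N) => //.
move=> _ [a [b [a0 b1 ->]]] /=.
have b0 : bcounit G b = 0.
  move: b b1; apply: (@closed_span_form _ (discr_adic k) _ (bcounit G) 0%N) => //.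
  by move=> _ [u [v [u0 _ ->]]] /=; rewrite bialg_counitM // u0 mul0r.
by rewrite z_der a0 b0 !mul0r addr0.
Qed.

Definition pi_lift (v : B -> D) : E -> D := sval (cid (pi_surj cot v)).
Lemma pi_liftK v : pi (pi_lift v) = v. Proof. exact: (svalP (cid (pi_surj cot v))). Qed.

Definition factor y (v : B -> D) : D := z (tens (pi_lift v) y).

Lemma z_eq x x' y : pi x = pi x' -> z (tens x y) = z (tens x' y).
Proof.
move=> xx'; apply/eqP; rewrite -subr_eq0; apply/eqP.
have /= <- := linB x x' (cf_lin (czl y)).
by apply: z_ker; rewrite (clB _ _ cpi) xx' subrr.
Qed.

Lemma factor_pi y x : factor y (pi x) = z (tens x y).
Proof. by apply: z_eq; rewrite pi_liftK. Qed.

(** [pi_lift] is a mere choice of preimages: linearity comes from independence of that choice,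
    continuity from the quotient topology of m/m^2. *)
Lemma cf_factor y : cont_form (factor y).
Proof.
split.
  move=> a u v; rewrite -{1}(pi_liftK u) -{1}(pi_liftK v) -cpi.1 factor_pi.
  exact: (cf_lin (czl y)).
apply/continuousP => V oV; apply/(cot_quot cot).
have -> : pi @^-1` (factor y @^-1` V) = (fun x => z (tens x y)) @^-1` V.
  by apply/funext => x; rewrite /preimage /= factor_pi.
by have [_ /continuousP] := czl y; apply.
Qed.

(** Continuity of z leaves finitely many basis vectors [dlt e] in the second argument; for each, the
    factor of z(-, dlt e) through [pi] depends on finitely many coordinates. Their union serves all
    y at once. *)
Lemma z_finite : exists s : seq B, forall x y,
  (forall b, List.In b s -> pi x b = 0) -> z (tens x y) = 0.
Proof.
(* Over the discrete field every ideal [adJ n] is 0, so the index 0 stands for exact vanishing. *)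
have [S SP] := cf_small 0%N cz.
have [s sP] : exists s : seq B, forall p, List.In p S -> forall v,
    (forall b, List.In b s -> v b = 0) -> factor (dlt p.2) v = 0.
  elim: S {SP} => [|p S [s sP]]; first by exists [::].
  have [s' s'P] := cf_small 0%N (cf_factor (dlt p.2)).
  exists (s' ++ s) => q [<-|qS] v v0.
    by apply: s'P => b bs; apply: v0; apply/List.in_app_iff; left.
  by apply: (sP q qS) => b bs; apply: v0; apply/List.in_app_iff; right.
exists s => x y x0; move: y.
apply: (cf_ext_dlt (czr x) (@cf_zero _ (discr_adic k) E)) => e.
have [[p [pS pe]]|nS] := pselect (exists p, List.In p S /\ p.2 = e).
  by rewrite -factor_pi -pe; exact: (sP p pS).
apply: SP => -[e1 e2] pS /=; rewrite /tens /dlt /=.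
case: asboolP => [e2E|_]; last by rewrite mulr0.
by case: nS; exists (e1, e2).
Qed.

(* A section of [pi] on finitely many coordinates: an infinite sum of lifts of basis
   vectors need not converge. *)
Fixpoint finite_section (s : seq B) (v : B -> D) : E -> D :=
  if s is b :: s' then v b \*o pi_lift (dlt b) + finite_section s' (zero_at b v) else 0.

Lemma cl_finite_section s : cont_linear (finite_section s).
Proof.
elim: s => [|b s IH]; first by change (cont_linear (fun (_ : B -> D) (_ : E) => 0 : D)); cf.
have cu : cont_linear (zero_at b : (B -> D) -> B -> D).
  apply/cont_linearP => c; rewrite /zero_at; case: asboolP => _;
    [exact: cf_zero|exact: cf_coord].
by rewrite /=; cf.
Qed.

Lemma pi_finite_section s v c : pi (finite_section s v) c =
  if `[< List.In c s >] then v c else 0.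
Proof.
elim: s v => [|b s IH] v /=; first by rewrite (cl0 cpi); case: asboolP.
rewrite (clD _ _ cpi) (clZ _ _ cpi) pi_liftK !fE IH /dlt /zero_at.
have [->|nbc] := pselect (b = c).
  have -> : `[< c = c >] by apply/asboolP.
  have -> : `[< c = c \/ List.In c s >] by apply/asboolP; left.
  by rewrite mulr1; case: ifP; rewrite addr0.
have -> : `[< b = c >] = false by apply/asboolP.
have -> : `[< b = c \/ List.In c s >] = `[< List.In c s >].
  by apply/asboolP/asboolP; tauto.
by rewrite mulr0 add0r.
Qed.

(** Pulling z back along a finite section is visibly continuous. The section may replace x in z(x,
    y) because the difference has zero coordinates on s, and antisymmetry gives the same for y. *)
Lemma zeta_exists : exists zeta : (B * B -> D) -> D, cont_form zeta /\
  forall x y, zeta (tens (pi x) (pi y)) = z (tens x y).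
Proof.
have [s sP] := z_finite; have cs := cl_finite_section s.
exists (fun t => z (tmap (finite_section s) (finite_section s) t)); split; first by cf.
have pl x y : z (tens (finite_section s (pi x)) y) = z (tens x y).
  apply/eqP; rewrite -subr_eq0; apply/eqP.
  have /= <- := linB (finite_section s (pi x)) x (cf_lin (czl y)).
  apply: sP => b bs; rewrite (clB _ _ cpi) !fE pi_finite_section.
  have -> : `[< List.In b s >] by apply/asboolP.
  by rewrite subrr.
by move=> x y; rewrite tmap_tens // pl z_tensC pl -z_tensC.
Qed.

End Zeta.

(** * The cocycle identity at first order *)

(* The alternating sum of the cocycle identity over the permutations, in the order
   abc, bca, cab, bac, acb, cba, of its arguments; see [zform_cyb]. *)
Lemma alternate_sum (S : comNzRingType) (h P1 P2 P3 P4 P5 P6 Q1 Q2 Q3 Q4 Q5 Q6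
    k1 k2 k3 k4 k5 k6 l1 l2 l3 l4 l5 l6 p1 p2 p3 q1 q2 q3 : S) :
  P1 + h * k1 = Q1 + h * l1 -> P2 + h * k2 = Q2 + h * l2 -> P3 + h * k3 = Q3 + h * l3 ->
  P4 + h * k4 = Q4 + h * l4 -> P5 + h * k5 = Q5 + h * l5 -> P6 + h * k6 = Q6 + h * l6 ->
  P1 - P4 = h * p1 -> P2 - P6 = h * p2 -> P3 - P5 = h * p3 ->
  Q1 - Q5 = h * q1 -> Q2 - Q4 = h * q2 -> Q3 - Q6 = h * q3 ->
  h * (p1 + p2 + p3 - (q1 + q2 + q3) + ((k1 - k4) + (k2 - k6) + (k3 - k5))
       - ((l1 - l5) + (l2 - l4) + (l3 - l6))) = 0.
Proof.
move=> e1 e2 e3 e4 e5 e6 d1 d2 d3 f1 f2 f3.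
transitivity (h * p1 + h * p2 + h * p3 - (h * q1 + h * q2 + h * q3)
  + h * ((k1 - k4) + (k2 - k6) + (k3 - k5)) - h * ((l1 - l5) + (l2 - l4) + (l3 - l6))).
  by ring.
rewrite -d1 -d2 -d3 -f1 -f2 -f3.
transitivity ((P1 + h * k1 - (Q1 + h * l1)) + (P2 + h * k2 - (Q2 + h * l2))
  + (P3 + h * k3 - (Q3 + h * l3)) - (P4 + h * k4 - (Q4 + h * l4))
  - (P5 + h * k5 - (Q5 + h * l5)) - (P6 + h * k6 - (Q6 + h * l6))); first by ring.
by rewrite e1 e2 e3 e4 e5 e6 !subrr !addr0 !subr0.
Qed.

(** The Hochschild identity at (a, b, c), (c, a, b) and (a, c, b), with r1 = r(ab, c), r2 = r(a,
    bc), r3 = r(ac, b), r4 = r(c, ab); commutativity is what makes the equations share these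
    values. *)
Lemma hochschild_alternate (S : comNzRingType) (ea eb ec rbc rac rab rcb rca r1 r2 r3 r4 : S) :
  r1 + rab * ec = r2 + rbc * ea ->
  r3 + rca * eb = r4 + rab * ec ->
  r3 + rac * eb = r2 + rcb * ea ->
  r1 - r4 = ea * (rbc - rcb) + eb * (rac - rca).
Proof.
move=> e1 e2 e3.
transitivity ((r1 + rab * ec) - (r4 + rab * ec)); first by ring.
rewrite e1 -e2.
transitivity (r2 + rbc * ea - (r3 + rac * eb) + rac * eb - rca * eb); first by ring.
by rewrite e3; ring.
Qed.

Section FirstOrder.
Variables (k : fieldType) (E : Type) (F : bialg (series k) E) (bF : bialgebra F).
Variables (sigma sigma' : (E * E -> series k) -> series k).
Hypothesis sc : hopf_2cocycle F sigma sigma'.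
Variable rho : (E * E -> series k) -> series k.
Hypothesis crho : cont_form rho.
Hypothesis srho : sigma = bcounit (bialg2 F) + hbar \*o rho.
Hypothesis comm : commutative_bialg (red_bialg F).
Hypothesis bG : bialgebra (red_bialg F).

Let F2 := btens F F.
Let bF2 : bialgebra F2 := bialgebra_btens bF bF.
Let cF : coalg F := bialg_coalg bF.
Let cF2 : coalg F2 := bialg_coalg bF2.
Let mF : cont_linear (bmul F) := bialg_mul bF.
Let dF : cont_linear (bcomul F) := coalg_comul cF.
Let eF : cont_form (bcounit F) := coalg_counit cF.
Let dF2 : cont_linear (bcomul F2) := coalg_comul cF2.
Let eF2 : cont_form (bcounit F2) := coalg_counit cF2.
Let cs : cont_form sigma := coc_cont sc.
Let sE := sigmaE srho.
Let cla : cont_linear (ltrans F2 rho) := cl_ltrans cF2 crho.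

(* The cocycle identity, with eps + hbar rho for sigma, divided by hbar. *)
Lemma coc_expand a b c :
  rho (tens (mulb F a b) c) + rho (tens a b) * bcounit F c
    + hbar * rho (tens (bmul F (ltrans F2 rho (tens a b))) c) =
  rho (tens a (mulb F b c)) + rho (tens b c) * bcounit F a
    + hbar * rho (tens a (bmul F (ltrans F2 rho (tens b c)))).
Proof.
have := coc_eq sc a b c.
rewrite tformC //; last by cf.
rewrite [X in _ = X -> _]tformC //; last by cf.
rewrite -[lform sigma _]/(ltrans F2 sigma (tens a b)) -[lform sigma _]/(ltrans F2 sigma (tens
  b c)).
have ltransD t : ltrans F2 sigma t = t + hbar \*o ltrans F2 rho t := ltransE bF srho t.
rewrite !ltransD !(clD _ _ mF) !(clZ _ _ mF) !sE.
have L1 u v w : rho (tens (u + hbar \*o v) w) = rho (tens u w) + hbar * rho (tens v w).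
  have cl : cont_form (fun u => rho (tens u w)) by cf.
  by have /= -> := linD u (hbar \*o v) (cf_lin cl); have /= -> := linZ hbar v (cf_lin cl).
have L2 u v w : rho (tens w (u + hbar \*o v)) = rho (tens w u) + hbar * rho (tens w v).
  have cl : cont_form (fun u => rho (tens w u)) by cf.
  by have /= -> := linD u (hbar \*o v) (cf_lin cl); have /= -> := linZ hbar v (cf_lin cl).
have cm u v : bcounit F (bmul F u + hbar \*o bmul F v) = bcounit F2 u + hbar * bcounit F2 v.
  by rewrite (linD _ _ (cf_lin eF)) (linZ _ _ (cf_lin eF)) !(counit_bmul bF).
have e2 t : bcounit F2 (ltrans F2 rho t) = rho t.
  by rewrite -conv_ltrans // conv1r.
have tE u v : bcounit F2 (tens u v) = bcounit F u * bcounit F v by rewrite /= tform_tens.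
rewrite -/F2 !tE L1 L2 !cm !e2 !tE => H.
apply: hbar_inj; apply: (addrI (bcounit F a * bcounit F b * bcounit F c)).
rewrite -[bmul F (tens a b)]/(mulb F a b) -[bmul F (tens b c)]/(mulb F b c) in H.
transitivity ((bcounit F a * bcounit F b + hbar * rho (tens a b)) * bcounit F c +
  hbar * (rho (tens (mulb F a b) c) + hbar * rho (tens (bmul F (ltrans F2 rho (tens a b))) c))).
  by ring.
rewrite H; ring.
Qed.

Local Notation G0 := (red_bialg F).
Local Notation G := (semiclassical F).
Let D := discr k.
Local Notation r0 := (red_form rho : (E * E -> discr k) -> discr k).
Definition zform : (E * E -> discr k) -> discr k := r0 - flip_form r0.
Let cr0 : cont_form r0 := cf_red_form crho.

Lemma zformE t : zform t = r0 t - r0 (flip t). Proof. by []. Qed.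

Lemma cf_zform : cont_form zform.
Proof. by change (cont_form (fun t => r0 t - r0 (flip t))); cf. Qed.

Lemma zform_tens u v : zform (tens u v) = r0 (tens u v) - r0 (tens v u).
Proof. by rewrite zformE flip_tens. Qed.

Lemma zform_anti t : zform (flip t) = - zform t.
Proof.
rewrite !zformE opprB; congr (_ - r0 _).
by apply/funext => -[x y].
Qed.

Lemma hochschild a b c : r0 (tens (mulb G0 a b) c) + r0 (tens a b) * bcounit G0 c =
  r0 (tens a (mulb G0 b c)) + r0 (tens b c) * bcounit G0 a.
Proof.
have := congr1 (fun f : series k => f 0%N) (coc_expand (lift a) (lift b) (lift c)).
rewrite !series_addE !hbar0 !addr0 !series_mul0E !(red_form_red _ crho) !red_tens.
by rewrite !red_mulb // !(red_form_red _ eF).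
Qed.

Lemma zform_der a b c : zform (tens (mulb G0 a b) c) =
  bcounit G0 a * zform (tens b c) + bcounit G0 b * zform (tens a c).
Proof.
rewrite !zform_tens.
apply: (@hochschild_alternate D _ _ (bcounit G0 c) _ _ (r0 (tens a b)) _ _ _
  (r0 (tens a (mulb G0 b c))) (r0 (tens (mulb G0 a c) b))).
- exact: hochschild.
- by rewrite (comm a c); exact: hochschild.
- by rewrite (comm b c); exact: hochschild.
Qed.

(** On x (x) y this is z(x_(1), y_(1)) x_(2) y_(2), the source of the quadratic terms [[z, z]]. *)
Definition twist (z : (E * E -> discr k) -> discr k) (t : E * E -> discr k) : E -> discr k :=
  bmul G0 (lform z (bcomul (btens G0 G0) t)).

Lemma red_twist t : red (bmul F (ltrans F2 rho t)) = twist r0 (red t).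
Proof.
rewrite (red_map_red _ mF) /twist; congr (bmul G0 _).
rewrite red_lform //; congr lform.
transitivity (mid4 (red (tmap (bcomul F) (bcomul F) t) : _ -> discr k)) => //.
by rewrite red_tmap.
Qed.

Lemma twist_alternate x y : twist r0 (tens x y) - twist r0 (tens y x) = twist zform (tens x y).
Proof.
have mG := bialg_mul bG.
have bflip u : bmul G0 (flip u) = bmul G0 u.
  move: u; apply: cl_ext => [||a b]; [by cf|by []|].
  by rewrite flip_tens; exact: comm.
rewrite -[in X in _ - X]flip_tens /twist (lform_comul_flip (bialg_coalg bG)) bflip.
by rewrite -(clB _ _ mG).
Qed.

(** On arguments of counit 0 the products of rho with eps disappear from [coc_expand]. The leading
    terms of the alternating sum then pair off into commutators, so hbar divides the sum once
    more. *)
Lemma zform_cyb x y w : bcounit G0 x = 0 -> bcounit G0 y = 0 -> bcounit G0 w = 0 ->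
  zform (tens (poisson G x y) w) + zform (tens (poisson G y w) x) + zform (tens (poisson G w
    x) y)
  + (zform (tens (twist zform (tens x y)) w) + zform (tens (twist zform (tens y w)) x)
     + zform (tens (twist zform (tens w x)) y)) = 0.
Proof.
move=> x0 y0 w0.
(* The constant lift of an element of m has counit 0 only modulo hbar. Subtracting its counit makes
   the terms with eps vanish exactly. *)
pose lf (u : E -> discr k) := lift u - bcounit F (lift u) \*o bone F.
have lfE u : bcounit F (lf u) = 0.
  by rewrite /lf (linB _ _ (cf_lin eF)) (linZ _ _ (cf_lin eF)) bialg_counit1 // mulr1 subrr.
have lfr u : bcounit G0 u = 0 -> red (lf u) = u.
  move=> u0; rewrite /lf red_add red_opp red_scale.
  have -> : bcounit F (lift u) 0%N = (0 : discr k) by exact: u0.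
  apply/funext => e; rewrite -[LHS]/(u e - 0 * red (bone F) e).
  by rewrite mul0r subr0.
pose a := lf x; pose b := lf y; pose c := lf w.
have ex u v s : bcounit F u = 0 -> bcounit F s = 0 ->
    rho (tens (mulb F u v) s) + hbar * rho (tens (bmul F (ltrans F2 rho (tens u v))) s) =
    rho (tens u (mulb F v s)) + hbar * rho (tens u (bmul F (ltrans F2 rho (tens v s)))).
  by move=> u0 s0; have := coc_expand u v s; rewrite u0 s0 !mulr0 !addr0.
have dl u v s : rho (tens (mulb F u v) s) - rho (tens (mulb F v u) s) =
  hbar * rho (tens (hbrk F u v) s).
  have cl : cont_form (fun u => rho (tens u s)) by cf.
  have /= <- := linB (mulb F u v) (mulb F v u) (cf_lin cl).
  by rewrite (hbrkE bF comm); have /= -> := linZ hbar (hbrk F u v) (cf_lin cl).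
have dr u v s : rho (tens s (mulb F u v)) - rho (tens s (mulb F v u)) =
  hbar * rho (tens s (hbrk F u v)).
  have cl : cont_form (fun u => rho (tens s u)) by cf.
  have /= <- := linB (mulb F u v) (mulb F v u) (cf_lin cl).
  by rewrite (hbrkE bF comm); have /= -> := linZ hbar (hbrk F u v) (cf_lin cl).
have a0 := lfE x; have b0 := lfE y; have c0 := lfE w; rewrite -/a -/b -/c in a0 b0 c0.
have := alternate_sum (ex a b c a0 c0) (ex b c a b0 a0) (ex c a b c0 b0)
  (ex b a c b0 c0) (ex a c b a0 b0) (ex c b a c0 a0) (dl a b c) (dl b c a) (dl c a b)
  (dr b c a) (dr c a b) (dr a b c).
rewrite -[RHS](mulr0 hbar) => /hbar_inj /(congr1 (fun f : series k => f 0%N)).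
have redr u v : rho (tens u v) 0%N = r0 (tens (red u) (red v)).
  by rewrite (red_form_red _ crho) red_tens.
have rt u v : red (bmul F (ltrans F2 rho (tens u v))) = twist r0 (tens (red u) (red v)).
  by rewrite red_twist red_tens.
rewrite !(series_addE, series_oppE) !redr !rt -!(poisson_red bF comm) !lfr //.
have ml u v s : r0 (tens (u - v) s) = r0 (tens u s) - r0 (tens v s).
  have cl : cont_form (fun u => r0 (tens u s)) by cf.
  exact: (linB u v (cf_lin cl)).
have mr u v s : r0 (tens s (u - v)) = r0 (tens s u) - r0 (tens s v).
  have cl : cont_form (fun u => r0 (tens s u)) by cf.
  exact: (linB u v (cf_lin cl)).
rewrite !zform_tens -!twist_alternate !ml !mr => H.
rewrite -[RHS]H; ring.
Qed.

End FirstOrder.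

(** * The deformed Lie bialgebra *)

Section LieDeformation.
Variables (k : fieldType) (E B : Type).
Local Notation D := (discr k).
Variables (G : poisson_bialg D E) (fG : formal_poisson_group G).
Variables (pi : (E -> D) -> B -> D) (L : lie_data D B).
Hypothesis cot : cotangent_lie_bialgebra G pi L.
Variable z : (E * E -> D) -> D.
Hypothesis cz : cont_form z.
Hypothesis z_anti : forall t, z (flip t) = - z t.
Hypothesis z_der : forall a b c,
  z (tens (mulb G a b) c) = bcounit G a * z (tens b c) + bcounit G b * z (tens a c).
Hypothesis z_cyb : forall x y w, bcounit G x = 0 -> bcounit G y = 0 -> bcounit G w = 0 ->
  z (tens (poisson G x y) w) + z (tens (poisson G y w) x) + z (tens (poisson G w x) y)
  + (z (tens (bmul G (lform z (bcomul (btens G G) (tens x y)))) w)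
     + z (tens (bmul G (lform z (bcomul (btens G G) (tens y w)))) x)
     + z (tens (bmul G (lform z (bcomul (btens G G) (tens w x)))) y)) = 0.
Variable zeta : (B * B -> D) -> D.
Hypothesis czeta : cont_form zeta.
Hypothesis zetaE : forall x y, zeta (tens (pi x) (pi y)) = z (tens x y).

Let bG : bialgebra G := fpg_bialgebra fG.
Let cG : coalg G := bialg_coalg bG.
Let mG : cont_linear (bmul G) := bialg_mul bG.
Let dG : cont_linear (bcomul G) := coalg_comul cG.
Let eG : cont_form (bcounit G) := coalg_counit cG.
Let cpi : cont_linear pi := cot_cont cot.
Let ccobr : cont_linear (lcobr L) := lb_cobr_cont (cot_lie cot).
Let cbr : cont_linear (lbr L) := lb_br_cont (cot_lie cot).
Let cfl : cont_linear (@flip D E E) := @cl_flip _ (discr_adic k) E E.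

Let zl w : (E -> D) -> D := fun u => z (tens u w).
Let czl w : cont_form (zl w). Proof. by rewrite /zl; cf. Qed.
Let zr w : (E -> D) -> D := fun u => z (tens w u).
Let zrE w : zr w = - zl w.
Proof. by apply/funext => u; exact: z_tensC. Qed.
Let czr w : cont_form (zr w). Proof. by rewrite /zr; cf. Qed.

Lemma z_bmul s w : z (tens (bmul G s) w) =
  tform (bcounit G) (zl w) s + tform (zl w) (bcounit G) s.
Proof.
have c := czl w; move: s; apply: cf_ext => [||x y]; [by cf|by cf|].
rewrite -[bmul G _]/(mulb G x y) z_der !tform_tens // /zl; ring.
Qed.

(** The derivation rule puts eps on x_(2) or on y_(2), leaving z(x, y_(1)) z(y_(2), w) + z(x_(1), y)
    z(x_(2), w). *)
Lemma z_twist x y w : z (tens (bmul G (lform z (bcomul (btens G G) (tens x y)))) w) =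
  z (tens x (rtrans G (zl w) y)) + z (tens (rtrans G (zl w) x) y).
Proof.
have c := czl w.
have c1 : cont_form (tform (bcounit G) (zl w)) by cf.
have c2 : cont_form (tform (zl w) (bcounit G)) by cf.
rewrite z_bmul -[lform z _]/(ltrans (btens G G) z (tens x y)) -!conv_ltrans // !conv_rtrans.
by rewrite !rtrans_tens // !rtrans1.
Qed.

Lemma tform_lcobr (phi psi : (B -> D) -> D) x : cont_form phi -> cont_form psi ->
  tform phi psi (lcobr L (pi x)) =
  (phi \o pi) (rtrans G (psi \o pi) x) - (psi \o pi) (rtrans G (phi \o pi) x).
Proof.
move=> cp cq; rewrite (lcobr_pi fG cot) tform_tmap //.
have cp' : cont_form (phi \o pi) by rewrite /comp; cf.
have cq' : cont_form (psi \o pi) by rewrite /comp; cf.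
have ct : cont_form (tform (phi \o pi) (psi \o pi)) by cf.
rewrite (linB _ _ (cf_lin ct)); congr (_ - _).
by rewrite tformC.
Qed.

Lemma rtrans_opp a x : rtrans G (- a) x = - rtrans G a x.
Proof. by []. Qed.

Lemma z_oppr x y : z (tens x (- y)) = - z (tens x y).
Proof. exact: (linN y (cf_lin (czr x))). Qed.

Lemma z_oppl x y : z (tens (- x) y) = - z (tens x y).
Proof. exact: (linN x (cf_lin (czl y))). Qed.

(** Each of the three cobrackets in [[zeta, zeta]] gives two terms. Up to antisymmetry they are the
    six terms that [z_twist] produces from [z_cyb]. *)
Lemma cobound_dual_cyb u v t : cobound L zeta u v t + dual_cyb L zeta u v t = 0.
Proof.
(* Representatives are taken in m, as [z_cyb] requires. *)
have [x x0 <-] := cot_surj cot u; have [y y0 <-] := cot_surj cot v.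
have [w w0 <-] := cot_surj cot t.
have cl b : cont_form (fun x => zeta (tens x b)) by cf.
have cr b : cont_form (fun x => zeta (tens b x)) by cf.
have El b : (fun x => zeta (tens x (pi b))) \o pi = zl b.
  by apply/funext => c; exact: zetaE.
have Er b : (fun x => zeta (tens (pi b) x)) \o pi = zr b.
  by apply/funext => c; exact: zetaE.
rewrite /cobound /dual_cyb !tform_lcobr // !El !Er !(brk_pi fG cot) !zetaE.
have := z_cyb x0 y0 w0; rewrite !z_twist !zrE !rtrans_opp.
rewrite -![zl _ (rtrans _ _ _)]/(z (tens _ _)) -![(- zl _) _]/(- z (tens _ _)).
rewrite -![zl w (- _)]/(z (tens _ _)) ?(z_oppl, z_oppr) ?opprK => <-.
rewrite (z_tensC z_anti x) (z_tensC z_anti y (rtrans _ _ _)) (z_tensC z_anti w).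
ring.
Qed.

Lemma zeta_anti u v : zeta (tens u v) = - zeta (tens v u).
Proof.
have [x <-] := pi_surj cot u; have [y <-] := pi_surj cot v.
by rewrite !zetaE; exact: z_tensC.
Qed.

Lemma zeta_2cocycle : lie_2cocycle L zeta.
Proof.
split=> // psi cpsi.
have tf0 t : tform psi (fun _ : B -> D => 0 : D) t = 0 by exact: lin0 (cf_lin cpsi).
split=> [a b c|a b].
  have -> : (fun x y w => cobound L zeta x y w + dual_cyb L zeta x y w) = fun _ _ _ => 0.
    by apply/funext => x; apply/funext => y; apply/funext => w; exact: cobound_dual_cyb.
  by rewrite /ad3 /dual_brk !tf0 !addr0.
have -> : (fun x y => zeta (tens x y) + zeta (tens y x)) = fun _ _ => 0.
  by apply/funext => x; apply/funext => y; rewrite zeta_anti addNr.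
by rewrite /ad2 /dual_brk !tf0 addr0.
Qed.

Lemma contract_pi x y b : contract L zeta (tens (pi x) (pi y)) b =
  z (tens (rtrans G (pib pi b) x) y) - z (tens (ltrans G (pib pi b) x) y).
Proof.
have cb := cf_pib cot b.
transitivity (z (tens (rtrans G (pib pi b) x - ltrans G (pib pi b) x) y)); last first.
  exact: (linB (rtrans G (pib pi b) x) (ltrans G (pib pi b) x) (cf_lin (czl y))).
rewrite -zetaE /contract; congr zeta; apply/funext => -[b1 b2]; rewrite /lmap /tens /=.
rewrite (cl_mulr _ _ _ ccobr) (lcobr_pi fG cot); congr (_ * _).
congr (pi _ b1); apply/funext => e.
exact: (linB (fun e' => bcomul G x (e, e')) (fun e' => bcomul G x (e', e)) (cf_lin cb)).
Qed.

Variable pb' : (E * E -> D) -> E -> D.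
Hypothesis pbE : forall t, pb' t = pbr G t +
  (bmul G (lform z (bcomul (btens G G) t)) - bmul G (rform z (bcomul (btens G G) t))).
(** The bialgebra is literally that of G, so that eps, m and [pi] are shared. *)
Let G' : poisson_bialg D E := PoissonBialg (pbialg G) pb'.
Hypothesis fG' : formal_poisson_group G'.
Let L' := lie_deform L zeta.

(** In each correction term [pi], a derivation over eps, keeps one factor and evaluates the other by
    eps. What remains are the contractions of zeta found in [contract_pi]. *)
Lemma brk_deform_pi x y : brk L' (pi x) (pi y) = pi (poisson G' x y).
Proof.
rewrite /poisson /= pbE (clD _ _ cpi) (clB _ _ cpi) -[pi (pbr G _)](brk_pi fG cot).
apply/funext => b; have cb := cf_pib cot b.
have c1 : cont_form (tform (bcounit G) (pib pi b)) by cf.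
have c2 : cont_form (tform (pib pi b) (bcounit G)) by cf.
rewrite -[LHS]/(brk L (pi x) (pi y) b + contract L zeta (tens (pi x) (pi y)) b
  - contract L zeta (flip (tens (pi x) (pi y))) b) flip_tens !contract_pi.
rewrite -[RHS]/(brk L (pi x) (pi y) b + (pi (bmul G (lform z (bcomul (btens G G) (tens x
  y)))) b -
  pi (bmul G (rform z (bcomul (btens G G) (tens x y)))) b)) !(pi_bmul fG cot).
rewrite -[lform z _]/(ltrans (btens G G) z (tens x y)) -[rform z _]/(rtrans (btens G G) z
  (tens x y)).
(* Translations are transposes of each other: phi(z(t_(1)) t_(2)) = z(t_(1) phi(t_(2))). *)
have h1 phi : cont_form phi -> phi (ltrans (btens G G) z (tens x y)) =
  z (rtrans (btens G G) phi (tens x y)).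
  by move=> cp; rewrite -conv_rtrans conv_ltrans.
have h2 phi : cont_form phi -> phi (rtrans (btens G G) z (tens x y)) =
  z (ltrans (btens G G) phi (tens x y)).
  by move=> cp; rewrite -conv_ltrans // conv_rtrans.
rewrite (h1 _ c1) (h1 _ c2) (h2 _ c1) (h2 _ c2) !rtrans_tens // !ltrans_tens // !rtrans1 //
  !ltrans1 //.
rewrite (z_tensC z_anti x (rtrans _ _ y)) (z_tensC z_anti x (ltrans _ _ y)).
ring.
Qed.

Let cpb' : cont_linear pb' := fpg_pbr_cont fG'.

Lemma cl_lbr_deform : cont_linear (lbr L').
Proof. by rewrite /L' /= /contract; cf. Qed.
Let cbr' := cl_lbr_deform.

Let cbrk u : cont_linear (brk L' u).
Proof. by rewrite /brk; cf. Qed.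

Lemma brk_deform_anti u v : brk L' u v = - brk L' v u.
Proof.
have [x <-] := pi_surj cot u; have [y <-] := pi_surj cot v.
by rewrite !brk_deform_pi (fpg_anti fG') (clN _ cpi).
Qed.

Lemma lmap_tens X Y Z (f : (X -> D) -> Y -> D) u (v : Z -> D) : cont_linear f ->
  lmap f (tens u v) = tens (f u) v.
Proof. by move=> cf; apply/funext => -[y x]; rewrite /lmap /tens /= (cl_mulr _ _ _ cf). Qed.

Lemma rmap_tens X Y Z (f : (X -> D) -> Y -> D) u (v : Z -> D) : cont_linear f ->
  rmap f (tens v u) = tens v (f u).
Proof. by move=> cf; apply/funext => -[y x]; rewrite /rmap /tens /= (cl_mull _ _ _ cf). Qed.

Lemma brk_deformZ a u v : brk L' (a \*o u) v = a \*o brk L' u v.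
Proof.
have cb : cont_linear (fun u => brk L' u v) by cf.
exact: clZ cb.
Qed.

(** For s = a (x) b and t = c (x) d, the second factor is pi(b d) = eps(b) pi(d) + eps(d) pi(b), so
    {a, c} (x) b d becomes two adjoint actions. *)
Lemma tmap_pi_brkl s t : tmap pi pi (tmap pb' (bmul G) (mid4 (tens s t))) =
  lmap (brk L' (pi (rform (bcounit G) s))) (tmap pi pi t)
  - lmap (brk L' (pi (rform (bcounit G) t))) (tmap pi pi s).
Proof.
move: s; apply: cl_ext => [||a b]; [by cf|by cf|].
move: t; apply: cl_ext => [||c d]; [by cf|by cf|].
rewrite mid4_tens !tmap_tens // -[pb' _]/(poisson G' a c) -[bmul G _]/(mulb G b d).
rewrite (pi_mulb fG cot) -brk_deform_pi !rform_tens // !(clZ _ _ cpi) !lmap_tens //.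
rewrite !brk_deformZ (brk_deform_anti (pi c)).
by apply/funext => -[b1 b2]; rewrite !fE /tens !fE /=; ring.
Qed.

Lemma tmap_pi_brkr s t : tmap pi pi (tmap (bmul G) pb' (mid4 (tens s t))) =
  rmap (brk L' (pi (lform (bcounit G) s))) (tmap pi pi t)
  - rmap (brk L' (pi (lform (bcounit G) t))) (tmap pi pi s).
Proof.
move: s; apply: cl_ext => [||a b]; [by cf|by cf|].
move: t; apply: cl_ext => [||c d]; [by cf|by cf|].
rewrite mid4_tens !tmap_tens // -[pb' _]/(poisson G' b d) -[bmul G _]/(mulb G a c).
rewrite (pi_mulb fG cot) -brk_deform_pi !lform_tens // !(clZ _ _ cpi) !rmap_tens //.
rewrite !brk_deformZ (brk_deform_anti (pi d)).
by apply/funext => -[b1 b2]; rewrite !fE /tens !fE /=; ring.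
Qed.

Lemma ad_tens2_lin u : cont_linear (ad_tens2 L' u).
Proof.
by change (cont_linear (fun t p => lmap (brk L' u) t p + rmap (brk L' u) t p)); cf.
Qed.

Lemma ad_tens2_flip u t : ad_tens2 L' u (flip t) = flip (ad_tens2 L' u t).
Proof. by apply/funext => -[b1 b2]; rewrite /ad_tens2 [LHS]addrC. Qed.

Lemma tmap_flip t : tmap pi pi (flip t) = flip (tmap pi pi t).
Proof.
apply/funext => -[b1 b2].
exact: (fubini (fun x y => t (y, x)) (cl_form b1 cpi) (cl_form b2 cpi)).
Qed.

(** The linear part of the compatibility of the bracket with Delta; antisymmetrized, it is the
    cocycle condition for the cobracket. *)
Lemma tmap_pi_comul x y : tmap pi pi (bcomul G (poisson G' x y)) =
  ad_tens2 L' (pi x) (tmap pi pi (bcomul G y)) - ad_tens2 L' (pi y) (tmap pi pi (bcomul G x)).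
Proof.
have ct : cont_linear (tmap pi pi) by exact: cl_tmap.
rewrite -[bcomul G (poisson _ _ _)]/(bcomul G' (poisson G' x y)) (fpg_comul fG').
rewrite (clD _ _ ct) tmap_pi_brkl tmap_pi_brkr !(coalg_counitr cG) !(coalg_counitl cG).
by apply/funext => p; rewrite /ad_tens2 !fE; ring.
Qed.

Lemma lcobr_deform x y : lcobr L' (pi (poisson G' x y)) =
  ad_tens2 L' (pi x) (lcobr L' (pi y)) - ad_tens2 L' (pi y) (lcobr L' (pi x)).
Proof.
have ct : cont_linear (tmap pi pi) by exact: cl_tmap.
have ca u := ad_tens2_lin u.
rewrite /= !(lcobr_pi fG cot) !(clB _ _ ct) !tmap_flip tmap_pi_comul.
rewrite !(clB _ _ (ca _)) !ad_tens2_flip.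
by apply/funext => -[b1 b2]; rewrite !fE /flip /= !fE; ring.
Qed.

Lemma lie_bialgebra_deform : lie_bialgebra L'.
Proof.
have LL := cot_lie cot.
split.
- exact: cbr'.
- exact: ccobr.
- exact: brk_deform_anti.
- move=> u v w; have [x <-] := pi_surj cot u; have [y <-] := pi_surj cot v.
  have [t <-] := pi_surj cot w.
  by rewrite !brk_deform_pi -!(clD _ _ cpi) (fpg_jacobi fG') (cl0 cpi).
- exact: lb_coanti LL.
- exact: lb_cojacobi LL.
- move=> u v; have [x <-] := pi_surj cot u; have [y <-] := pi_surj cot v.
  by rewrite brk_deform_pi; exact: lcobr_deform.
Qed.

Lemma cotangent_deform : cotangent_lie_bialgebra G' pi L'.
Proof.
case: (cot) => c1 c2 c3 c4 c5 c6 c7 c8; split=> //.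
- exact: lie_bialgebra_deform.
- by move=> x y _ _; exact: brk_deform_pi.
Qed.

End LieDeformation.

(** * From the 2-cocycle to the deformed formal Poisson group *)

Theorem theorem3p2p1 (k : fieldType) (char0 : [pchar k] =i pred0)
  (E B : Type) (F : bialg (series k) E) (G : poisson_bialg (discr k) E)
  (F_over_G : QFSHA_over F G)
  (pi : (E -> discr k) -> (B -> discr k)) (gstar : lie_data (discr k) B)
  (gstar_cotangent : cotangent_lie_bialgebra G pi gstar)
  (sigma sigma' : (E * E -> series k) -> series k)
  (sigma_cocycle : hopf_2cocycle F sigma sigma')
  (sigma_cong : hcong (bialg2 F) sigma (bcounit (bialg2 F))) :
  exists vs : (E * E -> series k) -> series k,
    [/\ dual (bialg2 F) vs,
        is_conv_log (bialg2 F) sigma (hbar \*o vs),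
        is_conv_exp (bialg2 F) (hbar \*o vs) sigma,
        (flip_form vs = - vs <-> flip_form sigma = sigma') &
        exists zeta : (B * B -> discr k) -> discr k,
          [/\ cont_form zeta,
              (forall x y, aug_ideal G x -> aug_ideal G y ->
                 zeta (tens (pi x) (pi y)) =
                 red_form (vs - flip_form vs) (tens x y)),
              (forall u v, zeta (tens u v) = - zeta (tens v u)),
              lie_2cocycle gstar zeta &
              exists G_zeta : poisson_bialg (discr k) E,
                QFSHA_over (cocycle_deform F sigma sigma') G_zeta /\
                cotangent_lie_bialgebra G_zeta pi (lie_deform gstar zeta)]].
Proof.
have [[hopfF commF compF] fG GE] := F_over_G.
have bF : bialgebra F by exact: hopf_bialgebra.
have [rho drho srho] := sigma_cong.
have crho : cont_form rho by case: drho.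
have [vs [dvs vslog vsexp vsflip [w dw vsE]]] := conv_log_exp char0 bF sigma_cocycle drho srho.
exists vs; split=> //.
subst G.
have bG : bialgebra (red_bialg F) by exact: fpg_bialgebra fG.
pose z := zform rho.
have cz : cont_form z by exact: cf_zform.
have z_anti := @zform_anti _ _ rho.
have z_der := zform_der bF sigma_cocycle crho srho commF.
have z_cyb := zform_cyb bF sigma_cocycle crho srho commF bG.
have [zeta [czeta zetaE]] := zeta_exists fG gstar_cotangent cz z_anti z_der.
(* The logarithm [vs] differs from [rho] by a multiple of hbar, so z may be computed from either. *)
have zE t : z t = red_form (vs - flip_form vs) t.
  have vs0 u : vs u 0%N = rho u 0%N by rewrite vsE !fE series_addE hbar0 addr0.
  have -> : red_form (vs - flip_form vs) t =
    vs (Defs.lift t) 0%N - vs (flip (Defs.lift t)) 0%N by [].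
  by rewrite !vs0.
have QFs := QFSHA_deform bF sigma_cocycle srho (And3 hopfF commF compF).
have redE := red_bialg_deform bF sigma_cocycle srho.
exists zeta; split=> //.
- by move=> x y _ _; rewrite zetaE zE.
- move=> u v; refine (zeta_anti gstar_cotangent z_anti zetaE u v).
- refine (zeta_2cocycle fG gstar_cotangent cz z_anti z_der z_cyb czeta zetaE).
pose Fs := cocycle_deform F sigma sigma'.
rewrite -/Fs in QFs redE *.
have [hopfFs commFs compFs] := QFs.
have bFs : bialgebra Fs by exact: hopf_bialgebra.
have fGs : formal_poisson_group (semiclassical Fs).
  apply: semiclassical_formal_poisson_group => //.
  by rewrite redE; exact: fpg_hopf fG.
(* The limit is rewritten over the undeformed bialgebra, the form in which [cotangent_deform] takes
   it. *)
have GsE : semiclassical Fs = PoissonBialg (red_bialg F) (pbr (semiclassical Fs)).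
  by rewrite -redE.
exists (semiclassical Fs); split; first by split.
rewrite GsE.
apply: (cotangent_deform fG gstar_cotangent cz z_anti czeta zetaE).
- move=> t; exact: (pbr_deform bF sigma_cocycle crho srho commF bG).
- by rewrite -GsE.
Qed.
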